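(* Let $n>2$, let $K$ be a positive integer, and let $\mu=(\mu_{1-n},\dots,\mu_0)\in\mathbb Z^n$ satisfy $\mu_0+K\ge\mu_{1-n}\ge\mu_{2-n}\ge\dots\ge\mu_{-1}\ge\mu_0$. The character of the vector space $V(\mu)$ with basis $\{\langle\widetilde{\underline d}\rangle\}_{\widetilde{\underline d}\in D(\mu)}$ indexed by affine Gelfand–Tsetlin patterns equals the character of the irreducible integrable $\widehat{\mathfrak{gl}}_n$-module with highest weight $\mu$. Explicitly, $$\sum_{\widetilde{\underline d}\in D(\mu)}e^{\Lambda_\mu-\sum_{i=0}^{n-1}d_i(\widetilde{\underline d})\alpha_i}=\operatorname{ch}L(\Lambda_\mu)\cdot\prod_{m\ge1}\frac1{1-e^{-m\delta}}.$$
   Context: **Affine Gelfand–Tsetlin patterns.** Extend $\mu$ to the nonincreasing sequence $\widetilde\mu_i:=\mu_{i\bmod n}+\lfloor\frac{-i}n\rfloor K$, $i\in\mathbb Z$, where $i\bmod n$ is taken in $\{1-n,\dots,0\}$. $D$ is the set of collections $\widetilde{\underline d}=(d_{ij})_{i\ge j,\ i,j\in\mathbb Z}$ of nonnegative integers with $d_{kj}\ge d_{ij}$ for all $i\ge k\ge j$, $d_{i+n,j+n}=d_{ij}$, and $d_{ij}=0$ for $i-j\gg0$. $D(\mu)\subset D$ is the set of those with $d_{ij}-\widetilde\mu_j\le d_{i+l,j+l}-\widetilde\mu_{j+l}$ for all $j\le i$, $l\ge0$. Put $d_k(\widetilde{\underline d})=\sum_{j\le k}d_{kj}$, which depends only on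 $k$ mod $n$. **Weights.** In the $\widehat{\mathfrak{sl}}_n$-module $V(\mu)$ the Chevalley Cartan generator $\mathfrak h_i$ acts on $\langle\widetilde{\underline d}\rangle$ by $-(\widetilde\mu_i-\widetilde\mu_{i+1})+2d_i-d_{i-1}-d_{i+1}$, where the generators $\mathfrak e_i$ raise $d_i$ by $1$. In the usual highest weight convention (simple coroots act as $-\mathfrak h_i$) the vector $\langle\widetilde{\underline d}\rangle$ has weight $\Lambda_\mu-\sum_id_i\alpha_i$, with $\alpha_0,\dots,\alpha_{n-1}$ the simple roots of $\widehat{\mathfrak{sl}}_n$, $\delta=\sum_i\alpha_i$, $\Lambda_0,\dots,\Lambda_{n-1}$ the fundamental weights, and $\Lambda_\mu=\sum_{i=0}^{n-1}(\widetilde\mu_i-\widetilde\mu_{i+1})\Lambda_i$, which is dominant of level $K$. **$\widehat{\mathfrak{gl}}_n$.** $\widehat{\mathfrak{gl}}_n$ is the quotient of $\mathfrak H\oplus\widehat{\mathfrak{sl}}_n$ by identifying the central element of the Heisenberg algebra $\mathfrak H$ (generators $a_i$, $i\in\mathbb Z$, and central $C'$, $[a_p,a_q]=\delta_{p,-q}pC'$) with $n$ times that of $\widehat{\mathfrak{sl}}_n$. The irreducible integrable module with highest weight $\mu$ is the tensor product of the irreducible integrable $\widehat{\mathfrak{sl}}_n$-module $L(\Lambda_\mu)$ and the Fock module of $\mathfrak H$, the latter having character $\prod_{m\ge1}(1-e^{-m\delta})^{-1}$. *)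

(* Defs.v *)
From HB Require Import structures.
From mathcomp Require Import all_boot all_order all_algebra.
From mathcomp Require Import complex.
From mathcomp Require Import boolp classical_sets functions cardinality fsbigop.
From mathcomp Require Import reals.

Set Implicit Arguments.
Unset Strict Implicit.
Unset Printing Implicit Defensive.

Import Order.TTheory GRing.Theory Num.Theory.
Local Open Scope classical_set_scope.
Local Open Scope card_scope.
Local Open Scope ring_scope.

(** * Affine Gelfand-Tsetlin patterns *)

(* The tuple lists (mu_{1-n}, ..., mu_0) in this order; [mu_at mu i] is mu_i
   and is only meaningful for 1 - n <= i <= 0. *)
Definition mu_at (n : nat) (mu : n.-tuple int) (i : int) : int :=
  nth 0 mu (absz (i + n%:Z - 1)%R).

Definition mu_admissible (n K : nat) (mu : n.-tuple int) : Prop :=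
  (forall i : int, 1 - n%:Z <= i < 0 -> mu_at mu (i + 1) <= mu_at mu i) /\
  mu_at mu (1 - n%:Z) <= mu_at mu 0 + K%:Z.

(* [- ((- i) %% n)] is the representative of i modulo n in {1-n, ..., 0}. *)
Definition mu_tilde (n K : nat) (mu : n.-tuple int) (i : int) : int :=
  mu_at mu (- ((- i) %% n%:Z)%Z) + ((- i) %/ n%:Z)%Z * K%:Z.

(* A collection (d_ij)_{i >= j} is encoded as a total function that vanishes
   for i < j, so that equality of patterns is equality of functions. *)
Definition pattern := int -> int -> nat.

Definition affGT (n : nat) : set pattern :=
  [set d | [/\ forall i j, i < j -> d i j = 0%N,
               forall i k j, j <= k -> k <= i -> (d i j <= d k j)%N,
               forall i j, d (i + n%:Z) (j + n%:Z) = d i j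
             & exists N : int, forall i j, N <= i - j -> d i j = 0%N]].

Definition affGTmu (n K : nat) (mu : n.-tuple int) : set pattern :=
  [set d | affGT n d /\
     forall i j l : int, j <= i -> 0 <= l ->
       (d i j)%:Z - mu_tilde K mu j
         <= (d (i + l) (j + l))%:Z - mu_tilde K mu (j + l)].

(* For d in [affGT n] the support of the sum is finite. *)
Definition row_sum (d : pattern) (k : int) : nat :=
  (\sum_(j \in [set j : int | (j <= k)%R]) d k j)%N.

(** * Weights of the affine Kac-Moody algebra of type A_{n-1}^(1) *)

(* The simple coroots together with the derivation (scaling element) form a
   basis of the Cartan subalgebra; a weight is given by its values on the
   coroots (first component) and on the derivation (second component). *)
Definition weight (F : fieldType) (n : nat) : zmodType := ('rV[F]_n * F)%type.

(* Since n > 2 the three indicators have disjoint supports. *)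
Definition cartan (n : nat) (i j : 'I_n) : int :=
  (i == j)%:R *+ 2 - (i == ordS j)%:R - (j == ordS i)%:R.

Definition simple_root (F : fieldType) (n : nat) (j : 'I_n) : weight F n :=
  (\row_i (cartan i j)%:~R, (j == 0 :> nat)%:R).

Definition delta (F : fieldType) (n : nat) : weight F n :=
  \sum_i simple_root F i.

Definition fund_weight (F : fieldType) (n : nat) (i : 'I_n) : weight F n :=
  (delta_mx 0 i, 0).

Definition Lambda_mu (F : fieldType) (n K : nat) (mu : n.-tuple int) :
    weight F n :=
  \sum_(i < n) fund_weight F i *~ (mu_tilde K mu i%:Z - mu_tilde K mu (i%:Z + 1)).

Definition pattern_weight (F : fieldType) (n K : nat) (mu : n.-tuple int)
    (d : pattern) : weight F n :=
  Lambda_mu F K mu - \sum_(i < n) simple_root F i *+ row_sum d i%:Z.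

(** * Representations of affine sl_n *)

Definition commutator (F : fieldType) (V : lmodType F) (X Y : V -> V) : V -> V :=
  fun v => X (Y v) - Y (X v).

(* Representations of affine sl_n (including the derivation), presented by
   Chevalley generators and Serre relations. *)
Record aff_rep (F : fieldType) (n : nat) (V : lmodType F) := AffRep {
  rep_e : 'I_n -> {linear V -> V};
  rep_f : 'I_n -> {linear V -> V};
  rep_h : 'I_n -> {linear V -> V};
  rep_d : {linear V -> V};
  rep_hh : forall i j v, commutator (rep_h i) (rep_h j) v = 0;
  rep_dh : forall i v, commutator rep_d (rep_h i) v = 0;
  rep_he : forall i j v,
    commutator (rep_h i) (rep_e j) v = (simple_root F j).1 0 i *: rep_e j v;
  rep_hf : forall i j v,
    commutator (rep_h i) (rep_f j) v = - ((simple_root F j).1 0 i *: rep_f j v);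
  rep_de : forall j v,
    commutator rep_d (rep_e j) v = (simple_root F j).2 *: rep_e j v;
  rep_df : forall j v,
    commutator rep_d (rep_f j) v = - ((simple_root F j).2 *: rep_f j v);
  rep_ef : forall i j v,
    commutator (rep_e i) (rep_f j) v = if i == j then rep_h i v else 0;
  rep_serre_e : forall i j v, i != j ->
    iter (absz (1 - cartan i j)%R) (commutator (rep_e i)) (rep_e j) v = 0;
  rep_serre_f : forall i j v, i != j ->
    iter (absz (1 - cartan i j)%R) (commutator (rep_f i)) (rep_f j) v = 0
}.

Section Representations.
Variables (F : fieldType) (n : nat) (V : lmodType F) (rho : aff_rep n V).

Definition subrep (W : set V) : Prop :=
  [/\ W 0,
      forall (a : F) u v, W u -> W v -> W (a *: u + v),
      forall i v, W v -> [/\ W (rep_e rho i v), W (rep_f rho i v)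
                           & W (rep_h rho i v)]
    & forall v, W v -> W (rep_d rho v)].

Definition irreducible_rep : Prop :=
  (exists v : V, v != 0) /\
  forall W : set V, subrep W -> W = [set 0] \/ W = setT.

Definition weight_space (lam : weight F n) : set V :=
  [set v | (forall i, rep_h rho i v = lam.1 0 i *: v) /\
           rep_d rho v = lam.2 *: v].

Definition integrable_rep : Prop :=
  (forall v, exists s : seq V,
     v = \sum_(u <- s) u /\
     forall u, u \in s -> exists lam, weight_space lam u) /\
  (forall i v, exists N : nat,
     iter N (rep_e rho i) v = 0 /\ iter N (rep_f rho i) v = 0).

Definition has_highest_weight (lam : weight F n) : Prop :=
  exists v : V,
    [/\ v != 0, weight_space lam v & forall i, rep_e rho i v = 0].

(* [rho] is (a copy of) L(lam). *)
Definition irr_integrable_hw (lam : weight F n) : Prop :=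
  [/\ irreducible_rep, integrable_rep & has_highest_weight lam].

End Representations.

(** * Formal characters *)

(* For a linear subspace S: S has a basis with m elements. *)
Definition has_dim (F : fieldType) (V : lmodType F) (S : set V) (m : nat) : Prop :=
  exists b : 'I_m -> V,
    (forall i, S (b i)) /\
    forall v, S v -> exists! c : 'rV[F]_m, v = \sum_i c 0 i *: b i.

(* The formal sum of the c(lam) e^lam is represented by its coefficients c. *)
Definition fchar (F : fieldType) (n : nat) := weight F n -> nat.

Definition is_character (F : fieldType) (n : nat) (V : lmodType F)
    (rho : aff_rep n V) (c : fchar F n) : Prop :=
  forall lam, has_dim (weight_space rho lam) (c lam).

(* c is the (well-defined) formal sum of e^(w i) over i in A. *)
Definition is_fsum (F : fieldType) (n : nat) (I : Type) (A : set I)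
    (w : I -> weight F n) (c : fchar F n) : Prop :=
  forall lam, [set i | A i /\ w i = lam] #= `I_(c lam).

(* c is the (well-defined) product of the formal characters a and b. *)
Definition is_fprod (F : fieldType) (n : nat) (a b c : fchar F n) : Prop :=
  forall lam,
    finite_set [set p : weight F n * weight F n |
                p.1 + p.2 = lam /\ (a p.1 * b p.2 != 0)%N] /\
    c lam = (\sum_(p \in [set p : weight F n * weight F n |
                          (p.1 + p.2)%R = lam]) (a p.1 * b p.2))%N.

(* The coefficient of q^N in the product over m >= 1 of
   1/(1 - q^m) = 1 + q^m + q^(2m) + ...; only the factors with m <= N and
   the terms q^(mj) with j <= N contribute to it. *)
Definition fock_coef (N : nat) : nat :=
  ((\prod_(1 <= m < N.+1) \sum_(0 <= j < N.+1) 'X^(m * j) : {poly nat})`_N)%R.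

(* The product over m >= 1 of 1/(1 - e^(- m delta)); for given lam at most
   one N contributes to the sum. *)
Definition fock_char (F : fieldType) (n : nat) : fchar F n :=
  fun lam => (\sum_(N \in [set N : nat | lam = (- (delta F n *+ N))%R])
                 fock_coef N)%N.
Arguments fock_char F n _ : clear implicits.

(* Main.v *)
Require Import Defs.
From HB Require Import structures.
From mathcomp Require Import all_boot all_order all_algebra.
From mathcomp Require Import complex.
From mathcomp Require Import boolp classical_sets functions cardinality fsbigop.
From mathcomp Require Import reals.
From mathcomp Require Import perm mpoly zify ring.

(* Write P(c), m(c) and D(c) for the number of patterns in D(mu) of weight
   Lambda_mu - c, the multiplicity of that weight in L(Lambda_mu) and the number of
   all patterns in D with row sums c; D is the coefficient sequence of the product
   of 1 / (1 - e^beta) over the positive roots, imaginary ones taken n times.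
   With eo(j) = j - mu~_j, the pattern d becomes the family of lattice paths
   i |-> d_ij + eo(j), which is nonintersecting exactly when d lies in D(mu).
   Swapping the tails of adjacent paths cancels the intersecting families in a sum
   over affine permutations w, which gives P = N * D for a signed sequence N
   supported on the quadric where the Casimir value of c vanishes; Bender-Knuth
   involutions give the reflection invariance of P. For mu = 0 this reads
   phi = N0 * D with phi the coefficients of the Fock character.
   The Casimir operator and the traces of f_beta e_beta on weight spaces yield
   Freudenthal's recursion for m, by which m * N0 is supported on the same quadric.
   Hence m * phi - P = (m * N0 - N) * D; a lowest term c of this difference lies on
   the quadric and, by reflection invariance, is dominant, and this forces c = 0,
   where both sides are 1. *)

(** The module is given by Chevalley generators only, so root vectors cannot be read off from loop
    matrices. They are built as iterated brackets in the endomorphism ring and labelled by the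
    periodic matrix they should be. That the label determines the operator comes from
    irreducibility: a raising element of degree at least 2 commuting with every [f j], or a lowering
    one commuting with every [e j], is zero. In imaginary degrees n spanning elements are used in
    place of a basis of n - 1 traceless ones; in the Casimir sum they act like dual bases. The
    support of m * N0 is found by reading the Casimir value as a second-order differential operator
    C on generating series. In C(m * N0) the term C(m) * N0 cancels the cross term, because N0 = phi
    / D has as logarithmic derivative minus the root sum that Freudenthal's recursion puts into
    C(m). What remains is m * C_0(N0), with C_0 the operator for weight 0, and this vanishes by the
    support of N0. Of the permutation sums N and N0, only the supports and the two convolution
    identities enter the comparison. *)

Set Implicit Arguments.
Unset Strict Implicit.
Unset Printing Implicit Defensive.

Import Order.TTheory GRing.Theory Num.Theory.
Local Open Scope classical_set_scope.
Local Open Scope ring_scope.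

(** * Root vectors and Casimir elements *)

Section RootVectors.
Variables (n' : nat) (F : numFieldType) (E : pzRingType) (sc : {rmorphism F -> E}).
Hypothesis scC : forall z X, sc z * X = X * sc z.
Local Notation n := n'.+3.
Local Notation I := 'I_n'.+3.

Definition lie (X Y : E) : E := X * Y - Y * X.

Lemma lieDl X Y Z : lie (X + Y) Z = lie X Z + lie Y Z.
Proof. by rewrite /lie mulrDl mulrDr opprD addrACA. Qed.
Lemma lieDr X Y Z : lie X (Y + Z) = lie X Y + lie X Z.
Proof. by rewrite /lie mulrDl mulrDr opprD addrACA. Qed.
Lemma lieC X Y : lie Y X = - lie X Y.
Proof. by rewrite /lie opprB. Qed.
Lemma lieNl X Y : lie (- X) Y = - lie X Y.
Proof. by rewrite /lie mulrN mulNr opprD. Qed.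
Lemma lieNr X Y : lie X (- Y) = - lie X Y.
Proof. by rewrite /lie mulrN mulNr opprD. Qed.
Lemma lie0r X : lie X 0 = 0.
Proof. by rewrite /lie mulr0 mul0r subrr. Qed.
Lemma lieZl z X Y : lie (sc z * X) Y = sc z * lie X Y.
Proof. by rewrite /lie mulrBr -!mulrA [Y * _]mulrA -scC -mulrA. Qed.
Lemma lieZr z X Y : lie X (sc z * Y) = sc z * lie X Y.
Proof. by rewrite lieC lieZl -mulrN -lieC. Qed.
Lemma lie_sumr (J : Type) (r : seq J) (P : pred J) X (G : J -> E) :
  lie X (\sum_(i <- r | P i) G i) = \sum_(i <- r | P i) lie X (G i).
Proof.
by apply: (big_morph (lie X)); [exact: lieDr|exact: lie0r].
Qed.
Lemma lie_suml (J : Type) (r : seq J) (P : pred J) X (G : J -> E) :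
  lie (\sum_(i <- r | P i) G i) X = \sum_(i <- r | P i) lie (G i) X.
Proof.
rewrite lieC lie_sumr -sumrN; apply: eq_bigr => i _; by rewrite -lieC.
Qed.
Lemma lie_jacobi X Y Z : lie X (lie Y Z) = lie (lie X Y) Z + lie Y (lie X Z).
Proof.
rewrite /lie !mulrBr !mulrBl !mulrA !opprB [RHS]addrACA !subrKA.
by rewrite addrACA [RHS]addrACA [- _ - _]addrC.
Qed.
Lemma lieM X Y Z : lie X (Y * Z) = lie X Y * Z + Y * lie X Z.
Proof. by rewrite /lie mulrBl mulrBr !mulrA addrA subrK. Qed.

Definition lincomb (g : I -> E) (a : I -> F) : E := \sum_i sc (a i) * g i.

(* Coefficients of the bracket of [sum_i b_i E_{i,i+1}] with [sum_i a_i E_{i,i+k}]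
   for n-periodic matrix units [E_{i,j}], the indices being read modulo n. *)
Definition adjoint_coef (k : nat) (b a : I -> F) : I -> F :=
  fun i => b i * a (i + 1) - a i * b (i + k%:R).

(* [root_span g k a X]: X is obtained from the generators g by the iterated
   brackets that produce the periodic matrix [sum_i a_i E_{i,i+k}]. *)
Inductive root_span (g : I -> E) : nat -> (I -> F) -> E -> Prop :=
| root_span1 a : root_span g 1 a (lincomb g a)
| root_spanB k b a X : root_span g k a X ->
    root_span g k.+1 (adjoint_coef k b a) (lie (lincomb g b) X)
| root_spanD k a1 a2 X1 X2 : root_span g k a1 X1 -> root_span g k a2 X2 ->
    root_span g k (fun i => a1 i + a2 i) (X1 + X2).

Lemma root_span_ext g k a1 a2 X1 X2 : root_span g k a1 X1 ->
  a1 =1 a2 -> X1 = X2 -> root_span g k a2 X2.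
Proof. by move=> H /funext <- <-. Qed.

Lemma lincombD g a b : lincomb g (fun i => a i + b i) = lincomb g a + lincomb g b.
Proof. by rewrite -big_split; apply: eq_bigr => i _; rewrite rmorphD mulrDl. Qed.

Lemma lincombZ g z a : lincomb g (fun i => z * a i) = sc z * lincomb g a.
Proof. by rewrite mulr_sumr; apply: eq_bigr => i _; rewrite rmorphM mulrA. Qed.

Lemma lincomb_delta g (i : I) : lincomb g (fun j => (j == i)%:R) = g i.
Proof.
rewrite /lincomb (bigD1 i) //= eqxx rmorph1 mul1r big1 ?addr0 // => j /negPf ->.
by rewrite rmorph0 mul0r.
Qed.

Lemma root_spanZ g k a X z : root_span g k a X ->
  root_span g k (fun i => z * a i) (sc z * X).
Proof.
move=> H; elim: H z => {k a X} [a|k b a X _ IH|k a1 a2 X1 X2 _ IH1 _ IH2] z.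
- rewrite -lincombZ; exact: root_span1.
- apply: root_span_ext (root_spanB b (IH z)) _ _; last by rewrite lieZr.
  by move=> i; rewrite /adjoint_coef; ring.
- apply: root_span_ext (root_spanD (IH1 z) (IH2 z)) _ _; last by rewrite mulrDr.
  by move=> i; rewrite mulrDr.
Qed.

Lemma root_spanN g k a X : root_span g k a X -> root_span g k (fun i => - a i) (- X).
Proof.
move=> /(root_spanZ (-1)) H; apply: root_span_ext H _ _.
  by move=> i; rewrite mulN1r.
by rewrite rmorphN rmorph1 mulN1r.
Qed.

Lemma root_span0 g k : root_span g k.+1 (fun=> 0) 0.
Proof.
elim: k => [|k IH].
  apply: root_span_ext (root_span1 g (fun=> 0)) _ _ => //.
  by rewrite /lincomb big1 // => i _; rewrite rmorph0 mul0r.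
apply: root_span_ext (root_spanB (fun=> 0) IH) _ _; last by rewrite lie0r.
by move=> i; rewrite /adjoint_coef; ring.
Qed.

Lemma root_span_sum g k (a : I -> I -> F) (X : I -> E) :
  (forall j, root_span g k.+1 (a j) (X j)) ->
  root_span g k.+1 (fun i => \sum_j a j i) (\sum_j X j).
Proof.
move=> H; elim: (index_enum I) => [|j s IH].
  by apply: root_span_ext (root_span0 g k) _ _ => [i|]; rewrite big_nil.
by apply: root_span_ext (root_spanD (H j) IH) _ _ => [i|]; rewrite big_cons.
Qed.

(** A bracket has degree at least 2, so degree 1 contains only linear combinations of generators and
    their sums. *)
Lemma root_span_deg1 g a X : root_span g 1 a X -> X = lincomb g a.
Proof.
move=> H; move: {-2}1%N H (erefl 1%N) => k; elim=> {k a X} //.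
- case=> //; move=> b a X H _ _; exfalso.
  move: H; move: {-2}0%N (erefl 0%N) => k e0 H; elim: H e0 => //.
- move=> k a1 a2 X1 X2 _ IH1 _ IH2 e1.
  by rewrite lincombD IH1 // IH2.
Qed.

Lemma root_span_pos g k a X : root_span g k a X -> (0 < k)%N.
Proof. by elim. Qed.

Lemma ord_natr_eq0 k : (k%:R == 0 :> I) = (n %| k)%N.
Proof. by rewrite -val_eqE /= Zp_nat. Qed.

Lemma ord_natrD k (i : I) : i + k.+1%:R = i + k%:R + 1.
Proof. by rewrite -natr1 addrA. Qed.

(** For [w] the simple roots this is the root of the matrix unit E_{i,i+k}: an arc of the cyclic
    Dynkin diagram. *)
Definition arc_sum (V : zmodType) (w : I -> V) (k : nat) (i : I) : V :=
  \sum_(l < k) w (i + l%:R).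

Lemma arc_sumS (V : zmodType) (w : I -> V) k i :
  arc_sum w k.+1 i = arc_sum w k i + w (i + k%:R).
Proof. by rewrite /arc_sum big_ord_recr. Qed.

Lemma arc_sumSl (V : zmodType) (w : I -> V) k i :
  arc_sum w k.+1 i = w i + arc_sum w k (i + 1).
Proof.
rewrite /arc_sum big_ord_recl addr0; congr (_ + _).
by apply: eq_bigr => l _; rewrite -addrA /= /bump add1n -nat1r.
Qed.

(** Such an arc wraps around the cycle completely (an imaginary root); moving its start by one drops
    and adds the same node. *)
Lemma arc_sum_dvd (V : zmodType) (w : I -> V) k i j :
  (n %| k)%N -> arc_sum w k i = arc_sum w k j.
Proof.
rewrite -ord_natr_eq0 => /eqP k0.
have step p : arc_sum w k (p + 1) = arc_sum w k p.
  apply: (addrI (w p)); rewrite -arc_sumSl arc_sumS k0 addr0; exact: addrC.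
have steps p m : arc_sum w k (p + m%:R) = arc_sum w k p.
  elim: m => [|m IH]; first by rewrite addr0.
  by rewrite ord_natrD step.
by rewrite -(subrK j i) addrC -(natr_Zp (i - j)) steps.
Qed.

(** X need not be a weight vector: [lie H] multiplies each coefficient by the weight of its own
    arc. *)
Lemma root_span_weight g H w k a X : (forall j, lie H (g j) = sc (w j) * g j) ->
  root_span g k a X ->
  root_span g k (fun i => a i * arc_sum w k i) (lie H X).
Proof.
move=> Hw.
have Hl b : lie H (lincomb g b) = lincomb g (fun i => b i * w i).
  rewrite lie_sumr; apply: eq_bigr => i _.
  by rewrite lieZr Hw rmorphM mulrA.
elim=> {k a X} [a|k b a X HX IH|k a1 a2 X1 X2 _ IH1 _ IH2].
- apply: root_span_ext (root_span1 g (fun i => a i * w i)) _ _ => // i.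
  by rewrite arc_sumS /arc_sum big_ord0 add0r addr0.
- rewrite lie_jacobi Hl.
  apply: root_span_ext (root_spanD (root_spanB _ HX) (root_spanB b IH)) _ _ => //.
  move=> i; rewrite /adjoint_coef arc_sumSl.
  have := arc_sumSl w k i; rewrite arc_sumS.
  move: (arc_sum w k (i + 1)) => A /(canRL (addrK _)) ->; ring.
- rewrite lieDr; apply: root_span_ext (root_spanD IH1 IH2) _ _ => // i; ring.
Qed.

Lemma sum_shift (V : nmodType) (G : I -> V) (c : I) : \sum_i G (i + c) = \sum_i G i.
Proof.
rewrite [RHS](reindex_inj (h := fun i : I => i + c)) //; exact: addIr.
Qed.

(** The matrix unit E_{i,i+k}, projected to trace zero in imaginary degrees. There the n projections
    form a tight frame of an (n - 1)-dimensional space, so a sum of products over them equals the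
    sum over a pair of dual bases. *)
Definition proj_delta (k : nat) (i : I) : I -> F :=
  fun p => (p == i)%:R - (n %| k)%:R / n%:R.

(** * Brackets with lowering generators and uniqueness of root vectors *)

Section Lowering.
Variables e f h : I -> E.
Definition cartanF (i j : I) : F := (cartan i j)%:~R.

Hypothesis he : forall i j, lie (h i) (e j) = sc (cartanF i j) * e j.
Hypothesis ef : forall i j, lie (e i) (f j) = if i == j then h i else 0.

Lemma ordSE (p : I) : ordS p = p + 1.
Proof. by apply: val_inj; rewrite /= addn1. Qed.

Lemma cartanFE i j : cartanF i j = (i == j)%:R *+ 2 - (i == j + 1)%:R - (i == j - 1)%:R.
Proof.
rewrite /cartanF /cartan !ordSE !rmorphB rmorphMn /= !rmorph_nat.
by rewrite -[j == i + 1]subr_eq [j - 1 == i]eq_sym.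
Qed.

Lemma lie_h_lincomb (eta : I -> F) j : lie (lincomb h eta) (e j) =
  sc (eta j *+ 2 - eta (j + 1) - eta (j - 1)) * e j.
Proof.
rewrite lie_suml; under eq_bigr => i _ do rewrite lieZl he mulrA -rmorphM.
rewrite -mulr_suml -rmorph_sum; congr (sc _ * _).
under eq_bigr => i _ do rewrite cartanFE mulrBr mulrBr.
rewrite !sumrB; congr (_ - _ - _).
- by rewrite (bigD1 j) //= eqxx big1 ?addr0 ?mulr_natr // => i /negPf ->; rewrite mul0rn mulr0.
- by rewrite (bigD1 (j + 1)) //= eqxx big1 ?addr0 ?mulr1 // => i /negPf ->; rewrite mulr0.
- by rewrite (bigD1 (j - 1)) //= eqxx big1 ?addr0 ?mulr1 // => i /negPf ->; rewrite mulr0.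
Qed.

Lemma arc_sum_laplace (eta : I -> F) k i :
  arc_sum (fun j => eta j *+ 2 - eta (j + 1) - eta (j - 1)) k i =
  eta i - eta (i - 1) - eta (i + k%:R) + eta (i + k%:R - 1).
Proof.
elim: k => [|k IH]; first by rewrite /arc_sum big_ord0 addr0; ring.
by rewrite arc_sumS IH ord_natrD addrK; ring.
Qed.

Lemma root_span_h (eta : I -> F) k a X : root_span e k a X ->
  root_span e k (fun i => a i * (eta i - eta (i - 1) - eta (i + k%:R) + eta (i + k%:R - 1)))
    (lie (lincomb h eta) X).
Proof.
move=> /(root_span_weight (lie_h_lincomb eta)) H; apply: root_span_ext H _ _ => // i.
by rewrite arc_sum_laplace.
Qed.

Lemma lie_lincomb_ef a b : lie (lincomb e a) (lincomb f b) = lincomb h (fun i => a i * b i).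
Proof.
rewrite lie_suml; apply: eq_bigr => i _; rewrite lieZl lie_sumr (bigD1 i) //=.
rewrite lieZr ef eqxx big1 ?addr0 => [|j /negPf ji]; first by rewrite mulrA rmorphM.
by rewrite lieZr ef eq_sym ji mulr0.
Qed.

(** Here [f j] stands for E_{j+1,j}. The degree starts at 2 or more, so the result still has
    positive degree and no Cartan part. *)
Lemma root_span_lower c k a X : root_span e k.+2 a X ->
  root_span e k.+1 (fun i => c (i - 1) * a (i - 1) - a i * c (i + k.+1%:R))
    (lie (lincomb f c) X).
Proof.
move=> H; move em: k.+2 H => m H; elim: H k em => {m a X} //.
- move=> k' b a X HX IH k [ek]; move: HX IH; rewrite -{k'}ek => HX IH.
  rewrite lie_jacobi (lieC (lincomb e b)) lie_lincomb_ef.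
  (* If X has degree 1, the inner bracket with [f] lies in the Cartan part, which [root_span] does
     not describe; both terms are then handled by [root_span_h]. *)
  case: k HX IH => [|k] HX IH.
    have HX' := root_span_deg1 HX; rewrite {2}HX' (lieC (lincomb e a)) lie_lincomb_ef.
    rewrite lieNr -lieC.
    apply: root_span_ext (root_spanD (root_spanN (root_span_h (fun i => b i * c i) HX))
       (root_span_h (fun i => a i * c i) (root_span1 e b))) _ _; last by rewrite lieNl.
    by move=> i; rewrite /adjoint_coef addrK subrK; ring.
  apply: root_span_ext (root_spanD (root_spanN (root_span_h (fun i => b i * c i) HX))
       (root_spanB b (IH _ erefl))) _ _; last by rewrite lieNl.
  move=> i; rewrite /adjoint_coef.
  have -> : i - 1 + k.+2%:R = i + k.+1%:R by rewrite -[k.+2%:R]natr1; ring.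
  have -> : i + k.+2%:R - 1 = i + k.+1%:R by rewrite -[k.+2%:R]natr1; ring.
  have -> : i + 1 + k.+1%:R = i + k.+2%:R by rewrite -[k.+2%:R]natr1; ring.
  by rewrite addrK subrK; ring.
- move=> k' a1 a2 X1 X2 _ IH1 _ IH2 k ek; rewrite lieDr.
  apply: root_span_ext (root_spanD (IH1 _ ek) (IH2 _ ek)) _ _ => // i.
  by ring.
Qed.

Hypothesis lower_inj : forall k a X, root_span e k.+2 a X ->
  (forall j, lie (f j) X = 0) -> X = 0.

(** Descent on the degree: lowering keeps the coefficients zero, so all lowered elements vanish by
    induction and [lower_inj] applies. *)
Lemma root_span_eq0 k a X : root_span e k.+1 a X -> a =1 (fun=> 0) -> X = 0.
Proof.
elim: k a X => [|k IH] a X HX a0.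
  rewrite (root_span_deg1 HX) /lincomb big1 // => i _.
  by rewrite a0 rmorph0 mul0r.
apply: (lower_inj HX) => j; rewrite -(lincomb_delta f j).
by apply: (IH _ _ (root_span_lower _ HX)) => i; rewrite !a0; ring.
Qed.

Lemma root_span_inj k a1 a2 X1 X2 : root_span e k.+1 a1 X1 -> root_span e k.+1 a2 X2 ->
  a1 =1 a2 -> X1 = X2.
Proof.
move=> H1 H2 e12; apply/eqP; rewrite -subr_eq0; apply/eqP.
by apply: (root_span_eq0 (root_spanD H1 (root_spanN H2))) => i; rewrite e12 subrr.
Qed.
End Lowering.

(** Bracketing E_{j,j+1} with E_{j+1,j+k+2} yields a single matrix unit, except when n divides the
    new degree; then it yields a difference of two adjacent ones, and these differences span the
    traceless vectors. *)
Lemma root_span_surj g k a : ((n %| k.+1)%N -> \sum_i a i = 0) ->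
  exists X, root_span g k.+1 a X.
Proof.
elim: k a => [|k IH] a Ha; first by exists (lincomb g a); exact: root_span1.
have n0 : n%:R != 0 :> F by rewrite pnatr_eq0.
have Hp j : exists X, root_span g k.+1 (proj_delta k.+1 j) X.
  apply: IH => kn; rewrite /proj_delta kn sumrB (bigD1 j) //= eqxx big1 ?addr0.
    by rewrite sumr_const card_ord -[X in _ - X]mulr_natr divfK ?subrr.
  by move=> i /negPf ->.
(* The trace correction in [proj_delta] is a multiple of a central matrix and drops out of the
   bracket. *)
have Hs j : exists X, root_span g k.+2
    (fun p => (p == j)%:R - (n %| k.+2)%:R * (p == j + 1)%:R) X.
  have [X HX] := Hp (j + 1).
  exists (lie (lincomb g (fun p => (p == j)%:R)) X).
  apply: root_span_ext (root_spanB _ HX) _ _ => // p.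
  rewrite /adjoint_coef /proj_delta (inj_eq (addIr 1)) -[in (n %| k.+2)%N]ord_natr_eq0.
  have -> : (p + k.+1%:R == j) = (p + k.+2%:R == j + 1).
    by rewrite -[k.+2%:R]natr1 addrA (inj_eq (addIr 1)).
  have j1 : (j == j + 1) = false by rewrite -[X in X == _]addr0 (inj_eq (addrI j)) eq_sym oner_eq0.
  case: (boolP (n %| k.+1)%N) => kn; last first.
    have e1 : (j + 1 + k.+2%:R == j + 1) = (k.+2%:R == 0 :> I).
      by rewrite -[X in _ == X]addr0 (inj_eq (addrI _)).
    rewrite mul0r !subr0; case: (eqVneq p j) => [->|_]; first by rewrite j1 /=; ring.
    by case: (eqVneq p (j + 1)) => [->|_]; rewrite ?e1 /=; ring.
  have kn' : k.+1%:R = 0 :> I by apply/eqP; rewrite ord_natr_eq0.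
  rewrite -[k.+2%:R]natr1 kn' add0r oner_eq0 (inj_eq (addIr 1)).
  case: (eqVneq p j) => [->|_]; first by rewrite j1 /=; ring.
  by case: (p == j + 1) => /=; ring.
have [X HX] := fin_all_exists Hs.
case: (boolP (n %| k.+2)%N) => kn; last first.
  exists (\sum_j sc (a j) * X j).
  apply: root_span_ext (root_span_sum (fun j => root_spanZ (a j) (HX j))) _ _ => //.
  move=> i; rewrite (negPf kn) (bigD1 i) //= eqxx mul0r subr0 mulr1 big1 ?addr0 // => j ji.
  by rewrite eq_sym (negPf ji) mul0r subr0 mulr0.
(* Summation by parts: partial sums of [a] are the coefficients on adjacent differences, and the
   wrap-around at index 0 closes because the total is zero. *)
pose s (i : I) := \sum_(j < n | (j <= i)%N) a j.
exists (\sum_j sc (s j) * X j).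
apply: root_span_ext (root_span_sum (fun j => root_spanZ (s j) (HX j))) _ _ => //.
move=> i; rewrite kn; under eq_bigr => j _ do rewrite mul1r mulrBr.
rewrite sumrB (bigD1 i) //= eqxx mulr1 big1 ?addr0; last first.
  by move=> j ji; rewrite eq_sym (negPf ji) mulr0.
rewrite (bigD1 (i - 1)) //= subrK eqxx mulr1 big1 ?addr0; last first.
  by move=> j; rewrite eq_sym subr_eq => /negPf ->; rewrite mulr0.
have sE : s i = a i + \sum_(j < n | (j < i)%N) a j.
  rewrite /s (bigD1 i) //=; congr (_ + _); apply: eq_bigl => j.
  by rewrite -val_eqE /= ltn_neqAle andbC.
rewrite sE; apply/eqP; rewrite subr_eq; apply/eqP; congr (_ + _).
case: (eqVneq i 0) => [i0|i0].
  rewrite i0 big_pred0 // sub0r /s -[LHS](Ha kn); apply: eq_bigl => j.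
  by rewrite /= modn_small // -ltnS ltn_ord.
have i_gt0 : (0 < i)%N by rewrite lt0n.
have -> : i - 1 = inord i.-1.
  apply: (addIr 1); rewrite subrK; apply: val_inj; rewrite /= inordK; last first.
    by rewrite (leq_ltn_trans (leq_pred _)).
  by rewrite addn1 prednK // modn_small.
apply: eq_bigl => j; rewrite inordK; last by rewrite (leq_ltn_trans (leq_pred _)).
by rewrite -[in RHS]ltnS prednK.
Qed.

(** * Mixed brackets and partial Casimir sums *)

Section Casimir.
Variables e f h : I -> E.
Hypothesis he : forall i j, lie (h i) (e j) = sc (cartanF i j) * e j.
Hypothesis hf : forall i j, lie (h i) (f j) = - (sc (cartanF i j) * f j).
Hypothesis ef : forall i j, lie (e i) (f j) = if i == j then h i else 0.
Hypothesis lower_inj_e : forall k a X, root_span e k.+2 a X ->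
  (forall j, lie (f j) X = 0) -> X = 0.
Hypothesis lower_inj_f : forall k a X, root_span f k.+2 a X ->
  (forall j, lie (e j) X = 0) -> X = 0.

(** With [- h] for [h] the relations become symmetric in [e] and [f], so the lemmas on raising
    elements also serve the lowering side. *)
Let he' i j : lie (- h i) (f j) = sc (cartanF i j) * f j.
Proof. by rewrite lieNl hf opprK. Qed.
Let ef' i j : lie (f i) (e j) = if i == j then - h i else 0.
Proof. by rewrite lieC ef eq_sym; case: eqP => [->|_] //; rewrite oppr0. Qed.

(** On the [f] side a label [b] in degree l stands for (-1)^(l-1) times the sum of b_i E_{i+l,i},
    since [E_{21}, E_{32}] = - E_{31}. This is the origin of the sign. *)
Lemma root_span_mixed_lt k a X : root_span e k a X -> forall l b Y, root_span f (k + l.+1) b Y ->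
  root_span f l.+1 (fun i => (-1) ^+ k * (a (i + l.+1%:R) * b i - b (i - k%:R) * a (i - k%:R)))
    (lie X Y).
Proof.
elim=> {k a X} [a|k b' a' X HX IH|k a1 a2 X1 X2 _ IH1 _ IH2] l b Y HY.
- rewrite add1n in HY.
  apply: root_span_ext (root_span_lower he' ef' a HY) _ _ => // i.
  by rewrite expr1; ring.
- have -> : lie (lie (lincomb e b') X) Y =
    lie (lincomb e b') (lie X Y) - lie X (lie (lincomb e b') Y).
    by rewrite [X in X - _]lie_jacobi addrK.
  have HY2 := HY; rewrite addSnnS in HY.
  have HXY := root_span_lower he' ef' b' (IH _ _ _ HY).
  have k_gt0 := root_span_pos HX.
  rewrite addSn addnS in HY2.
  have HeY := root_span_lower he' ef' b' HY2; rewrite -addnS in HeY.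
  apply: root_span_ext (root_spanD HXY (root_spanN (IH _ _ _ HeY))) _ _ => // i.
  rewrite /adjoint_coef exprS.
  have -> : i - 1 + l.+2%:R = i + l.+1%:R by rewrite -[l.+2%:R]natr1; ring.
  have -> : i - k%:R - 1 = i - k.+1%:R by rewrite -[k.+1%:R]natr1; ring.
  have -> : i - 1 - k%:R = i - k.+1%:R by rewrite -[k.+1%:R]natr1; ring.
  have -> : i - k.+1%:R + 1 = i - k%:R by rewrite -[k.+1%:R]natr1; ring.
  have -> : i - k.+1%:R + k%:R = i - 1 by rewrite -[k.+1%:R]natr1; ring.
  have -> : i - k%:R + (k + l.+1)%:R = i + l.+1%:R by rewrite natrD; ring.
  have -> : i + l.+1%:R + k%:R = i + (k + l.+1)%:R by rewrite natrD; ring.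
  have -> : i + l.+2%:R = i + l.+1%:R + 1 by rewrite -[l.+2%:R]natr1; ring.
  by ring.
- rewrite lieDl; apply: root_span_ext (root_spanD (IH1 _ _ _ HY) (IH2 _ _ _ HY)) _ _ => // i.
  by ring.
Qed.

(** The bracket of opposite matrix units is the coroot of their arc. A full turn of simple coroots
    is the central element, so [arc_sum h] already carries the central term. *)
Lemma root_span_mixed_eq k a X : root_span e k.+1 a X -> forall b Y, root_span f k.+1 b Y ->
  lie X Y = sc ((-1) ^+ k) * \sum_i sc (a i * b i) * arc_sum h k.+1 i.
Proof.
move=> H; move em: k.+1 H => m H; elim: H k em => {m a X}
  [a|m b' a' X HX IH|m a1 a2 X1 X2 _ IH1 _ IH2] k em b Y HY.
- case: em => ek; subst k; rewrite (root_span_deg1 HY) (lie_lincomb_ef ef) expr0 rmorph1 mul1r.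
  by apply: eq_bigr => i _; rewrite arc_sumS /arc_sum big_ord0 addr0 add0r.
- case: em => em; subst m; case: k HX IH HY => [|k] HX IH HY; first by have := root_span_pos HX.
  have -> : lie (lie (lincomb e b') X) Y =
    lie (lincomb e b') (lie X Y) - lie X (lie (lincomb e b') Y).
    by rewrite [X in X - _]lie_jacobi addrK.
  have HY2 := HY; rewrite -addn1 in HY2.
  rewrite (root_span_deg1 (root_span_mixed_lt HX HY2)) (lie_lincomb_ef ef).
  rewrite (IH _ erefl _ _ (root_span_lower he' ef' b' HY)).
  (* [T1] and [T2] split off the first and the last node of an arc, matching the two terms of
     [adjoint_coef]. *)
  have T1 : \sum_i sc (b' i * a' (i + 1) * b i) * arc_sum h k.+2 i =
    \sum_i sc (b' i * a' (i + 1) * b i) * h i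
    + \sum_i sc (b' (i - 1) * a' i * b (i - 1)) * arc_sum h k.+1 i.
    rewrite -[X in _ = _ + X](sum_shift _ 1) -big_split; apply: eq_bigr => i _.
    by rewrite arc_sumSl mulrDr addrK.
  have T2 : \sum_i sc (a' i * b i * b' (i + k.+1%:R)) * arc_sum h k.+2 i =
    \sum_i sc (a' (i - k.+1%:R) * b (i - k.+1%:R) * b' i) * h i
    + \sum_i sc (a' i * b i * b' (i + k.+1%:R)) * arc_sum h k.+1 i.
    rewrite -[X in _ = X + _](sum_shift _ k.+1%:R) -big_split; apply: eq_bigr => i _.
    by rewrite arc_sumS mulrDr addrK addrC.
  transitivity (sc ((-1) ^+ k.+1) *
    (\sum_i sc (b' i * a' (i + 1) * b i) * arc_sum h k.+2 i -
     \sum_i sc (a' i * b i * b' (i + k.+1%:R)) * arc_sum h k.+2 i)); last first.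
    congr (_ * _); rewrite -sumrB; apply: eq_bigr => i _.
    by rewrite -mulrBl -rmorphB; congr (sc _ * _); rewrite /adjoint_coef; ring.
  rewrite T1 T2 opprD addrACA -!sumrB mulrDr !mulr_sumr -sumrN; congr (_ + _);
    apply: eq_bigr => i _.
    rewrite -mulrBl -rmorphB [RHS]mulrA -rmorphM; congr (sc _ * _).
    by ring.
  rewrite -[in RHS]mulrBl -rmorphB [RHS]mulrA -rmorphM mulrA -rmorphM -mulNr -rmorphN.
  by congr (sc _ * _); rewrite exprS; ring.
- by rewrite lieDl (IH1 _ em _ _ HY) (IH2 _ em _ _ HY) -mulrDr -big_split; congr (_ * _);
    apply: eq_bigr => i _; rewrite /= -mulrDl -rmorphD; congr (sc _ * _); ring.
Qed.

Lemma proj_delta_sum k i : (n %| k)%N -> \sum_p proj_delta k i p = 0.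
Proof.
move=> kn; rewrite /proj_delta kn sumrB (bigD1 i) //= eqxx big1 ?addr0.
  by rewrite sumr_const card_ord -[X in _ - X]mulr_natr divfK ?subrr // pnatr_eq0.
by move=> j /negPf ->.
Qed.

(** Bracketing respects the trace projection: [D1] and [D2] say that a correction is present only in
    degrees where the two delta terms multiplying it coincide. *)
Lemma proj_delta_lower (k : nat) (i j p : I) :
  (p - 1 == j)%:R * proj_delta k.+2 i (p - 1) - proj_delta k.+2 i p * (p + k.+1%:R == j)%:R =
  (i == j)%:R * proj_delta k.+1 (i + 1) p - (i + k.+1%:R == j)%:R * proj_delta k.+1 i p.
Proof.
rewrite /proj_delta.
have D2 : (n %| k.+2)%:R / n%:R * ((p - 1 == j)%:R - (p + k.+1%:R == j)%:R) = 0 :> F.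
  case: (boolP (n %| k.+2)%N) => [|_]; last by rewrite !mul0r.
  rewrite -ord_natr_eq0 -natr1 addr_eq0 => /eqP ->; by rewrite subrr mulr0.
have D1 : (n %| k.+1)%:R / n%:R * ((i == j)%:R - (i + k.+1%:R == j)%:R) = 0 :> F.
  case: (boolP (n %| k.+1)%N) => [|_]; last by rewrite !mul0r.
  rewrite -ord_natr_eq0 => /eqP ->; by rewrite addr0 subrr mulr0.
have -> : (p == i + 1) = (p - 1 == i) by rewrite subr_eq.
have A1 : (p - 1 == j)%:R * (p - 1 == i)%:R = (i == j)%:R * (p - 1 == i)%:R :> F.
  by case: (eqVneq (p - 1) i) => [->|]; rewrite ?mulr0.
have A2 : (p == i)%:R * (p + k.+1%:R == j)%:R = (i + k.+1%:R == j)%:R * (p == i)%:R :> F.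
  by case: (eqVneq p i) => [->|]; rewrite ?mulr0 ?mul0r // mulrC.
rewrite !mulrBr mulrBl A1 A2; move: D1 D2; rewrite !mulrBr.
by move=> /subr0_eq D1 /subr0_eq D2; rewrite ![_ * (_ / _)]mulrC D1 D2; ring.
Qed.

Lemma proj_delta_raise (k : nat) (i j p : I) :
  adjoint_coef k (fun q => (q == j)%:R) (proj_delta k i) p =
  (i == j + 1)%:R * proj_delta k.+1 j p - (i + k%:R == j)%:R * proj_delta k.+1 i p.
Proof.
rewrite /adjoint_coef /proj_delta.
have D1 : (n %| k.+1)%:R / n%:R * ((i == j + 1)%:R - (i + k%:R == j)%:R) = 0 :> F.
  case: (boolP (n %| k.+1)%N) => [|_]; last by rewrite !mul0r.
  rewrite -ord_natr_eq0 -natr1 addr_eq0 => /eqP ->; by rewrite subr_eq subrr mulr0.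
have D0 : (n %| k)%:R / n%:R * ((p == j)%:R - (p + k%:R == j)%:R) = 0 :> F.
  case: (boolP (n %| k)%N) => [|_]; last by rewrite !mul0r.
  rewrite -ord_natr_eq0 => /eqP ->; by rewrite addr0 subrr mulr0.
have A1 : (p == j)%:R * (p + 1 == i)%:R = (i == j + 1)%:R * (p == j)%:R :> F.
  by case: (eqVneq p j) => [->|]; rewrite ?mulr0 ?mul0r // eq_sym mulrC.
have A2 : (p == i)%:R * (p + k%:R == j)%:R = (i + k%:R == j)%:R * (p == i)%:R :> F.
  by case: (eqVneq p i) => [->|]; rewrite ?mulr0 ?mul0r // mulrC.
rewrite !mulrBr mulrBl A1 A2; move: D1 D0; rewrite !mulrBr.
by move=> /subr0_eq D1 /subr0_eq D2; rewrite ![_ * (_ / _)]mulrC D1 D2; ring.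
Qed.

Lemma proj_delta_weight (w : I -> F) k i p :
  proj_delta k i p * arc_sum w k p = arc_sum w k i * proj_delta k i p.
Proof.
rewrite mulrC; case: (boolP (n %| k)%N) => kn; first by rewrite (arc_sum_dvd w p i kn).
rewrite /proj_delta (negPf kn) mul0r subr0.
by case: (eqVneq p i) => [->|] //; rewrite !mulr0.
Qed.

(** The sum of [Y * X] up to degree T + 1 is a truncated Casimir operator. It fails to commute with
    [f j] by the Cartan term and by two boundary terms; these apply [X T] first, so they vanish on
    vectors too close to the top to be raised by T + 1. *)
Lemma casimir_elements : exists X Y : nat -> I -> E,
  [/\ forall H w, (forall j, lie H (e j) = sc (w j) * e j) ->
        forall k i, lie H (X k i) = sc (arc_sum w k.+1 i) * X k i,
      forall H w, (forall j, lie H (f j) = sc (w j) * f j) ->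
        forall k i, lie H (Y k i) = sc (arc_sum w k.+1 i) * Y k i,
      forall k i, lie (X k i) (Y k i) =
        sc (1 - (n %| k.+1)%:R / n%:R) * arc_sum h k.+1 i
    & forall T j, lie (f j) (\sum_(k < T.+1) \sum_i Y k i * X k i) =
        - (f j * h j) + (Y T.+1 (j - T.+1%:R) * X T (j - T.+1%:R) - Y T.+1 j * X T (j + 1))].
Proof.
have exX g k i : exists X, root_span g k.+1 (proj_delta k.+1 i) X.
  by apply: root_span_surj; apply: proj_delta_sum.
pose X k i := projT1 (cid (exX e k i)).
pose y k i := projT1 (cid (exX f k i)).
have HX k i : root_span e k.+1 (proj_delta k.+1 i) (X k i) by rewrite /X; case: cid.
have Hy k i : root_span f k.+1 (proj_delta k.+1 i) (y k i) by rewrite /y; case: cid.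
(* The sign converts the [f] side label into the transposed matrix unit E_{i+k+1,i}, up to the trace
   projection. *)
pose Y k i := sc ((-1) ^+ k) * y k i.
have injE := root_span_inj he ef lower_inj_e.
have injF := root_span_inj he' ef' lower_inj_f.
have fX0 i j : lie (f j) (X 0 i) = - ((i == j)%:R * h j).
  rewrite (root_span_deg1 (HX _ _)) -(lincomb_delta f j) lieC (lie_lincomb_ef ef).
  congr (- _); rewrite /lincomb (bigD1 j) //= eqxx mulr1 big1 ?addr0; last first.
    by move=> p /negPf ->; rewrite mulr0 rmorph0 mul0r.
  by rewrite /proj_delta dvdn1 mul0r subr0 rmorph_nat eq_sym.
have fX k i j : lie (f j) (X k.+1 i) =
    (i == j)%:R * X k (i + 1) - (i + k.+1%:R == j)%:R * X k i.
  rewrite -(lincomb_delta f j) -!(rmorph_nat sc).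
  apply: (injE _ _ _ _ _ (root_span_lower he ef _ (HX _ _))
    (root_spanD (root_spanZ (i == j)%:R (HX k (i + 1)))
       (root_spanN (root_spanZ (i + k.+1%:R == j)%:R (HX k i))))) => p.
  exact: proj_delta_lower.
have fy k i j : lie (f j) (y k i) =
    (i == j + 1)%:R * y k.+1 j - (i + k.+1%:R == j)%:R * y k.+1 i.
  rewrite -(lincomb_delta f j) -!(rmorph_nat sc).
  apply: (injF _ _ _ _ _ (root_spanB _ (Hy _ _))
    (root_spanD (root_spanZ (i == j + 1)%:R (Hy k.+1 j))
       (root_spanN (root_spanZ (i + k.+1%:R == j)%:R (Hy k.+1 i))))) => p.
  exact: proj_delta_raise.
have fY k i j : lie (f j) (Y k i) =
    (i + k.+1%:R == j)%:R * Y k.+1 i - (i == j + 1)%:R * Y k.+1 j.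
  rewrite /Y lieZr fy exprS mulN1r rmorphN -!(rmorph_nat sc) mulrBr !mulNr !mulrN opprK.
  by rewrite addrC !mulrA ![sc (_%:R) * _]scC.
have n0 : n%:R != 0 :> F by rewrite pnatr_eq0.
exists X, Y; split.
- move=> H w Hw k i.
  apply: (injE _ _ _ _ _ (root_span_weight Hw (HX k i)) (root_spanZ _ (HX k i))) => p.
  exact: proj_delta_weight.
- move=> H w Hw k i; rewrite /Y lieZr mulrA -scC -mulrA; congr (_ * _).
  apply: (injF _ _ _ _ _ (root_span_weight Hw (Hy k i)) (root_spanZ _ (Hy k i))) => p.
  exact: proj_delta_weight.
- move=> k i; rewrite /Y lieZr (root_span_mixed_eq (HX k i) (Hy k i)) mulrA -rmorphM.
  rewrite -expr2 sqrr_sign rmorph1 mul1r.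
  case: (boolP (n %| k.+1)%N) => kn; last first.
    rewrite mul0r subr0 rmorph1 mul1r (bigD1 i) //= big1 ?addr0.
      by rewrite /proj_delta eqxx (negPf kn) mul0r subr0 mulr1 rmorph1 mul1r.
    move=> p /negPf pi; rewrite /proj_delta pi (negPf kn) mul0r subr0 mulr0.
    by rewrite rmorph0 mul0r.
  under eq_bigr => p _ do rewrite (arc_sum_dvd h p i kn).
  rewrite -mulr_suml -rmorph_sum; congr (sc _ * _).
  under eq_bigr => p _ do rewrite {1}/proj_delta mulrBl.
  rewrite sumrB -mulr_sumr proj_delta_sum // mulr0 subr0.
  rewrite (bigD1 i) //= eqxx mul1r big1 ?addr0; last by move=> p /negPf ->; rewrite mul0r.
  by rewrite /proj_delta eqxx kn.
- move=> T j.
  have sumd (G : I -> E) q : \sum_i (i == q)%:R * G i = G q.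
    rewrite (bigD1 q) //= eqxx mul1r big1 ?addr0 // => i /negPf ->; by rewrite mul0r.
  have Ak k : \sum_i lie (f j) (Y k i) * X k i =
      Y k.+1 (j - k.+1%:R) * X k (j - k.+1%:R) - Y k.+1 j * X k (j + 1).
    under eq_bigr => i _ do
      rewrite fY mulrBl -!mulrA [i + _ == j]eq_sym -[j == i + _]subr_eq [j - _ == i]eq_sym.
    by rewrite sumrB !sumd /Y ?mulrA.
  (* [Bk k] is the negative of [Ak k], so the sum over degrees telescopes to [B0] and the last
     [Ak]. *)
  have Bk k : \sum_i Y k.+1 i * lie (f j) (X k.+1 i) =
      Y k.+1 j * X k (j + 1) - Y k.+1 (j - k.+1%:R) * X k (j - k.+1%:R).
    under eq_bigr => i _ do rewrite fX mulrBr !mulrA -!(rmorph_nat sc) -!scC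
      [i + _ == j]eq_sym -[j == i + _]subr_eq [j - _ == i]eq_sym !(rmorph_nat sc) -!mulrA.
    by rewrite sumrB !sumd /Y ?mulrA.
  have B0 : \sum_i Y 0 i * lie (f j) (X 0 i) = - (f j * h j).
    under eq_bigr => i _ do rewrite fX0 mulrN mulrA -(rmorph_nat sc) -scC rmorph_nat -mulrA.
    rewrite sumrN sumd; congr (- (_ * _)).
    rewrite /Y expr0 rmorph1 mul1r (root_span_deg1 (Hy _ _)).
    rewrite -[RHS](lincomb_delta f); apply: eq_bigr => p _.
    by rewrite /proj_delta dvdn1 mul0r subr0.
  have S k : lie (f j) (\sum_i Y k i * X k i) =
      \sum_i lie (f j) (Y k i) * X k i + \sum_i Y k i * lie (f j) (X k i).
    by rewrite lie_sumr -big_split; apply: eq_bigr => i _; rewrite lieM.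
  elim: T => [|T IH]; first by rewrite big_ord_recl big_ord0 addr0 S Ak B0 addrC.
  rewrite big_ord_recr /= lieDr IH S Ak Bk -addrA; congr (_ + _).
  by rewrite addrCA -[X in _ + (X + _)]opprB addNr addr0.
Qed.
End Casimir.

End RootVectors.

(** * Weight multiplicities of highest weight modules *)

Section EndoRing.
Variables (F : fieldType) (L : lmodType F).

(** Bundling makes operators a ring with central scalars, the setting in which the Casimir elements
    were constructed. *)
Record endo := Endo { endo_fun :> L -> L; endo_linear : linear endo_fun }.

Lemma endoP (X Y : endo) : (forall v, X v = Y v) <-> X = Y.
Proof.
split=> [XY|-> //]; case: X XY => X HX; case: Y => Y HY /= /funext XY.
by rewrite XY in HX *; congr Endo; exact: Prop_irrelevance.
Qed.

HB.instance Definition _ := gen_eqMixin endo.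
HB.instance Definition _ := gen_choiceMixin endo.
HB.instance Definition _ (X : endo) :=
  GRing.isLinear.Build F L L *:%R X (@endo_linear X).

Fact endo0_linear : linear (fun _ : L => 0 : L).
Proof. by move=> a u v; rewrite scaler0 addr0. Qed.
Fact endoN_linear (X : endo) : linear (fun v => - X v).
Proof. by move=> a u v; rewrite linearP opprD scalerN. Qed.
Fact endoD_linear (X Y : endo) : linear (fun v => X v + Y v).
Proof. by move=> a u v; rewrite !linearP scalerDr addrACA. Qed.
Fact endo1_linear : linear (@id L). Proof. by []. Qed.
Fact endoM_linear (X Y : endo) : linear (fun v => X (Y v)).
Proof. by move=> a u v; rewrite !linearP. Qed.
Fact endo_scale_linear (z : F) : linear (fun v : L => z *: v).
Proof. by move=> a u v; rewrite scalerDr !scalerA mulrC. Qed.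

Fact endo_addA : associative (fun X Y => Endo (endoD_linear X Y)).
Proof. by move=> X Y Z; apply/endoP => v /=; rewrite addrA. Qed.
Fact endo_addC : commutative (fun X Y => Endo (endoD_linear X Y)).
Proof. by move=> X Y; apply/endoP => v /=; rewrite addrC. Qed.
Fact endo_add0 : left_id (Endo endo0_linear) (fun X Y => Endo (endoD_linear X Y)).
Proof. by move=> X; apply/endoP => v /=; rewrite add0r. Qed.
Fact endo_addN : left_inverse (Endo endo0_linear) (fun X => Endo (endoN_linear X))
  (fun X Y => Endo (endoD_linear X Y)).
Proof. by move=> X; apply/endoP => v /=; rewrite addNr. Qed.
HB.instance Definition _ :=
  GRing.isZmodule.Build endo endo_addA endo_addC endo_add0 endo_addN.

Fact endo_mulA : associative (fun X Y => Endo (endoM_linear X Y)).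
Proof. by move=> X Y Z; apply/endoP. Qed.
Fact endo_mul1l : left_id (Endo endo1_linear) (fun X Y => Endo (endoM_linear X Y)).
Proof. by move=> X; apply/endoP. Qed.
Fact endo_mul1r : right_id (Endo endo1_linear) (fun X Y => Endo (endoM_linear X Y)).
Proof. by move=> X; apply/endoP. Qed.
Fact endo_mulDl : left_distributive (fun X Y => Endo (endoM_linear X Y)) +%R.
Proof. by move=> X Y Z; apply/endoP. Qed.
Fact endo_mulDr : right_distributive (fun X Y => Endo (endoM_linear X Y)) +%R.
Proof. by move=> X Y Z; apply/endoP => v /=; rewrite linearD. Qed.
HB.instance Definition _ := GRing.Zmodule_isPzRing.Build endo
  endo_mulA endo_mul1l endo_mul1r endo_mulDl endo_mulDr.

Definition endo_scale (z : F) : endo := Endo (endo_scale_linear z).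
Fact endo_scale_additive : zmod_morphism endo_scale.
Proof. by move=> a b; apply/endoP => v /=; rewrite scalerBl. Qed.
Fact endo_scale_multiplicative : monoid_morphism endo_scale.
Proof. by split=> [|a b]; apply/endoP => v /=; rewrite ?scale1r // scalerA. Qed.
HB.instance Definition _ := GRing.isZmodMorphism.Build F endo endo_scale endo_scale_additive.
HB.instance Definition _ := GRing.isMonoidMorphism.Build F endo endo_scale endo_scale_multiplicative.

Lemma endo_scaleC z (X : endo) : endo_scale z * X = X * endo_scale z.
Proof. by apply/endoP => v /=; rewrite linearZ. Qed.

Lemma endoDE (X Y : endo) v : (X + Y) v = X v + Y v. Proof. by []. Qed.
Lemma endoNE (X : endo) v : (- X) v = - X v. Proof. by []. Qed.
Lemma endoBE (X Y : endo) v : (X - Y) v = X v - Y v. Proof. by []. Qed.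
Lemma endoME (X Y : endo) v : (X * Y) v = X (Y v). Proof. by []. Qed.
Lemma endo0E v : (0 : endo) v = 0. Proof. by []. Qed.
Lemma endo_scaleE z v : endo_scale z v = z *: v. Proof. by []. Qed.
Lemma endo_sumE (J : Type) (r : seq J) (P : pred J) (G : J -> endo) v :
  (\sum_(i <- r | P i) G i) v = \sum_(i <- r | P i) G i v.
Proof. by apply: (big_morph (fun X : endo => X v)). Qed.

End EndoRing.

(** * Finite spans and comparison of dimensions *)

Section Dimension.
Variables (F : fieldType) (L : lmodType F).

Fixpoint span (s : seq L) (u : L) : Prop :=
  if s is w :: s' then exists a : F, span s' (u - a *: w) else u = 0.

Lemma span_lin s a u v : span s u -> span s v -> span s (a *: u + v).
Proof.
elim: s u v => [|w s IH] u v /=; first by move=> -> ->; rewrite scaler0 addr0.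
move=> [b Hu] [c Hv]; exists (a * b + c).
have -> : a *: u + v - (a * b + c) *: w = a *: (u - b *: w) + (v - c *: w).
  by rewrite scalerDl scalerBr scalerA addrACA opprD.
exact: IH.
Qed.

Lemma span0 s : span s 0.
Proof. by elim: s => //= w s IH; exists 0; rewrite scale0r subr0. Qed.

Lemma span_cons w s u : span s u -> span (w :: s) u.
Proof. by exists 0; rewrite scale0r subr0. Qed.

Lemma span_mem s u : u \in s -> span s u.
Proof.
elim: s => //= w s IH; rewrite inE => /orP[/eqP ->|/IH]; last exact: span_cons.
by exists 1; rewrite scale1r subrr; exact: span0.
Qed.

Lemma span_sum (J : Type) (r : seq J) (P : pred J) (G : J -> L) s :
  (forall j, P j -> span s (G j)) -> span s (\sum_(j <- r | P j) G j).
Proof.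
move=> H; apply: big_ind => //; first exact: span0.
by move=> u v Hu Hv; rewrite -[u]scale1r; apply: span_lin.
Qed.

Lemma spanZ s a u : span s u -> span s (a *: u).
Proof. by move=> H; rewrite -[_ *: _]addr0; apply: span_lin H (span0 _). Qed.

Lemma has_dim_span s : exists m, has_dim (span s) m.
Proof.
elim: s => [|w s [m [b [bs bP]]]].
  exists 0%N, (fun=> 0); split=> [[]//|v /= ->]; exists 0.
  by split=> [|c' _]; rewrite ?big_ord0 // [c']thinmx0.
case: (EM (span s w)) => ws.
  exists m, b; split=> [i|v /= [a Hv]]; first exact/span_cons/bs.
  by apply: bP; rewrite -[v](subrK (a *: w)) addrC; apply: span_lin.
pose b' (i : 'I_m.+1) := if unlift ord0 i is Some j then b j else w.
have b'E (c : 'rV[F]_m.+1) : \sum_i c 0 i *: b' i =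
    c 0 ord0 *: w + \sum_i c 0 (lift ord0 i) *: b i.
  by rewrite big_ord_recl /b' unlift_none; congr (_ + _); apply: eq_bigr => i _; rewrite liftK.
have sb (c : 'I_m -> F) : span s (\sum_i c i *: b i).
  by apply: span_sum => i _; apply/spanZ/bs.
exists m.+1, b'; split.
  move=> i; rewrite /b'; case: unliftP => [j|] _; first exact/span_cons/bs.
  by exists 1; rewrite scale1r subrr; exact: span0.
move=> v [a Hv]; have [c [vc cU]] := bP _ Hv.
exists (\row_i if unlift ord0 i is Some j then c 0 j else a); split.
  rewrite b'E !mxE unlift_none; under eq_bigr => i _ do rewrite mxE liftK.
  by rewrite -vc addrC subrK.
move=> c' vc'; have ac : a = c' 0 ord0.
  apply/eqP; apply: contra_notT ws => ne; rewrite -subr_eq0 in ne.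
  have := vc'; rewrite b'E => /(congr1 (fun x => x - a *: w)).
  rewrite vc addrAC -scalerBl => vE.
  have -> : w = (c' 0 ord0 - a)^-1 *: (v - a *: w - \sum_i c' 0 (lift ord0 i) *: b i).
    rewrite vc vE addrK scalerA mulVf ?scale1r //.
    by rewrite -opprB oppr_eq0.
  by apply: spanZ; rewrite -[X in _ + X]scaleN1r addrC; apply: span_lin.
apply/rowP => i; rewrite mxE; case: unliftP => [j ->|->] //.
rewrite (cU (\row_j c' 0 (lift ord0 j))) ?mxE //.
under eq_bigr => k _ do rewrite mxE.
by rewrite vc' b'E ac addrC addKr.
Qed.

(** The coordinate matrix of an injective linear map is row free, so it has at most as many rows as
    columns. *)
Lemma has_dim_le (S S' : set L) m m' (g : endo L) : has_dim S m -> has_dim S' m' ->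
  (forall a u v, S u -> S v -> S (a *: u + v)) -> S 0 ->
  (forall u, S u -> S' (g u)) -> (forall u, S u -> g u = 0 -> u = 0) -> (m <= m')%N.
Proof.
move=> [b [bS bU]] [b' [b'S b'U]] Slin S0 gS ginj.
have ex i : exists c : 'rV[F]_m', g (b i) = \sum_j c 0 j *: b' j.
  by have [c [Hc _]] := b'U _ (gS _ (bS i)); exists c.
have [M HM] := fin_all_exists ex.
pose A := \matrix_(i, j) M i 0 j.
have Afree : row_free A.
  apply/inj_row_free => x xA.
  have Sx : S (\sum_i x 0 i *: b i).
    apply: big_ind => //; first by move=> u v Hu Hv; rewrite -[u]scale1r; apply: Slin.
    by move=> i _; rewrite -[_ *: _]addr0; apply: Slin.
  have gx : g (\sum_i x 0 i *: b i) = 0.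
    rewrite linear_sum; under eq_bigr => i _ do rewrite linearZ /= HM scaler_sumr.
    rewrite exchange_big big1 //= => j _.
    under eq_bigr => i _ do rewrite scalerA.
    rewrite -scaler_suml; have /rowP /(_ j) := xA; rewrite !mxE => xAj.
    rewrite (_ : \sum_i _ = 0) ?scale0r // -[RHS]xAj; apply: eq_bigr => i _; by rewrite mxE.
  have [c [_ cU]] := bU _ Sx.
  rewrite -(cU x erefl); apply: cU; rewrite (ginj _ Sx gx) big1 // => i _.
  by rewrite mxE scale0r.
by move: Afree; rewrite /row_free => /eqP <-; rewrite rank_leq_col.
Qed.

Lemma has_dim_uniq (S : set L) m m' : has_dim S m -> has_dim S m' ->
  (forall a u v, S u -> S v -> S (a *: u + v)) -> S 0 -> m = m'.
Proof.
move=> H H' Slin S0; apply/eqP; rewrite eqn_leq.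
by rewrite (has_dim_le (g := 1) H H') // (has_dim_le (g := 1) H' H).
Qed.

End Dimension.

(** * Injectivity of powers of the lowering operator of sl_2 *)

Section SL2.
Variables (F : numFieldType) (L : lmodType F) (e f h : endo L).
Hypothesis he : forall u, h (e u) = e (h u) + 2%:R *: e u.
Hypothesis hf : forall u, h (f u) = f (h u) - 2%:R *: f u.
Hypothesis ef : forall u, e (f u) = f (e u) + h u.

Lemma sl2_h_iter M j u : h u = M%:R *: u ->
  h (iter j f u) = (M%:R - 2%:R * j%:R) *: iter j f u.
Proof.
move=> Hu; elim: j => [|j IH]; first by rewrite mulr0 subr0.
rewrite iterS hf IH linearZ -scalerBl; congr (_ *: _).
by rewrite -natr1; ring.
Qed.

Lemma sl2_e_iter M j u : h u = M%:R *: u ->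
  e (iter j.+1 f u) = iter j.+1 f (e u) + (j.+1%:R * (M%:R - j%:R)) *: iter j f u.
Proof.
move=> Hu; elim: j => [|j IH]; first by rewrite /= ef Hu mul1r subr0.
rewrite iterS ef IH linearD linearZ (sl2_h_iter j.+1 Hu) /= -addrA -scalerDl.
by congr (_ + _ *: _); rewrite -[j.+2%:R]natr1 -[j.+1%:R]natr1; ring.
Qed.

(** Induction on the nilpotency order p. The vector [e u] has weight M + 2 and is killed by f^(M+2),
    so it vanishes by induction; then u is a highest weight vector, and applying [e] to f^(j+1) u =
    0 gives f^j u = 0 for each j < M. *)
Lemma sl2_lowering_inj p M u : h u = M%:R *: u -> iter p e u = 0 -> iter M f u = 0 -> u = 0.
Proof.
elim: p M u => [|p IH] [|k] u Hu //.
rewrite iterSr => eu fu.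
have fu' := sl2_e_iter k Hu; rewrite fu linear0 in fu'.
have eZ a x : e (a *: x) = a *: e x by rewrite linearZ.
have e0 : e u = 0.
  apply: (IH k.+3) => //; first by rewrite he Hu eZ -scalerDl -natrD addnC.
  rewrite -[iter k.+3 f (e u)]/(f (f (iter k.+1 f (e u)))).
  have -> : iter k.+1 f (e u) = - ((k.+1%:R * (k.+1%:R - k%:R)) *: iter k f u).
    by apply/eqP; rewrite -addr_eq0 -fu'.
  have fZ a x : f (a *: x) = a *: f x by rewrite linearZ.
  by rewrite -scaleNr !fZ -[f (iter k f u)]/(iter k.+1 f u) fu linear0 scaler0.
have step j : (j <= k)%N -> iter j.+1 f u = 0 -> iter j f u = 0.
  move=> jk fj; have := sl2_e_iter j Hu; rewrite fj e0 linear0.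
  have -> : iter j.+1 f 0 = 0 by elim: j.+1 => //= q ->; rewrite linear0.
  rewrite add0r => /esym /eqP; rewrite scaler_eq0 mulf_eq0 pnatr_eq0 subr_eq0 eqr_nat.
  by rewrite -[k.+1 == j]negbK neq_ltn ltnS jk orbT /= => /eqP.
suff H j : (j <= k.+1)%N -> iter j f u = 0 -> u = 0 by exact: (H k.+1).
by elim: j => [|j IHj] // jk /(step j jk); apply: IHj; apply: ltnW.
Qed.
End SL2.

(** * Words, weights and root vectors in an irreducible highest weight module *)

Section HighestWeight.
Variables (n' : nat) (F : numFieldType) (L : lmodType F) (rho : aff_rep n'.+3 L).
Local Notation n := n'.+3.
Local Notation I := 'I_n'.+3.
Variables (lam : I -> nat) (Lam : weight F n).
Hypothesis Lam1 : forall i, Lam.1 0 i = (lam i)%:R.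
Hypothesis Lam2 : Lam.2 = 0.
Hypothesis irr : irreducible_rep rho.
Variable v0 : L.
Hypothesis v0_neq0 : v0 != 0.
Hypothesis v0_wt : weight_space rho Lam v0.
Hypothesis v0_hi : forall i, rep_e rho i v0 = 0.

Local Notation sc := (@endo_scale F L).
Let e i : endo L := Endo (linearP (rep_e rho i)).
Let f i : endo L := Endo (linearP (rep_f rho i)).
Let h i : endo L := Endo (linearP (rep_h rho i)).
Let d : endo L := Endo (linearP (rep_d rho)).

Lemma lieE (X Y : endo L) u : lie X Y u = X (Y u) - Y (X u).
Proof. by []. Qed.

Lemma op_he i j : lie (h i) (e j) = sc (cartanF F i j) * e j.
Proof. by apply/endoP => u; have := rep_hh rho i j u => _; have := rep_he rho i j u; rewrite mxE. Qed.
Lemma op_hf i j : lie (h i) (f j) = - (sc (cartanF F i j) * f j).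
Proof. by apply/endoP => u; have := rep_hf rho i j u; rewrite mxE. Qed.
Lemma op_ef i j : lie (e i) (f j) = if i == j then h i else 0.
Proof. by apply/endoP => u; have := rep_ef rho i j u; case: eqP. Qed.
Lemma op_de j : lie d (e j) = sc ((j == 0 :> nat)%:R) * e j.
Proof. by apply/endoP => u; exact: (rep_de rho j u). Qed.
Lemma op_df j : lie d (f j) = - (sc ((j == 0 :> nat)%:R) * f j).
Proof. by apply/endoP => u; exact: (rep_df rho j u). Qed.

Definition lower_wt (c : 'X_{1..n}) : weight F n :=
  Lam - \sum_i simple_root F i *+ c i.

Definition coroot_val (c : 'X_{1..n}) (i : I) : F :=
  (lam i)%:R - ((c i)%:R *+ 2 - (c (i + 1))%:R - (c (i - 1))%:R).

Lemma weight1_sum (J : Type) (r : seq J) (G : J -> weight F n) i :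
  (\sum_(j <- r) G j).1 0 i = \sum_(j <- r) (G j).1 0 i.
Proof. by elim: r => [|j r IH]; rewrite ?big_nil ?mxE // !big_cons mxE IH. Qed.

Lemma weight2_sum (J : Type) (r : seq J) (G : J -> weight F n) :
  (\sum_(j <- r) G j).2 = \sum_(j <- r) (G j).2.
Proof. by elim: r => [|j r IH]; rewrite ?big_nil // !big_cons -IH. Qed.

Lemma weight1_muln (x : weight F n) k i : (x *+ k).1 0 i = x.1 0 i *+ k.
Proof. by elim: k => [|k IH]; rewrite ?mulr0n ?mxE // !mulrS mxE IH. Qed.

Lemma weight2_muln (x : weight F n) k : (x *+ k).2 = x.2 *+ k.
Proof. by elim: k => [|k IH] //; rewrite !mulrS -IH. Qed.

Lemma lower_wt1 c i : (lower_wt c).1 0 i = coroot_val c i.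
Proof.
rewrite /lower_wt !mxE Lam1 weight1_sum /coroot_val; congr (_ - _).
under eq_bigr => j _ do rewrite weight1_muln mxE -[(cartan i j)%:~R]/(cartanF F i j) cartanFE
  -[_ *+ c j]mulr_natr !mulrBl.
rewrite !sumrB addrAC; congr (_ - _ - _).
- rewrite (bigD1 i) //= eqxx big1 ?addr0; first by rewrite mulrnAl mul1r.
  by move=> j /negPf ji; rewrite eq_sym ji mul0rn mul0r.
- rewrite (bigD1 (i + 1)) //= addrK eqxx mul1r big1 ?addr0 // => j ji.
  by rewrite eq_sym subr_eq (negPf ji) mul0r.
- rewrite (bigD1 (i - 1)) //= subrK eqxx mul1r big1 ?addr0 // => j ji.
  by rewrite -subr_eq eq_sym (negPf ji) mul0r.
Qed.

Lemma lower_wt2 c : (lower_wt c).2 = - (c 0)%:R.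
Proof.
rewrite /lower_wt /= Lam2 sub0r weight2_sum (bigD1 0) //= weight2_muln big1 ?addr0 // => i i0.
by rewrite weight2_muln /= -[(i == 0 :> nat)]/(i == 0 :> I) (negPf i0) mul0rn.
Qed.

(** The coroots cannot see multiples of delta; the derivation can. Equality on coroots gives the
    difference [x] constant increments, which sum to zero around the cycle, and the derivation gives
    x 0 = 0. *)
Lemma lower_wt_inj : injective lower_wt.
Proof.
move=> c1 c2 c12.
pose x (i : I) : F := (c1 i)%:R - (c2 i)%:R.
have x0 : x 0 = 0.
  by apply/eqP; rewrite subr_eq0 -eqr_opp -!lower_wt2 c12.
have xL i : x (i + 1) - x i = x (i - 1 + 1) - x (i - 1).
  have : (lower_wt c1).1 0 i = (lower_wt c2).1 0 i by rewrite c12.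
  rewrite !lower_wt1 /coroot_val /x subrK => /addrI /oppr_inj /eqP.
  rewrite -subr_eq0 => /eqP E; apply/eqP; rewrite -subr_eq0 -oppr0 -E; apply/eqP; ring.
have xcst i : x (i + 1) - x i = x 1 - x 0.
  rewrite -(natr_Zp i); elim: (i : nat) => [|k IH]; first by rewrite add0r.
  by rewrite -natr1 xL addrK IH.
have : \sum_i (x (i + 1) - x i) = 0 by rewrite sumrB sum_shift subrr.
under eq_bigr => i _ do rewrite xcst.
rewrite sumr_const card_ord => /eqP; rewrite -mulr_natr mulf_eq0 pnatr_eq0 orbF => /eqP D0.
have xi i : x i = 0.
  rewrite -(natr_Zp i); elim: (i : nat) => [|k IH] //.
  by rewrite -natr1 -[x _](subrK (x k%:R)) xcst D0 IH addr0.
apply/mnmP => i; apply/eqP; rewrite -(eqr_nat F) -subr_eq0; apply/eqP; exact: xi.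
Qed.

Lemma weight_space_sub lam1 a u v : weight_space rho lam1 u -> weight_space rho lam1 v ->
  weight_space rho lam1 (a *: u + v).
Proof.
move=> [Hu Du] [Hv Dv]; split=> [i|]; rewrite linearP ?Hu ?Du ?Hv ?Dv scalerDr !scalerA.
  by rewrite [a * _]mulrC.
by rewrite [a * _]mulrC.
Qed.

Lemma weight_space0 lam1 : weight_space rho lam1 0.
Proof. by split=> [i|]; rewrite linear0 scaler0. Qed.

Lemma weight_spaceZ lam1 a u : weight_space rho lam1 u -> weight_space rho lam1 (a *: u).
Proof. by move=> Hu; rewrite -[_ *: _]addr0; apply: weight_space_sub (weight_space0 _). Qed.

Lemma weight_space_sum lam1 (J : Type) (r : seq J) (P : pred J) (G : J -> L) :
  (forall j, P j -> weight_space rho lam1 (G j)) -> weight_space rho lam1 (\sum_(j <- r | P j) G j).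
Proof.
move=> H; apply: big_ind => //; first exact: weight_space0.
by move=> u v Hu Hv; rewrite -[u]scale1r; apply: weight_space_sub.
Qed.

Lemma weight_space_op (X : endo L) (mu lam1 : weight F n) u :
  (forall i, lie (h i) X = sc (mu.1 0 i) * X) -> lie d X = sc mu.2 * X ->
  weight_space rho lam1 u -> weight_space rho (lam1 + mu) (X u).
Proof.
move=> HX DX [Hu Du]; split=> [i|].
  have /endoP /(_ u) := HX i; rewrite lieE /= Hu linearZ /= => /eqP.
  by rewrite subr_eq => /eqP ->; rewrite mxE scalerDl addrC.
have /endoP /(_ u) := DX; rewrite lieE /= Du linearZ /= => /eqP.
by rewrite subr_eq => /eqP ->; rewrite scalerDl addrC.
Qed.

Lemma weight_space_f lam1 i u : weight_space rho lam1 u ->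
  weight_space rho (lam1 - simple_root F i) (f i u).
Proof.
apply: weight_space_op => [j|]; rewrite /= ?mxE ?op_hf ?op_df -mulNr -rmorphN //.
Qed.

Lemma weight_space_e lam1 i u : weight_space rho lam1 u ->
  weight_space rho (lam1 + simple_root F i) (e i u).
Proof.
by apply: weight_space_op => [j|]; rewrite /= ?mxE ?op_he ?op_de.
Qed.

Lemma weight_space_indep (s : seq (weight F n)) (g : weight F n -> L) : uniq s ->
  (forall l, l \in s -> weight_space rho l (g l)) -> \sum_(l <- s) g l = 0 ->
  forall l, l \in s -> g l = 0.
Proof.
elim: s g => [|l0 s IH] g //= /andP[l0s us] Hg; rewrite big_cons => sum0.
have ws l : l \in s -> weight_space rho l (g l) by move=> ls; apply: Hg; rewrite inE ls orbT.
have ws0 : weight_space rho l0 (g l0) by apply: Hg; rewrite inE eqxx.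
have key (X : endo L) (ev : weight F n -> F) :
    (forall l, l \in l0 :: s -> X (g l) = ev l *: g l) ->
    forall l, l \in s -> (ev l - ev l0) *: g l = 0.
  move=> HX; apply: IH => // [l ls|]; first exact/weight_spaceZ/ws.
  under eq_bigr => l _ do rewrite scalerBl.
  rewrite sumrB -scaler_sumr.
  have : X (g l0 + \sum_(l <- s) g l) - ev l0 *: (g l0 + \sum_(l <- s) g l) = 0.
    by rewrite sum0 linear0 scaler0 subrr.
  rewrite linearD linear_sum /= HX ?inE ?eqxx // scalerDr opprD addrACA subrr add0r.
  move=> Hs; rewrite -[RHS]Hs {Hs}.
  congr (_ - _); rewrite big_seq [RHS]big_seq; apply: eq_bigr => l ls.
  by rewrite HX // inE ls orbT.
have gs l : l \in s -> g l = 0.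
  move=> ls; have [//|gl] := eqVneq (g l) 0.
  case/negP: l0s; rewrite (_ : l0 = l) //.
  have e1 i : l.1 0 i = l0.1 0 i.
    have /eqP := key (h i) (fun l => l.1 0 i) (fun l ll => (Hg l ll).1 i) l ls.
    by rewrite scaler_eq0 (negPf gl) orbF subr_eq0 => /eqP.
  have e2 : l.2 = l0.2.
    have /eqP := key d (fun l => l.2) (fun l ll => (Hg l ll).2) l ls.
    by rewrite scaler_eq0 (negPf gl) orbF subr_eq0 => /eqP.
  rewrite [l]surjective_pairing [l0]surjective_pairing e2; congr (_, _).
  by apply/rowP => i; rewrite e1.
move=> l; rewrite inE => /orP[/eqP ->|]; last exact: gs.
move: sum0; rewrite big_seq big1 ?addr0 // => l' /gs //.
Qed.

Definition fword (s : seq I) : L := foldr (fun i u => f i u) v0 s.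
Definition content (s : seq I) : 'X_{1..n} := foldr (fun i c => (U_(i) + c)%MM) 0%MM s.

Lemma lower_wtS c i : lower_wt (U_(i) + c)%MM = lower_wt c - simple_root F i.
Proof.
rewrite /lower_wt -addrA -opprD; congr (_ - _).
rewrite (bigD1 i) //= [in RHS](bigD1 i) //= mnmDE mnm1E eqxx mulrnDr mulr1n.
rewrite -addrA addrC; congr (_ + _ + _).
by apply: eq_bigr => j ji; rewrite mnmDE mnm1E eq_sym (negPf ji).
Qed.

Lemma lower_wt0 : lower_wt 0%MM = Lam.
Proof. by rewrite /lower_wt big1 ?subr0 // => i _; rewrite mnm0E. Qed.

Lemma fword_wt s : weight_space rho (lower_wt (content s)) (fword s).
Proof.
elim: s => [|i s IH] /=; first by rewrite lower_wt0.
by rewrite lower_wtS; apply: weight_space_f.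
Qed.

Lemma mdeg_content s : mdeg (content s) = size s.
Proof. by elim: s => [|i s IH] /=; rewrite ?mdeg0 // mdegD mdeg1 IH. Qed.

(** A list of coefficient-word pairs, so that combinations can be filtered by weight without
    choosing a basis. *)
Definition wcomb (r : seq (F * seq I)) : L := \sum_(p <- r) p.1 *: fword p.2.

Lemma wcomb_cat r1 r2 : wcomb (r1 ++ r2) = wcomb r1 + wcomb r2.
Proof. exact: big_cat. Qed.

Lemma wcomb_scale a r : wcomb [seq (a * p.1, p.2) | p <- r] = a *: wcomb r.
Proof. by rewrite /wcomb big_map scaler_sumr; apply: eq_bigr => p _; rewrite scalerA. Qed.

Lemma wcomb_f i r : wcomb [seq (p.1, i :: p.2) | p <- r] = f i (wcomb r).
Proof. by rewrite /wcomb big_map linear_sum; apply: eq_bigr => p _; rewrite linearZ. Qed.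

Lemma wcomb_weight (X : endo L) (ev : weight F n -> F) r :
  (forall l u, weight_space rho l u -> X u = ev l *: u) ->
  X (wcomb r) = wcomb [seq (ev (lower_wt (content p.2)) * p.1, p.2) | p <- r].
Proof.
move=> HX; rewrite /wcomb big_map linear_sum; apply: eq_bigr => p _ /=.
by rewrite linearZ /= (HX _ _ (fword_wt _)) !scalerA mulrC.
Qed.

Lemma h_weight i l u : weight_space rho l u -> h i u = l.1 0 i *: u.
Proof. by case=> H _; exact: H. Qed.
Lemma d_weight l u : weight_space rho l u -> d u = l.2 *: u.
Proof. by case=> _ H; exact: H. Qed.

Lemma subrep_setT (W : set L) : subrep rho W -> (exists2 u, W u & u != 0) -> W = setT.
Proof.
move=> HW [u Wu u0]; case: irr => _ /(_ W HW) [W0|//].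
by move: Wu; rewrite W0 => /= Wu; rewrite Wu eqxx in u0.
Qed.

Lemma wcomb_e i s : exists r, e i (fword s) = wcomb r.
Proof.
elim: s => [|j s [r IH]] /=; first by exists [::]; rewrite /wcomb big_nil; exact: v0_hi.
have -> : rep_e rho i (rep_f rho j (fword s)) = lie (e i) (f j) (fword s) + f j (e i (fword s)).
  by rewrite lieE /= subrK.
rewrite op_ef IH -wcomb_f; case: eqP => _; last first.
  by exists [seq (p.1, j :: p.2) | p <- r]; rewrite endo0E add0r.
exists (((lower_wt (content s)).1 0 i, s) :: [seq (p.1, j :: p.2) | p <- r]).
by rewrite [RHS]/wcomb big_cons (h_weight _ (fword_wt _)).
Qed.

Lemma wcomb_span u : exists r, u = wcomb r.
Proof.
suff E : [set u | exists r, u = wcomb r] = setT.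
  by have : [set u | exists r, u = wcomb r] u by rewrite E.
move=> {u}; apply: subrep_setT; last first.
  by exists v0 => //; exists [:: (1, [::])]; rewrite /wcomb big_seq1 scale1r.
split; first by exists [::]; rewrite /wcomb big_nil.
- move=> a u v [r1 ->] [r2 ->].
  by exists ([seq (a * p.1, p.2) | p <- r1] ++ r2); rewrite wcomb_cat wcomb_scale.
- move=> i v [r ->]; split.
  + elim: r => [|p r [r' IH]]; first by exists [::]; rewrite /wcomb !big_nil linear0.
    have [r1 Hr1] := wcomb_e i p.2.
    exists ([seq (p.1 * q.1, q.2) | q <- r1] ++ r').
    by rewrite wcomb_cat -IH wcomb_scale -Hr1 /wcomb big_cons linearD linearZ.
  + by exists [seq (p.1, i :: p.2) | p <- r]; rewrite wcomb_f.
  + exists [seq ((lower_wt (content p.2)).1 0 i * p.1, p.2) | p <- r].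
    exact: (wcomb_weight (X := h i) (ev := fun l => l.1 0 i) r (@h_weight i)).
- move=> v [r ->]; exists [seq ((lower_wt (content p.2)).2 * p.1, p.2) | p <- r].
  exact: (wcomb_weight (X := d) (ev := fun l => l.2) r d_weight).
Qed.

(** Grouping the terms by weight and subtracting the vector itself leaves a zero sum of vectors from
    distinct weight spaces, so every group of foreign weight vanishes. *)
Lemma wcomb_component l r : weight_space rho l (wcomb r) ->
  wcomb r = wcomb [seq p <- r | lower_wt (content p.2) == l].
Proof.
move=> Hl.
pose g k := wcomb [seq p <- r | lower_wt (content p.2) == k] - (if k == l then wcomb r else 0).
pose s := undup (l :: [seq lower_wt (content p.2) | p <- r]).
have ls : l \in s by rewrite mem_undup inE eqxx.
have us : uniq s := undup_uniq _.
have gw k : k \in s -> weight_space rho k (g k).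
  move=> _; rewrite /g -scaleN1r addrC; apply: weight_space_sub.
    by case: eqP => [->|_] //; exact: weight_space0.
  rewrite /wcomb big_filter; apply: weight_space_sum => p /eqP <-.
  exact/weight_spaceZ/fword_wt.
have g0 : \sum_(k <- s) g k = 0.
  rewrite sumrB [X in _ - X](bigD1_seq l) //= eqxx [X in _ - (_ + X)]big1 ?addr0; last first.
    by move=> k /negPf ->.
  apply/eqP; rewrite subr_eq0; apply/eqP.
  under eq_bigr => k _ do rewrite /wcomb big_filter big_mkcond.
  rewrite exchange_big /= [LHS]big_seq [RHS]big_seq; apply: eq_bigr => p pr.
  rewrite (bigD1_seq (lower_wt (content p.2))) //= ?eqxx ?big1 ?addr0 //.
    by move=> k /negPf; rewrite eq_sym => ->.
  by rewrite mem_undup inE; apply/orP; right; apply/mapP; exists p.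
have /eqP := weight_space_indep us gw g0 ls.
by rewrite /g eqxx subr_eq0 => /eqP.
Qed.

Lemma weight_space_span l u : weight_space rho l u ->
  exists r, u = wcomb r /\ all (fun p => lower_wt (content p.2) == l) r.
Proof.
have [r ->] := wcomb_span u; move=> /wcomb_component ->.
by eexists; split=> //; apply: filter_all.
Qed.

Lemma weight_space_out l u : (forall c, l != lower_wt c) -> weight_space rho l u -> u = 0.
Proof.
move=> Hl /weight_space_span [[|p r] [-> /=]]; first by rewrite /wcomb big_nil.
by rewrite eq_sym (negPf (Hl _)).
Qed.

(** The span of nonempty words, a complement to the line of [v0]; it acts as the kernel of the
    functional reading off the [v0] coefficient. *)
Let proper_comb (u : L) := exists2 r, u = wcomb r & all (fun p => p.2 != [::]) r.

Lemma proper_comb_v0 : ~ proper_comb v0.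
Proof.
move=> [r v0r rN]; have := v0_wt; rewrite -lower_wt0 {1}v0r => /wcomb_component.
rewrite -v0r (_ : filter _ _ = [::]); first by rewrite /wcomb big_nil => /eqP; rewrite (negPf v0_neq0).
apply/eqP; rewrite -size_eq0 size_filter -leqn0 leqNgt -has_count -all_predC.
apply: sub_all rN => -[a [|i s]] //= _; apply/eqP => /lower_wt_inj /(congr1 (@mdeg _)).
by rewrite mdegD mdeg1 mdeg0.
Qed.

Lemma proper_combP a u v : proper_comb u -> proper_comb v -> proper_comb (a *: u + v).
Proof.
move=> [r1 -> H1] [r2 -> H2].
exists ([seq (a * p.1, p.2) | p <- r1] ++ r2); first by rewrite wcomb_cat wcomb_scale.
by rewrite all_cat H2 andbT all_map.
Qed.

Lemma proper_comb0 : proper_comb 0.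
Proof. by exists [::]; rewrite // /wcomb big_nil. Qed.

Lemma proper_combZ a u : proper_comb u -> proper_comb (a *: u).
Proof. by move=> H; rewrite -[_ *: _]addr0; apply: proper_combP H proper_comb0. Qed.

Lemma proper_comb_sum (J : Type) (r : seq J) (G : J -> L) :
  (forall j, proper_comb (G j)) -> proper_comb (\sum_(j <- r) G j).
Proof.
move=> H; apply: big_ind => //; first exact: proper_comb0.
by move=> u v Hu Hv; rewrite -[u]scale1r; apply: proper_combP.
Qed.

Lemma proper_comb_f i u : proper_comb (f i u).
Proof.
have [r ->] := wcomb_span u; exists [seq (p.1, i :: p.2) | p <- r]; first by rewrite wcomb_f.
by rewrite all_map; apply/allP.
Qed.

Lemma proper_comb_weight (X : endo L) (ev : weight F n -> F) u :
  (forall l u, weight_space rho l u -> X u = ev l *: u) -> proper_comb u -> proper_comb (X u).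
Proof.
move=> HX [r -> Hr]; rewrite (wcomb_weight _ HX).
by eexists; first reflexivity; rewrite all_map.
Qed.

(* The vectors all of whose images under raising words have no v0-component
   form a proper subrepresentation. *)
Lemma raising_words_faithful u :
  (forall s : seq I, proper_comb (foldr (fun i w => e i w) u s)) -> u = 0.
Proof.
pose ew s u := foldr (fun i w => e i w) u s.
have ewP s a u1 u2 : ew s (a *: u1 + u2) = a *: ew s u1 + ew s u2.
  by elim: s => //= i s ->; rewrite linearP.
have ew_rcons s i u1 : ew (rcons s i) u1 = ew s (e i u1) by elim: s => //= j s ->.
have ewS i s u1 : ew (i :: s) u1 = e i (ew s u1) by [].
pose Z : set L := [set u | forall s, proper_comb (ew s u)].
have Zcart (X : endo L) (ev : weight F n -> F) (w : I -> F) u1 :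
    (forall l u, weight_space rho l u -> X u = ev l *: u) ->
    (forall i, lie X (e i) = sc (w i) * e i) -> Z u1 -> Z (X u1).
  move=> HX Hw Zu s.
  have -> : ew s (X u1) = (- \sum_(i <- s) w i) *: ew s u1 + X (ew s u1).
    elim: s => [|i s IH]; first by rewrite big_nil oppr0 scale0r add0r.
    rewrite !ewS IH linearP big_cons opprD scalerDl -addrA addrCA; congr (_ + _).
    have /endoP /(_ (ew s u1)) := Hw i; rewrite lieE => /eqP; rewrite subr_eq => /eqP ->.
    by rewrite endoME endo_scaleE addrA scaleNr addNr add0r.
  by apply: proper_combP => //; apply: (proper_comb_weight HX).
suff Z0 : Z = [set 0] by move=> Hu; have : Z u by []; rewrite Z0.
suff Zsub : subrep rho Z.
  case: irr => _ /(_ Z Zsub) [//|ZT].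
  by have : Z v0 by [rewrite ZT]; move/(_ [::]) => /proper_comb_v0.
split.
- have ew0 s : ew s 0 = 0 by elim: s => // i s IH; rewrite ewS IH linear0.
  by move=> s; rewrite ew0; exact: proper_comb0.
- by move=> a u1 u2 H1 H2 s; rewrite ewP; apply: proper_combP.
- have Ze i u1 : Z u1 -> Z (e i u1) by move=> H s; rewrite -ew_rcons.
  have Zh i u1 : Z u1 -> Z (h i u1).
    apply: (Zcart (h i) (fun l => l.1 0 i) (fun j => cartanF F i j)); first exact: h_weight.
    exact: op_he.
  move=> i u1 Zu; split; [exact: Ze| |exact: Zh].
  move=> s; elim/last_ind: s u1 Zu => [|s j IH] u1 Zu; first exact: proper_comb_f.
  rewrite ew_rcons.
  have -> : e j (rep_f rho i u1) = (if j == i then 1 else 0) *: h i u1 + f i (e j u1).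
    have /endoP /(_ u1) := op_ef j i; rewrite lieE => /eqP; rewrite subr_eq => /eqP ->.
    by case: eqP => [->|_]; rewrite ?scale1r ?scale0r.
  by rewrite ewP; apply: proper_combP; [exact: Zh|exact/IH/Ze].
- move=> u1; exact: (Zcart d (fun l => l.2) (fun j => (j == 0 :> nat)%:R) u1 d_weight op_de).
Qed.

(** A raising element kills [v0]; commuting with every [f j], it kills all words, which span the
    module. *)
Lemma lower_inj_e k a X : root_span sc e k.+2 a X -> (forall j, lie (f j) X = 0) -> X = 0.
Proof.
move=> HX fX.
have X0 : X v0 = 0.
  elim: HX => {k a X fX} [a|k b a X _ IH|k a1 a2 X1 X2 _ IH1 _ IH2].
  - rewrite /lincomb endo_sumE big1 // => i _.
    by rewrite endoME endo_scaleE /= v0_hi scaler0.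
  - rewrite lieE IH linear0 sub0r /lincomb endo_sumE.
    under eq_bigr => i _ do rewrite endoME endo_scaleE /= v0_hi scaler0.
    by rewrite big1_eq linear0 oppr0.
  - by rewrite endoDE IH1 IH2 addr0.
have Xw s : X (fword s) = 0.
  elim: s => [|i s IH] //.
  have /endoP /(_ (fword s)) := fX i; rewrite lieE IH linear0 sub0r => /eqP.
  by rewrite oppr_eq0 => /eqP.
apply/endoP => u; have [r ->] := wcomb_span u.
by rewrite linear_sum big1 // => p _; rewrite linearZ /= Xw scaler0.
Qed.

(** The dual argument: the image of a lowering element has no [v0] component, and since X commutes
    with every [e j], neither has any raised image, so [raising_words_faithful] applies. *)
Lemma lower_inj_f k a X : root_span sc f k.+2 a X -> (forall j, lie (e j) X = 0) -> X = 0.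
Proof.
move=> HX eX.
have XN u : proper_comb (X u).
  have fN b u1 : proper_comb (lincomb sc f b u1).
    rewrite /lincomb endo_sumE; apply: proper_comb_sum => i.
    exact/proper_combZ/proper_comb_f.
  elim: HX u => {k a X eX} [a|k b a X _ IH|k a1 a2 X1 X2 _ IH1 _ IH2] u //.
  - by rewrite lieE -scaleN1r addrC; apply: proper_combP.
  - by rewrite endoDE -[X1 u]scale1r; apply: proper_combP.
apply/endoP => u; apply: raising_words_faithful => s.
have -> : foldr (fun i w => e i w) (X u) s = X (foldr (fun i w => e i w) u s); last exact: XN.
elim: s => [|i s IH] //=; rewrite IH.
have /endoP /(_ (foldr (fun i w => e i w) u s)) := eX i; rewrite lieE => /eqP.
by rewrite subr_eq0 => /eqP.
Qed.

Definition arc (k : nat) (i : I) : 'X_{1..n} := (\big[mnm_add/0%MM]_(l < k) U_((i + l%:R)%R))%MM.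

Lemma lower_wtD c k i :
  lower_wt (arc k i + c)%MM = lower_wt c - \sum_(l < k) simple_root F (i + l%:R).
Proof.
rewrite /arc; elim: k => [|k IH]; first by rewrite !big_ord0 add0m subr0.
by rewrite !big_ord_recr /= [(_ + U_(_))%MM]addmC -addmA lower_wtS IH opprD addrA.
Qed.

Lemma mdeg_arc k i : mdeg (arc k i) = k.
Proof.
rewrite /arc mdeg_sum; under eq_bigr => l _ do rewrite mdeg1.
by rewrite sum1_card card_ord.
Qed.

Lemma root1 k (i j : I) : (\sum_(l < k) simple_root F (i + l%:R)).1 0 j = arc_sum (cartanF F j) k i.
Proof. by rewrite weight1_sum; apply: eq_bigr => l _; rewrite mxE. Qed.

Lemma root2 k (i : I) : (\sum_(l < k) simple_root F (i + l%:R)).2 =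
  arc_sum (fun j : I => (j == 0 :> nat)%:R) k i.
Proof. by rewrite weight2_sum; apply: eq_bigr. Qed.

Definition shell_quad (c : 'X_{1..n}) : F :=
  \sum_j ((c j)%:R * (c j)%:R - (c j)%:R * (c (j + 1))%:R).

(** With beta the sum of c_j alpha_j this is (|Lam + rho|^2 - |Lam + rho - beta|^2) / 2, for simple
    roots of square length 2; [shell_quad] is |beta|^2 / 2. *)
Definition casimir_val (c : 'X_{1..n}) : F :=
  \sum_j ((lam j)%:R + 1) * (c j)%:R - shell_quad c.

Lemma casimir_valS c j : casimir_val (U_(j) + c)%MM = casimir_val c + coroot_val c j.
Proof.
have sd (G : I -> F) : \sum_i G i * (j == i)%:R = G j.
  rewrite (bigD1 j) //= eqxx mulr1 big1 ?addr0 // => i; rewrite eq_sym => /negPf ->.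
  by rewrite mulr0.
have sd1 (G : I -> F) : \sum_i G i * (j == i + 1)%:R = G (j - 1).
  rewrite -(sum_shift _ (-1)); under eq_bigr => i _ do rewrite subrK.
  exact: sd.
have -> : casimir_val (U_(j) + c)%MM =
    casimir_val c + \sum_i ((lam i)%:R + 1 - (c i)%:R *+ 2 - 1 + (c (i + 1))%:R) * (j == i)%:R
    + \sum_i (c i)%:R * (j == i + 1)%:R.
  rewrite /casimir_val /shell_quad -!sumrB -!big_split; apply: eq_bigr => i _ /=.
  rewrite !mnmDE !mnm1E !natrD.
  have jj : (j == i)%:R * (j == i)%:R = (j == i)%:R :> F by case: (j == i); rewrite ?mulr1 ?mulr0.
  have j1 : (j == i)%:R * (j == i + 1)%:R = 0 :> F.
    case: eqP => [->|]; rewrite ?mul0r //.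
    by rewrite -[X in X == _]addr0 (inj_eq (addrI _)) eq_sym oner_eq0 mulr0.
  rewrite !(mulrDl, mulrDr) jj j1; ring.
rewrite sd sd1 /coroot_val; ring.
Qed.

Lemma casimir_val0 : casimir_val 0%MM = 0.
Proof.
by rewrite /casimir_val /shell_quad !big1 ?subr0 // => i _; rewrite !mnm0E ?mulr0 ?subr0.
Qed.

(** The scalar by which the bracket of X and Y from [casimir_elements] acts on the weight space of
    [c]. *)
Definition kappa (k : nat) (i : I) (c : 'X_{1..n}) : F :=
  (1 - (n %| k)%:R / n%:R) * arc_sum (coroot_val c) k i.

Lemma content_eq0 s : content s = 0%MM -> s = [::].
Proof. by case: s => //= i s /(congr1 (@mdeg _)); rewrite mdegD mdeg1 mdeg0. Qed.

(** Words of content [c] have length [mdeg c], so there are finitely many of them. *)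
Lemma lower_space_span c : exists s, [set u | weight_space rho (lower_wt c) u] = span s.
Proof.
exists [seq fword s | s <- [seq tval t | t <- enum {: (mdeg c).-tuple I}] & content s == c].
apply/seteqP; split=> u /=.
  move=> /weight_space_span [r [-> /allP Hr]]; rewrite /wcomb big_seq.
  apply: span_sum => p /Hr /eqP /lower_wt_inj pc; apply/spanZ/span_mem/map_f.
  rewrite mem_filter pc eqxx /=; apply/mapP.
  have sz : size p.2 == mdeg c by rewrite -pc mdeg_content.
  by exists (Tuple sz) => //; rewrite mem_enum.
set t := (X in [seq _ | _ <- X & _]); elim: t u => [|s t IH] u /=.
  by move=> ->; exact: weight_space0.
case: eqP => [sc|_]; last exact: IH.
move=> [a /IH Ha]; rewrite -[u](subrK (a *: fword s)) addrC.
by apply: weight_space_sub => //; rewrite -sc; exact: fword_wt.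
Qed.

Lemma lower_space_dim c : exists m, has_dim (weight_space rho (lower_wt c)) m.
Proof.
have [s Hs] := lower_space_span c; have [m Hm] := has_dim_span s; exists m.
by rewrite (_ : weight_space rho (lower_wt c) = span s) // -Hs.
Qed.

(** * Freudenthal's recursion by traces *)

Section Trace.
Let V c := weight_space rho (lower_wt c).
Variables (m : 'X_{1..n} -> nat) (b : forall c, 'I_(m c) -> L).
Variable coord : forall c, L -> 'rV[F]_(m c).
Arguments coord : clear implicits.
Arguments b : clear implicits.
Hypothesis bV : forall c i, V c (b c i).
Hypothesis coordP : forall c u, V c u -> u = \sum_i coord c u 0 i *: b c i.
Hypothesis coordU : forall c (x : 'rV[F]_(m c)), coord c (\sum_i x 0 i *: b c i) = x.

Lemma coord_lin c a u v : V c u -> V c v -> coord c (a *: u + v) = a *: coord c u + coord c v.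
Proof.
move=> Vu Vv; rewrite -[RHS]coordU; congr (coord c _).
rewrite {1}(coordP Vu) {1}(coordP Vv) scaler_sumr -big_split; apply: eq_bigr => i _ /=.
by rewrite !mxE scalerDl scalerA.
Qed.

Lemma coord0 c : coord c 0 = 0.
Proof.
have := coord_lin (-1) (weight_space0 (lower_wt c)) (weight_space0 (lower_wt c)).
by rewrite scaler0 addr0 scaleN1r addNr.
Qed.

Lemma coord_sum c (J : Type) (r : seq J) (a : J -> F) (G : J -> L) :
  (forall j, V c (G j)) ->
  coord c (\sum_(j <- r) a j *: G j) = \sum_(j <- r) a j *: coord c (G j).
Proof.
move=> H; elim: r => [|j r IH]; first by rewrite !big_nil coord0.
rewrite !big_cons coord_lin ?IH //.
by apply: weight_space_sum => j' _; apply: weight_spaceZ; apply: H.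
Qed.

Definition op_mx c c' (X : endo L) : 'M[F]_(m c, m c') :=
  \matrix_(i, j) coord c' (X (b c i)) 0 j.

Definition op_tr c (Z : endo L) : F := \sum_i coord c (Z (b c i)) 0 i.

Lemma op_trM c c' (X Y : endo L) : (forall u, V c u -> V c' (X u)) ->
  (forall u, V c' u -> V c (Y u)) ->
  op_tr c (Y * X) = \tr (op_mx c c' X *m op_mx c' c Y).
Proof.
move=> HX HY; apply: eq_bigr => i _; rewrite endoME {1}(coordP (HX _ (bV i))).
rewrite linear_sum mxE; under eq_bigr => j _ do rewrite linearZ.
rewrite coord_sum; last by move=> j; apply: HY.
by rewrite summxE; apply: eq_bigr => j _; rewrite !mxE.
Qed.

Lemma op_trC c c' (X Y : endo L) : (forall u, V c u -> V c' (X u)) ->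
  (forall u, V c' u -> V c (Y u)) -> op_tr c (Y * X) = op_tr c' (X * Y).
Proof. by move=> HX HY; rewrite (op_trM HX HY) (op_trM HY HX) mxtrace_mulC. Qed.

Lemma op_tr_scalar c (Z : endo L) z : (forall u, V c u -> Z u = z *: u) ->
  op_tr c Z = z * (m c)%:R.
Proof.
move=> HZ; rewrite /op_tr.
have cb i : coord c (b c i) = delta_mx 0 i.
  rewrite -[RHS]coordU; congr (coord c _); rewrite (bigD1 i) //= mxE !eqxx scale1r.
  by rewrite big1 ?addr0 // => j ji; rewrite mxE eqxx (negPf ji) scale0r.
under eq_bigr => i _.
  rewrite HZ // -[_ *: _]addr0 coord_lin //; last exact: weight_space0.
  rewrite coord0 addr0 cb !mxE !eqxx mulr1; over.
by rewrite sumr_const card_ord mulr_natr.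
Qed.

Lemma op_trD c (Z1 Z2 : endo L) : (forall u, V c u -> V c (Z1 u)) ->
  (forall u, V c u -> V c (Z2 u)) -> op_tr c (Z1 + Z2) = op_tr c Z1 + op_tr c Z2.
Proof.
move=> H1 H2; rewrite /op_tr -big_split; apply: eq_bigr => i _ /=.
rewrite -[X in coord c X]/(Z1 (b c i) + Z2 (b c i)) -[Z1 _]scale1r coord_lin ?scale1r ?mxE //; [exact: H1|exact: H2].
Qed.

Lemma op_tr_sum c (J : Type) (r : seq J) (Z : J -> endo L) :
  (forall j u, V c u -> V c (Z j u)) ->
  op_tr c (\sum_(j <- r) Z j) = \sum_(j <- r) op_tr c (Z j).
Proof.
move=> H; elim: r => [|j r IH].
  by rewrite !big_nil /op_tr big1 // => i _; rewrite endo0E coord0 mxE.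
rewrite !big_cons op_trD ?IH //; first exact: H.
by move=> u Vu; rewrite endo_sumE; apply: weight_space_sum => j' _; apply: H.
Qed.

(** [t k i c] is the trace of [Y k i * X k i] on the weight space of [c]. Cyclicity turns it into
    the trace of X Y on the space one root higher, where [X, Y] is a scalar; this gives the
    recursion. The sum over all arcs is the trace of the Casimir scalar. *)
Lemma freudenthal_trace : exists t : nat -> I -> 'X_{1..n} -> F,
  (forall k i c, t k i c = if (arc k.+1 i <= c)%MM then
      t k i (c - arc k.+1 i)%MM + kappa k.+1 i (c - arc k.+1 i)%MM * (m (c - arc k.+1 i)%MM)%:R
     else 0) /\
  (forall c T, (mdeg c <= T.+1)%N ->
     \sum_(k < T.+1) \sum_i t k i c = casimir_val c * (m c)%:R).
Proof.
have [X [Y [HX HY HXY HS]]] :=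
  casimir_elements (@endo_scaleC F L) op_he op_hf op_ef lower_inj_e lower_inj_f.
have Xw l k i u : weight_space rho l u ->
    weight_space rho (l + \sum_(q < k.+1) simple_root F (i + q%:R)) (X k i u).
  apply: weight_space_op => [j|]; first by rewrite root1; apply: HX => p; apply: op_he.
  by rewrite root2; apply: HX => p; apply: op_de.
have Yw l k i u : weight_space rho l u ->
    weight_space rho (l - \sum_(q < k.+1) simple_root F (i + q%:R)) (Y k i u).
  have aN (w : I -> F) q p : - arc_sum w q p = arc_sum (fun x => - w x) q p.
    by rewrite /arc_sum sumrN.
  apply: weight_space_op => [j|].
    rewrite mxE root1 aN; apply: HY => p; rewrite op_hf rmorphN mulNr //.
  by rewrite /= root2 aN; apply: HY => p; rewrite op_df rmorphN mulNr.
have XV k i c u : V c u -> (arc k.+1 i <= c)%MM -> V (c - arc k.+1 i)%MM (X k i u).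
  move=> /(Xw _ k i) + le; rewrite -{1}(submK le) addmC lower_wtD subrK //.
have X0 k i c u : V c u -> ~~ (arc k.+1 i <= c)%MM -> X k i u = 0.
  move=> /(Xw _ k i) + nle; apply: weight_space_out => c'.
  apply: contra nle => /eqP E; have /lower_wt_inj -> : lower_wt c = lower_wt (arc k.+1 i + c')%MM.
    by rewrite lower_wtD -E addrK.
  exact: lem_addr.
have YV k i c u : V c u -> V (arc k.+1 i + c)%MM (Y k i u).
  by move=> /(Yw _ k i); rewrite /V lower_wtD.
have YXV k i c u : V c u -> V c ((Y k i * X k i) u).
  move=> Vu; rewrite endoME; case: (boolP (arc k.+1 i <= c)%MM) => le.
    by rewrite -(submK le) addmC; apply/YV/XV.
  by rewrite (X0 _ _ _ _ Vu le) linear0; apply: weight_space0.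
exists (fun k i c => op_tr c (Y k i * X k i)); split.
  move=> k i c; case: ifP => le; last first.
    rewrite (@op_tr_scalar _ _ 0) ?mul0r // => u Vu.
    by rewrite endoME (X0 _ _ _ _ Vu) ?le // linear0 scale0r.
  set c' := (c - arc k.+1 i)%MM.
  have YV' u : V c' u -> V c (Y k i u).
    by move=> /(YV k i); rewrite addmC submK.
  rewrite (op_trC (c' := c') (X := X k i) (Y := Y k i)) //; last by move=> u Vu; apply: XV.
  have -> : X k i * Y k i = Y k i * X k i + lie (X k i) (Y k i) by rewrite addrC subrK.
  have hk u : V c' u -> lie (X k i) (Y k i) u = kappa k.+1 i c' *: u.
    move=> Vu; rewrite HXY endoME endo_scaleE -scalerA; congr (_ *: _).
    rewrite /arc_sum endo_sumE scaler_suml; apply: eq_bigr => q _.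
    by rewrite (h_weight _ Vu) lower_wt1.
  rewrite op_trD; [|exact: YXV|by move=> u Vu; rewrite hk //; apply: weight_spaceZ].
  by rewrite (op_tr_scalar hk).
move=> c T cT.
pose S := \sum_(k < T.+1) \sum_i Y k i * X k i.
have YXsumV k u : V c u -> V c ((\sum_i Y k i * X k i) u).
  by move=> Vu; rewrite endo_sumE; apply: weight_space_sum => i _; apply: YXV.
have -> : \sum_(k < T.+1) \sum_i op_tr c (Y k i * X k i) = op_tr c S.
  rewrite op_tr_sum; last by move=> k u; apply: YXsumV.
  by apply: eq_bigr => k _; rewrite op_tr_sum // => i u; apply: YXV.
apply: op_tr_scalar => u Vu.
(* Induction on the word by moving [f j] past [S]. The boundary terms vanish because [X T] raises by
   T + 1 and the remaining word has length at most T. *)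
have Sw s : (size s <= T.+1)%N -> S (fword s) = casimir_val (content s) *: fword s.
  elim: s => [|j s IH] sz.
    rewrite casimir_val0 scale0r /S endo_sumE big1 // => k _; rewrite endo_sumE big1 // => i _.
    rewrite endoME (X0 k i 0%MM) ?linear0 //; first by rewrite /V lower_wt0.
    apply/mnm_lepP => /(_ i); rewrite mnm0E leqNgt; apply/negP; rewrite negbK.
    by rewrite /arc mnm_sumE big_ord_recl /= addr0 mnm1E eqxx.
  have Vs : V (content s) (fword s) := fword_wt s.
  have Xs i : X T i (fword s) = 0.
    apply: X0 Vs _; apply/negP => /mnm_lepP le.
    have : (mdeg (arc T.+1 i) <= mdeg (content s))%N.
      by rewrite !mdegE; apply: leq_sum => p _; apply: le.
    by rewrite mdeg_arc mdeg_content leqNgt (sz : (size s < T.+1)%N).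
  have /endoP /(_ (fword s)) := HS T j; rewrite lieE -/S.
  rewrite endoDE endoNE endoBE !endoME !Xs !linear0 !addr0 => H.
  have -> : S (fword (j :: s)) = f j (S (fword s)) + f j (h j (fword s)).
    by rewrite -[X in _ + X]opprK -H opprB addrC subrK.
  rewrite (h_weight _ Vs) IH; last exact: ltnW.
  rewrite -[casimir_val _ *: _]addr0 linearP linear0 addr0.
  by rewrite -[(lower_wt _).1 0 j *: _]addr0 linearP linear0 addr0 -scalerDl lower_wt1 -casimir_valS.
have [r [-> /allP Hr]] := weight_space_span Vu.
rewrite /wcomb linear_sum scaler_sumr big_seq [RHS]big_seq; apply: eq_bigr => p /Hr /eqP /lower_wt_inj pc.
by rewrite linearZ /= Sw -?mdeg_content pc // !scalerA mulrC.
Qed.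

End Trace.

(** * Reflection invariance of weight multiplicities *)

Hypothesis intg : integrable_rep rho.

Let V c := weight_space rho (lower_wt c).

Lemma lower_space_f M i c u : V c u -> V (U_(i) *+ M + c)%MM (iter M (f i) u).
Proof.
move=> Vu; elim: M => [|M IH]; first by rewrite mulm0n add0m.
by rewrite iterS mulmS -addmA /V lower_wtS; apply: weight_space_f.
Qed.

Lemma lower_space_e M i c u : V (U_(i) *+ M + c)%MM u -> V c (iter M (e i) u).
Proof.
elim: M c => [|M IH] c; first by rewrite mulm0n add0m.
rewrite mulmSr -addmA => /IH; rewrite iterS /V lower_wtS => /(weight_space_e i).
by rewrite subrK.
Qed.

Lemma weight_space_e_iter M i l u : weight_space rho l u ->
  weight_space rho (l + simple_root F i *+ M) (iter M (e i) u).
Proof.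
move=> Hu; elim: M => [|M IH]; first by rewrite addr0.
by rewrite iterS mulrSr addrA; apply: weight_space_e.
Qed.

Lemma sl2_rels i : [/\ forall u, h i (e i u) = e i (h i u) + 2%:R *: e i u,
  forall u, h i (f i u) = f i (h i u) - 2%:R *: f i u
  & forall u, e i (f i u) = f i (e i u) + h i u].
Proof.
have c2 : cartanF F i i = 2%:R.
  have i1 : i + 1 != i by rewrite -[X in _ == X]addr0 (inj_eq (addrI _)) oner_eq0.
  have i2 : i - 1 != i by rewrite -[X in _ == X]addr0 (inj_eq (addrI _)) oppr_eq0 oner_eq0.
  by rewrite cartanFE eqxx [i == i + 1]eq_sym [i == i - 1]eq_sym (negPf i1) (negPf i2) !subr0.
split=> u.
- have /endoP /(_ u) := op_he i i; rewrite lieE c2 => /eqP; rewrite subr_eq => /eqP ->.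
  by rewrite addrC.
- have /endoP /(_ u) := op_hf i i; rewrite lieE c2 => /eqP; rewrite subr_eq => /eqP ->.
  by rewrite addrC.
- have /endoP /(_ u) := op_ef i i; rewrite eqxx lieE => /eqP; rewrite subr_eq => /eqP ->.
  by rewrite addrC.
Qed.

Lemma lower_f_inj i c M u : coroot_val c i = M%:R -> V c u -> iter M (f i) u = 0 -> u = 0.
Proof.
move=> cM Vu; have [he hf ef] := sl2_rels i; have [_ /(_ i u) [N [eN _]]] := intg.
apply: (sl2_lowering_inj he hf ef _ eN).
by rewrite (h_weight _ Vu) lower_wt1 cM.
Qed.

Lemma lower_e_inj i c M u : coroot_val c i = - M%:R -> V c u -> iter M (e i) u = 0 -> u = 0.
Proof.
move=> cM Vu; have [he hf ef] := sl2_rels i; have [_ /(_ i u) [N [_ fN]]] := intg.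
move=> eM; apply: (sl2_lowering_inj (h := - h i) (e := f i) (f := e i) (M := M) _ _ _ _ fN) => //.
- by move=> w; rewrite !endoNE hf opprB linearN addrC.
- by move=> w; rewrite !endoNE he opprD linearN.
- by move=> w; rewrite endoNE ef addrK.
- by rewrite endoNE (h_weight _ Vu) lower_wt1 cM scaleNr opprK.
Qed.

Lemma iter_endo (X : endo L) M : exists Y : endo L, forall u, Y u = iter M X u.
Proof.
elim: M => [|M [Y HY]]; first by exists 1.
by exists (X * Y) => u; rewrite endoME HY.
Qed.

Section Reflection.
Variable m : 'X_{1..n} -> nat.
Hypothesis mV : forall c, has_dim (V c) (m c).

(** The last condition says that [c'] is the reflection of [c] in the simple root i. The coroot
    takes the values M and - M on the two spaces, so f_i^M and e_i^M are injective in opposite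
    directions. *)
Lemma mult_reflect_le i (c c' : 'X_{1..n}) : (forall j, j != i -> c' j = c j) -> (c i <= c' i)%N ->
  (c i + c' i = lam i + c (i + 1)%R + c (i - 1)%R)%N -> m c = m c'.
Proof.
move=> cj le sum.
pose M := (c' i - c i)%N.
have c'E : c' = (U_(i) *+ M + c)%MM.
  apply/mnmP => j; rewrite mnmDE mulmnE mnm1E; case: (eqVneq i j) => [<-|ij].
    by rewrite mul1n subnK.
  by rewrite mul0n add0n cj // eq_sym.
have i1 : i + 1 != i by rewrite -[X in _ == X]addr0 (inj_eq (addrI _)) oner_eq0.
have i2 : i - 1 != i by rewrite -[X in _ == X]addr0 (inj_eq (addrI _)) oppr_eq0 oner_eq0.
have sumF : (c i)%:R + (c' i)%:R = (lam i)%:R + (c (i + 1))%:R + (c (i - 1))%:R :> F.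
  by rewrite -!natrD sum.
have key (x y a b l : F) : x + y = l + a + b -> l - (x *+ 2 - a - b) = y - x.
  by move=> H; have -> : l = x + y - a - b by [rewrite H; ring]; ring.
have cM : coroot_val c i = M%:R by rewrite /coroot_val /M natrB // (key _ _ _ _ _ sumF).
have c'M : coroot_val c' i = - M%:R.
  by rewrite /coroot_val /M natrB // [RHS]opprB (cj _ i1) (cj _ i2) (key _ (c i)%:R) // addrC.
have lin c1 a u v : V c1 u -> V c1 v -> V c1 (a *: u + v) by exact: weight_space_sub.
apply/eqP; rewrite eqn_leq; apply/andP; split.
  have [Y HY] := iter_endo (f i) M.
  apply: (has_dim_le (g := Y) (mV c) (mV c') (lin c) (weight_space0 _)) => u Vu.
  - by rewrite HY c'E; apply: lower_space_f.
  - by rewrite HY; apply: lower_f_inj Vu.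
have [Y HY] := iter_endo (e i) M.
apply: (has_dim_le (g := Y) (mV c') (mV c) (lin c') (weight_space0 _)) => u Vu.
- by rewrite HY; apply: (@lower_space_e _ i); rewrite -c'E.
- by rewrite HY; apply: lower_e_inj Vu.
Qed.

(** The reflected weight would have a negative coefficient at i, so the injective map e_i^M ends in
    a zero space. *)
Lemma mult_reflect_out i (c : 'X_{1..n}) : (lam i + c (i + 1)%R + c (i - 1)%R < c i)%N -> m c = 0%N.
Proof.
move=> lt.
pose M := ((c i).*2 - (lam i + c (i + 1)%R + c (i - 1)%R))%N.
have Mc : (c i < M)%N by rewrite /M; lia.
have cM : coroot_val c i = - M%:R.
  rewrite /M natrB; last by lia.
  by rewrite /coroot_val -muln2 !natrD natrM; ring.
have V0 u : V c u -> u = 0.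
  move=> Vu; apply: (lower_e_inj cM Vu).
  apply: (weight_space_out _ (weight_space_e_iter M i Vu)) => c1.
  apply/eqP => E; have : lower_wt c = lower_wt (U_(i) *+ M + c1)%MM.
    rewrite -[LHS](addrK (simple_root F i *+ M)) E; elim: (M) => [|q IH].
      by rewrite mulm0n add0m subr0.
    by rewrite mulmS -addmA lower_wtS -IH mulrSr opprD addrA.
  move=> /lower_wt_inj cE; move: Mc.
  by rewrite cE mnmDE mulmnE mnm1E eqxx mul1n ltnNge leq_addr.
apply/eqP; rewrite -leqn0.
have H0 : has_dim (V c) 0%N.
  exists (fun=> 0); split=> [[]//|u /V0 ->]; exists 0.
  by split=> [|x _]; rewrite ?big_ord0 // [x]thinmx0.
rewrite (has_dim_uniq (mV c) H0) //; last exact: weight_space0.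
by move=> a u v; apply: weight_space_sub.
Qed.
End Reflection.

Lemma mult0 m : has_dim (V 0%MM) m -> m = 1%N.
Proof.
move=> Hm; apply: (has_dim_uniq Hm); last exact: weight_space0; last first.
  by move=> a u v; apply: weight_space_sub.
exists (fun=> v0); split=> [_|u Vu]; first by rewrite /V lower_wt0.
have [r [-> /allP Hr]] := weight_space_span Vu.
have uE : wcomb r = (\sum_(p <- r) p.1) *: v0.
  rewrite /wcomb scaler_suml big_seq [RHS]big_seq; apply: eq_bigr => p /Hr /eqP.
  by move=> /lower_wt_inj /content_eq0 ->.
exists (const_mx (\sum_(p <- r) p.1)); split; first by rewrite big_ord1 mxE uE.
move=> x; rewrite big_ord1 uE => /eqP; rewrite -subr_eq0 -scalerBl scaler_eq0 (negPf v0_neq0).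
rewrite orbF subr_eq0 => /eqP xE; apply/rowP => i; rewrite mxE xE (ord1 i); congr (x _ _); exact: val_inj.
Qed.

Theorem lower_multiplicities : exists (m : 'X_{1..n} -> nat) (t : nat -> I -> 'X_{1..n} -> F),
  [/\ (forall c, has_dim (V c) (m c)) /\ m 0%MM = 1%N,
      forall i (c c' : 'X_{1..n}), (forall j, j != i -> c' j = c j) ->
        (c i + c' i = lam i + c (i + 1)%R + c (i - 1)%R)%N -> m c = m c',
      forall i (c : 'X_{1..n}), (lam i + c (i + 1)%R + c (i - 1)%R < c i)%N -> m c = 0%N,
      forall k i c, t k i c = if (arc k.+1 i <= c)%MM then
        t k i (c - arc k.+1 i)%MM + kappa k.+1 i (c - arc k.+1 i)%MM * (m (c - arc k.+1 i)%MM)%:R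
       else 0
    & forall c T, (mdeg c <= T.+1)%N ->
        \sum_(k < T.+1) \sum_i t k i c = casimir_val c * (m c)%:R].
Proof.
pose m c := projT1 (cid (lower_space_dim c)).
have mV c : has_dim (V c) (m c) by rewrite /m; case: cid.
pose b c := projT1 (cid (mV c)).
have [bV bU] : (forall c i, V c (b c i)) /\ (forall c v, V c v ->
    exists! x : 'rV_(m c), v = \sum_i x 0 i *: b c i).
  by split=> c; rewrite /b; case: cid => b' [].
(* [coord] has to be total; outside [V c] nothing is required of it. *)
have cP c v : exists x : 'rV_(m c), V c v -> v = \sum_i x 0 i *: b c i.
  by case: (EM (V c v)) => [/bU [x [Hx _]]|Nv]; [exists x|exists 0].
pose coord c v := projT1 (cid (cP c v)).
have coordP c v : V c v -> v = \sum_i coord c v 0 i *: b c i by rewrite /coord; case: cid.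
have coordU c (x : 'rV[F]_(m c)) : coord c (\sum_i x 0 i *: b c i) = x.
  have Vx : V c (\sum_i x 0 i *: b c i).
    by apply: weight_space_sum => i _; apply/weight_spaceZ/bV.
  by have [y [_ yU]] := bU _ _ Vx; transitivity y; [symmetry; apply: yU; exact: coordP|exact: yU].
have [t [t1 t2]] := freudenthal_trace bV coordP coordU.
exists m, t; split => //.
- by split=> //; exact: mult0.
- move=> i c c' cj sum; case: (leqP (c i) (c' i)) => le.
    exact: (mult_reflect_le mV cj le sum).
  symmetry; apply: (mult_reflect_le mV (i := i)) => [j ji||]; first by rewrite cj.
    exact: ltnW.
  have i1 : i + 1 != i by rewrite -[X in _ == X]addr0 (inj_eq (addrI _)) oner_eq0.
  have i2 : i - 1 != i by rewrite -[X in _ == X]addr0 (inj_eq (addrI _)) oppr_eq0 oner_eq0.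
  by rewrite (cj _ i1) (cj _ i2) addnC.
- exact: mult_reflect_out.
Qed.

End HighestWeight.

(** * Generating series *)

Section TruncatedSeries.
Variables (n : nat) (F : numFieldType).
Implicit Types (p q : {mpoly F[n]}) (c : 'X_{1..n}).

(* Membership in the ideal of terms of degree at least T: power series are
   handled as polynomials modulo this ideal. *)
Definition high (T : nat) p := forall c, (mdeg c < T)%N -> p@_c = 0.

Lemma mcoeffM_le p q c :
  (p * q)@_c = \sum_(a : 'X_{1..n < (mdeg c).+1} | (a <= c)%MM) p@_a * q@_(c - a).
Proof. by rewrite -mcoeff_poly_mul_lin. Qed.

Lemma mdeg_sub_le c a : (mdeg (c - a)%MM <= mdeg c)%N.
Proof. by rewrite !mdegE; apply: leq_sum => i _; rewrite mnmBE leq_subr. Qed.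

Lemma lem_mdeg (a c : 'X_{1..n}) : (a <= c)%MM -> (mdeg a <= mdeg c)%N.
Proof. by move=> /mnm_lepP ac; rewrite !mdegE; apply: leq_sum => i _; apply: ac. Qed.

Lemma highM T p q : high T q -> high T (p * q).
Proof.
move=> H c cT; rewrite mcoeffM_le big1 // => a _.
by rewrite H ?mulr0 // (leq_ltn_trans (mdeg_sub_le _ _)).
Qed.

Lemma highD T p q : high T p -> high T q -> high T (p + q).
Proof. by move=> Hp Hq c cT; rewrite mcoeffD Hp ?Hq ?addr0. Qed.

Lemma highN T p : high T p -> high T (- p).
Proof. by move=> Hp c cT; rewrite mcoeffN Hp ?oppr0. Qed.

Lemma highB T p q : high T p -> high T q -> high T (p - q).
Proof. by move=> Hp Hq; apply/highD/highN. Qed.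

Lemma high0 T : high T 0.
Proof. by move=> c _; rewrite mcoeff0. Qed.

Lemma high_sum T (J : Type) (r : seq J) (P : pred J) (G : J -> {mpoly F[n]}) :
  (forall j, P j -> high T (G j)) -> high T (\sum_(j <- r | P j) G j).
Proof. by move=> H; apply: big_ind => //; [exact: high0|exact: highD]. Qed.

Lemma mcoeffMX_le p b c :
  (p * 'X_[b])@_c = if (b <= c)%MM then p@_(c - b) else 0.
Proof.
case: ifP => bc; first by rewrite -{1}(submK bc) addmC mcoeffMX.
rewrite mcoeffM_le big1 // => a ac; rewrite mcoeffX.
case: eqP => [bE|]; last by rewrite mulr0.
by rewrite bE lem_subr in bc.
Qed.

(** The operator x_j d/dx_j scales the coefficient at [c] by [c j], so polynomials in [c] become
    differential operators. *)
Definition euler (j : 'I_n) p := 'X_j * p^`M(j).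

Lemma mcoeff_euler j p c : (euler j p)@_c = (c j)%:R * p@_c.
Proof.
rewrite /euler mulrC mcoeffMX_le; case: ifP => cj.
  rewrite mcoeff_mderiv submK // mnmBE mnm1E eqxx subn1 prednK ?mulr_natl //.
  by rewrite lt0n -lep1mP.
by move: cj; rewrite lep1mP => /negbFE /eqP ->; rewrite mul0r.
Qed.

Lemma eulerM j p q : euler j (p * q) = euler j p * q + p * euler j q.
Proof. by rewrite /euler mderivM; ring. Qed.

Lemma eulerD j p q : euler j (p + q) = euler j p + euler j q.
Proof. by rewrite /euler mderivD mulrDr. Qed.

Lemma eulerN j p : euler j (- p) = - euler j p.
Proof. by rewrite /euler mderivN mulrN. Qed.

Lemma euler1 j : euler j 1 = 0.
Proof. by rewrite /euler -mpolyC1 mderivC mulr0. Qed.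

Lemma euler_high T j p : high T p -> high T (euler j p).
Proof. by move=> H c cT; rewrite mcoeff_euler H ?mulr0. Qed.

Lemma eulerX j b : euler j 'X_[b] = (b j)%:R * 'X_[b].
Proof.
apply/mpolyP => c; rewrite mcoeff_euler -mpolyC_nat mcoeffCM mcoeffX.
by case: eqP => [->|]; rewrite ?mulr0.
Qed.

Definition geom (T : nat) (b : 'X_{1..n}) : {mpoly F[n]} := \sum_(r < T) 'X_[b *+ r].

Lemma high_geom T b : (0 < mdeg b)%N -> high T ((1 - 'X_[b]) * geom T b - 1).
Proof.
move=> b_gt0.
have -> : geom T b = \sum_(r < T) 'X_[b] ^+ r by apply: eq_bigr => r _; rewrite mpolyXn.
have -> : (1 - 'X_[b]) * (\sum_(r < T) 'X_[b] ^+ r) - 1 = - 'X_[b] ^+ T :> {mpoly F[n]}.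
  by rewrite -[1 - 'X_[b]]opprB mulNr -subrX1; ring.
apply: highN => c cT; rewrite mpolyXn mcoeffX; case: eqP => // bc; move: cT.
by rewrite -bc mdegMn ltnNge leq_pmull.
Qed.

(** Modulo high terms [g] is 1 / (1 - x^b). Differentiating (1 - x^b) g = 1 and multiplying by [g]
    gives its logarithmic derivative b_j x^b g. *)
Lemma euler_geom T j b : (0 < mdeg b)%N ->
  high T (euler j (geom T b) - (b j)%:R * 'X_[b] * geom T b * geom T b).
Proof.
move=> b_gt0; set g := geom T b; set x := 'X_[b].
have H := @high_geom T b b_gt0; have H1 := euler_high j H.
move: H H1; rewrite eulerD eulerN euler1 eulerM eulerD eulerN euler1 eulerX -/g -/x => H H1.
have -> : euler j g - (b j)%:R * x * g * g =
    g * ((0 - (b j)%:R * x) * g + (1 - x) * euler j g - 0) - euler j g * ((1 - x) * g - 1).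
  by ring.
by apply: highB; apply: highM.
Qed.

Lemma euler_prod T j (J : Type) (r : seq J) (G th : J -> {mpoly F[n]}) :
  (forall i, high T (euler j (G i) - G i * th i)) ->
  high T (euler j (\prod_(i <- r) G i) - (\prod_(i <- r) G i) * \sum_(i <- r) th i).
Proof.
move=> H; elim: r => [|i r IH]; first by rewrite !big_nil euler1 mulr0 subr0; exact: high0.
rewrite !big_cons eulerM.
set P := \prod_(i <- r) G i in IH *; set S := \sum_(i <- r) th i in IH *.
have -> : euler j (G i) * P + G i * euler j P - G i * P * (th i + S) =
  P * (euler j (G i) - G i * th i) + G i * (euler j P - P * S) by ring.
by apply: highD; apply: highM.
Qed.

Definition truncate (T : nat) (g : 'X_{1..n} -> F) : {mpoly F[n]} :=
  \sum_(a : 'X_{1..n < T}) g a *: 'X_[a].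

Lemma mcoeff_truncate T g c : (mdeg c < T)%N -> (truncate T g)@_c = g c.
Proof.
move=> cT; rewrite /truncate linear_sum (bigD1 (BMultinom cT)) //= mcoeffZ mcoeffX eqxx mulr1.
rewrite big1 ?addr0 // => a ac; rewrite mcoeffZ mcoeffX; case: eqP => E; last by rewrite mulr0.
by case/eqP: ac; apply: val_inj.
Qed.
End TruncatedSeries.

(** * Root products and Freudenthal's recursion as differential identities *)

Section Assembly.
Variables (n' : nat) (F : numFieldType).
Local Notation n := n'.+3.
Local Notation I := 'I_n'.+3.
Implicit Types c : 'X_{1..n}.

Definition delta_mnm : 'X_{1..n} := [multinom 1%N | i < n].

Lemma arc_sum_arc (R : pzRingType) (w : I -> R) k i : arc_sum w k i = \sum_j (arc k i j)%:R * w j.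
Proof.
elim: k => [|k IH].
  by rewrite /arc_sum big_ord0 big1 // => j _; rewrite /arc big_ord0 mnm0E mul0r.
rewrite arc_sumS IH; under [RHS]eq_bigr => j _ do
  rewrite /arc big_ord_recr /= mnmDE mnm1E natrD mulrDl.
rewrite big_split /=; congr (_ + _).
rewrite (bigD1 (i + k%:R)) //= eqxx mul1r big1 ?addr0 // => j /negPf.
by rewrite eq_sym => ->; rewrite mul0r.
Qed.

Lemma arc_delta q i : arc (n * q)%N i = (delta_mnm *+ q)%MM.
Proof.
have n0 : n%:R = 0 :> I by apply/eqP; rewrite ord_natr_eq0.
apply/mnmP => j; rewrite mulmnE mnmE mul1n.
elim: q => [|q IH]; first by rewrite muln0 /arc big_ord0 mnm0E.
rewrite mulnS addnC; move: IH; rewrite /arc !mnm_sumE => IH.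
rewrite big_split_ord /= IH -[q.+1]addn1; congr addn.
rewrite (bigD1 (j - i)) // big1 ?addn0 => [|l lj].
  by rewrite mnm1E natrD natr_Zp natrM n0 mul0r add0r addrC subrK eqxx.
rewrite mnm1E natrD natr_Zp natrM n0 mul0r add0r addrC eq_sym -subr_eq.
by rewrite eq_sym (negPf lj).
Qed.

Lemma mdeg_delta q : mdeg (delta_mnm *+ q)%MM = (n * q)%N.
Proof. by rewrite -(arc_delta q 0) mdeg_arc. Qed.

Section Operators.
Variable lam : I -> nat.
Local Notation e := (@euler n F).

(* Euler-operator form of c |-> coroot_val and c |-> casimir_val. *)
Definition laplace (j : I) (p : {mpoly F[n]}) :=
  e j p *+ 2 - e (j + 1) p - e (j - 1) p.

Definition quad_op (p : {mpoly F[n]}) := \sum_j (e j (e j p) - e j (e (j + 1) p)).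

Definition casimir_op (p : {mpoly F[n]}) := \sum_j ((lam j)%:R + 1) * e j p - quad_op p.

Lemma mcoeff_casimir_op p c : (casimir_op p)@_c = casimir_val F lam c * p@_c.
Proof.
rewrite /casimir_op /quad_op mcoeffB !linear_sum /= /casimir_val /shell_quad mulrBl !mulr_suml.
congr (_ - _); apply: eq_bigr => j _.
  by rewrite -[1]/(1%:R) -natrD -mpolyC_nat mcoeffCM mcoeff_euler natrD mulrA.
by rewrite mcoeffB !mcoeff_euler; ring.
Qed.

Lemma mcoeff_laplace j p c : (laplace j p)@_c =
  ((c j)%:R *+ 2 - (c (j + 1))%:R - (c (j - 1))%:R) * p@_c.
Proof. by rewrite /laplace !mcoeffB mcoeffMn !mcoeff_euler; ring. Qed.

(** Product rule for a second-order operator. The cross term is the polarized quadratic form, and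
    [lam] is charged to [p] alone, so [q] meets the operator for weight 0. *)
Lemma casimir_opM p q : casimir_op (p * q) = casimir_op p * q +
  \sum_j ((lam j)%:R * p - laplace j p) * e j q
  + p * (\sum_j e j q - quad_op q).
Proof.
have Q : quad_op (p * q) = quad_op p * q + \sum_j laplace j p * e j q + p * quad_op q.
  rewrite /quad_op mulr_suml mulr_sumr.
  have -> : \sum_j laplace j p * e j q =
     \sum_j ((e j p *+ 2 - e (j + 1) p) * e j q - e j p * e (j + 1) q).
    under eq_bigr => j _ do rewrite /laplace mulrBl; rewrite [LHS]sumrB [RHS]sumrB.
    congr (_ - _); rewrite -[LHS](sum_shift _ 1); apply: eq_bigr => j _.
    by rewrite addrK.
  rewrite -!big_split; apply: eq_bigr => j _ /=; rewrite !eulerM !eulerD !eulerM.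
  ring.
rewrite /casimir_op Q.
have L : \sum_j ((lam j)%:R + 1) * e j (p * q) =
   (\sum_j ((lam j)%:R + 1) * e j p) * q + \sum_j (lam j)%:R * p * e j q
   + p * \sum_j e j q.
  rewrite mulr_suml mulr_sumr -!big_split; apply: eq_bigr => j _ /=.
  by rewrite eulerM; ring.
under [X in _ = _ + X + _]eq_bigr => j _ do rewrite mulrBl.
rewrite L sumrB; ring.
Qed.
End Operators.

Definition root_geom (T : nat) (p : 'I_T * I) := geom F T (arc p.1.+1 p.2).
(** One factor per arc: each real root occurs once, while q delta occurs n times, once for every
    starting node. *)
Definition pattern_series T := \prod_(p : 'I_T * I) @root_geom T p.
Definition fock_series T := \prod_(k < T) geom F T (delta_mnm *+ k.+1).

Definition root_theta T (p : 'I_T * I) := 'X_[arc p.1.+1 p.2] * root_geom p.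

Definition im_defect (k : nat) : F := (n %| k)%:R / n%:R.

(* Twice-weighted roots: imaginary ones get total multiplicity n - 1, as in affine sl_n. *)
Definition root_psi T (j : I) :=
  \sum_(p : 'I_T * I) (1 - im_defect p.1.+1)%:MP * (arc p.1.+1 p.2 j)%:R * root_theta p.

Lemma arc_gt0 k (i : I) : (0 < mdeg (arc k.+1 i))%N.
Proof. by rewrite mdeg_arc. Qed.

Lemma euler_pattern_series T j : high T (euler j (pattern_series T) -
  pattern_series T * \sum_(p : 'I_T * I) (arc p.1.+1 p.2 j)%:R * root_theta p).
Proof.
apply: euler_prod => p; rewrite /root_theta /root_geom.
set g := geom _ _ _; set x := 'X_[_].
have -> : g * ((arc p.1.+1 p.2 j)%:R * (x * g)) = (arc p.1.+1 p.2 j)%:R * x * g * g by ring.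
exact/euler_geom/arc_gt0.
Qed.

Lemma high_theta_delta T q : (T <= n * q)%N ->
  high T ('X_[delta_mnm *+ q] * geom F T (delta_mnm *+ q)).
Proof.
move=> Tq; rewrite mulrC; apply: highM => c cT; rewrite mcoeffX; case: eqP => // E.
by move: cT; rewrite -E mdeg_delta ltnNge Tq.
Qed.

(** The n arcs of length n q all equal q delta; weighted by 1 / n they give one copy, as in the Fock
    product. The two index ranges differ only in terms of degree at least T. *)
Lemma high_im_theta T j : high T
  (\sum_(k < T) (k.+1)%:R * ('X_[delta_mnm *+ k.+1] * geom F T (delta_mnm *+ k.+1))
   - \sum_(p : 'I_T * I) (im_defect p.1.+1)%:MP * (arc p.1.+1 p.2 j)%:R * root_theta p).
Proof.
pose G q := q%:R * ('X_[delta_mnm *+ q] * geom F T (delta_mnm *+ q)).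
have n0 : n%:R != 0 :> F by rewrite pnatr_eq0.
have -> : \sum_(p : 'I_T * I) (im_defect p.1.+1)%:MP * (arc p.1.+1 p.2 j)%:R * root_theta p =
    \sum_(q < T) if (n * q.+1 <= T)%N then G q.+1 else 0.
  transitivity (\sum_(k < T) \sum_(i : I)
      (im_defect k.+1)%:MP * (arc k.+1 i j)%:R * ('X_[arc k.+1 i] * geom F T (arc k.+1 i))).
    by rewrite pair_bigA.
  transitivity (\sum_(k < T) \sum_(q < T) if (k.+1 == n * q.+1)%N then G q.+1 else 0).
    apply: eq_bigr => k _; rewrite /im_defect; case: (boolP (n %| k.+1)%N) => nk; last first.
      rewrite !big1 // => [q _|i _].
        by case: eqP => // kE; rewrite kE dvdn_mulr in nk.
      by rewrite mul0r mpolyC0 !mul0r.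
    have [q kE] := dvdnP nk; case: q kE => [|q] kE; first by [].
    rewrite mulnC in kE.
    have qT : (q < T)%N.
      have := ltn_ord k; rewrite kE; apply: leq_trans; rewrite leq_pmull //.
    rewrite [RHS](bigD1 (Ordinal qT)) //= -kE eqxx [X in _ = _ + X]big1 ?addr0; last first.
      move=> q' q'q; case: eqP => // E; case/eqP: q'q; apply: val_inj => /=.
      by move: E; rewrite kE => /eqP; rewrite eqn_mul2l => /eqP [].
    under eq_bigr => i _ do rewrite kE arc_delta mulmnE mnmE mul1n.
    have en : (1 / n%:R)%:MP_[n] *+ n = 1 :> {mpoly F[n]}.
      by rewrite -mpolyCMn -[X in X%:MP_[_]]mulr_natr divfK // mpolyC1.
    by rewrite sumr_const card_ord /G -!mulrnAl en mul1r.
  rewrite exchange_big; apply: eq_bigr => q _ /=.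
  case: (leqP (n * q.+1) T) => qT; last first.
    rewrite big1 // => k _; case: eqP => // E; move: (ltn_ord k).
    by rewrite E leqNgt qT.
  have kT : ((n * q.+1).-1 < T)%N by move: qT; rewrite mulnS.
  rewrite (bigD1 (Ordinal kT)) //= eqxx big1 ?addr0 // => k kq.
  case: eqP => // E; case/eqP: kq; apply: val_inj; exact: (congr1 predn E).
rewrite -sumrB; apply: high_sum => q _; case: ifP => qT; first by rewrite subrr; exact: high0.
rewrite subr0; apply/highM/high_theta_delta/ltnW; by rewrite ltnNge qT.
Qed.

Lemma euler_fock_series T j : high T (euler j (fock_series T) - fock_series T *
  \sum_(p : 'I_T * I) (im_defect p.1.+1)%:MP * (arc p.1.+1 p.2 j)%:R * root_theta p).
Proof.
set S := \sum_(p : _) _.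
pose S' := \sum_(k < T) (k.+1)%:R * ('X_[delta_mnm *+ k.+1] * geom F T (delta_mnm *+ k.+1)).
have H : high T (S' - S) := @high_im_theta T j.
have H' : high T (euler j (fock_series T) - fock_series T * S').
  apply: euler_prod => k; set g := geom _ _ _; set x := 'X_[_].
  have -> : g * ((k.+1)%:R * (x * g)) = ((delta_mnm *+ k.+1)%MM j)%:R * x * g * g.
    by rewrite mulmnE mnmE mul1n; ring.
  by apply: euler_geom; rewrite mdeg_delta.
have -> : euler j (fock_series T) - fock_series T * S =
  (euler j (fock_series T) - fock_series T * S') + fock_series T * (S' - S) by ring.
exact/highD/highM.
Qed.

Lemma pattern_series_inv T : exists E, high T (E * pattern_series T - 1).
Proof.
rewrite /pattern_series; elim: (index_enum _) => [|p r [E HE]].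
  by exists 1; rewrite big_nil mulr1 subrr; exact: high0.
exists ((1 - 'X_[arc p.1.+1 p.2]) * E); rewrite big_cons.
have Hg := @high_geom n F T _ (arc_gt0 p.1 p.2).
set P := \prod_(i <- r) _ in HE *; set g := root_geom p; set x := 'X_[_] in Hg *.
have -> : (1 - x) * E * (g * P) - 1 = E * P * ((1 - x) * g - 1) + (E * P - 1) by ring.
exact/highD/HE/highM.
Qed.

(** N0 is the Fock series divided by the pattern series, so its logarithmic derivative is the
    difference of theirs; the polynomial [E] supplies the division modulo high terms. *)
Lemma euler_quotient T j (N0 : {mpoly F[n]}) :
  high T (N0 * pattern_series T - fock_series T) -> high T (euler j N0 + N0 * @root_psi T j).
Proof.
set D := pattern_series T; set Phi := fock_series T => HN.
have HD := @euler_pattern_series T j; have HPhi := @euler_fock_series T j.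
rewrite -/D in HD; rewrite -/Phi in HPhi.
have psiE : @root_psi T j = \sum_(p : 'I_T * I) (arc p.1.+1 p.2 j)%:R * root_theta p
   - \sum_(p : 'I_T * I) (im_defect p.1.+1)%:MP * (arc p.1.+1 p.2 j)%:R * root_theta p.
  by rewrite -sumrB; apply: eq_bigr => p _; rewrite mpolyCB mpolyC1; ring.
move: HD HPhi psiE; set S1 := \sum_(p : _) _; set S2 := \sum_(p : _) _ => HD HPhi ->.
have HeN := euler_high j HN; rewrite eulerD eulerN eulerM in HeN.
have [E HE] := pattern_series_inv T; rewrite -/D in HE.
have -> : euler j N0 + N0 * (S1 - S2) =
   E * ((euler j N0 * D + N0 * euler j D - euler j Phi) - N0 * (euler j D - D * S1)
     + (euler j Phi - Phi * S2) - S2 * (N0 * D - Phi))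
   - (euler j N0 + N0 * (S1 - S2)) * (E * D - 1) by ring.
by apply: highB; apply: highM => //; apply: highB; [apply: highD; [apply: highB|]|]=> //;
  apply: highM.
Qed.

Variable lam : I -> nat.
Variables (m : 'X_{1..n} -> nat) (t : nat -> I -> 'X_{1..n} -> F).
Hypothesis mult0 : m 0%MM = 1%N.
Hypothesis mult_reflect : forall i c c', (forall j, j != i -> c' j = c j) ->
  (c i + c' i = lam i + c (i + 1)%R + c (i - 1)%R)%N -> m c = m c'.
Hypothesis mult_out : forall i c, (lam i + c (i + 1)%R + c (i - 1)%R < c i)%N -> m c = 0%N.
Hypothesis trace_rec : forall k i c, t k i c = if (arc k.+1 i <= c)%MM then
    t k i (c - arc k.+1 i)%MM
    + kappa F lam k.+1 i (c - arc k.+1 i)%MM * (m (c - arc k.+1 i)%MM)%:R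
  else 0.
Hypothesis trace_sum : forall c T, (mdeg c <= T.+1)%N ->
  \sum_(k < T.+1) \sum_i t k i c = casimir_val F lam c * (m c)%:R.

Definition mult_poly T := truncate T (fun c => (m c)%:R : F).

(** Solving the trace recursion along the multiples of one root turns [tau p] into
    [root_theta p * kap p]; regrouping by the coordinate j collects the roots into [root_psi]. *)
Lemma casimir_mult_poly T : high T.+1 (casimir_op lam (mult_poly T.+1) -
  \sum_j ((lam j)%:R * mult_poly T.+1 - laplace j (mult_poly T.+1)) * @root_psi T.+1 j).
Proof.
set f := mult_poly T.+1.
pose W j := (lam j)%:R * f - laplace j f.
pose kap (p : 'I_T.+1 * I) := (1 - im_defect p.1.+1)%:MP * arc_sum W p.1.+1 p.2.
pose tau (p : 'I_T.+1 * I) := truncate T.+1 (t p.1 p.2).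
have fE c : (mdeg c < T.+1)%N -> f@_c = (m c)%:R by exact: mcoeff_truncate.
have WE j c : (mdeg c < T.+1)%N -> (W j)@_c = coroot_val F lam c j * (m c)%:R.
  by move=> cT; rewrite mcoeffB -mpolyC_nat mcoeffCM mcoeff_laplace fE // -mulrBl.
have Hkap p : high T.+1 (tau p - 'X_[arc p.1.+1 p.2] * (tau p + kap p)).
  move=> c cT; rewrite mcoeffB mulrC mcoeffMX_le mcoeff_truncate // trace_rec.
  case: ifP => _; last by rewrite subrr.
  set c' := (c - _)%MM; have c'T : (mdeg c' < T.+1)%N := leq_ltn_trans (mdeg_sub_le _ _) cT.
  rewrite mcoeffD mcoeff_truncate // mcoeffCM /arc_sum linear_sum /=.
  under [X in _ - (_ + _ * X)]eq_bigr => l _ do rewrite WE //.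
  by rewrite -mulr_suml mulrA subrr.
have Htau p : high T.+1 (tau p - root_theta p * kap p).
  have := @high_geom n F T.+1 _ (arc_gt0 p.1 p.2).
  rewrite /root_theta /root_geom; move: (Hkap p); set g := geom _ _ _; set x := 'X_[_] => H1 H2.
  have -> : tau p - x * g * kap p = g * (tau p - x * (tau p + kap p))
     - tau p * ((1 - x) * g - 1) by ring.
  by apply: highB; apply: highM.
have sumk : \sum_(p : 'I_T.+1 * I) root_theta p * kap p = \sum_j W j * @root_psi T.+1 j.
  rewrite /root_psi; under [RHS]eq_bigr => j _ do rewrite mulr_sumr.
  rewrite exchange_big; apply: eq_bigr => p _ /=.
  rewrite /kap arc_sum_arc mulrCA mulr_sumr mulr_sumr; apply: eq_bigr => j _; ring.
have Hcas : high T.+1 (casimir_op lam f - \sum_(p : 'I_T.+1 * I) tau p).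
  move=> c cT; rewrite mcoeffB mcoeff_casimir_op fE // linear_sum /=.
  under eq_bigr => p _ do rewrite mcoeff_truncate //.
  by rewrite -(@trace_sum c T) ?(ltnW cT) // (pair_bigA _ (fun (k : 'I_T.+1) i => t k i c)) subrr.
have -> : casimir_op lam f - \sum_j W j * @root_psi T.+1 j =
   (casimir_op lam f - \sum_(p : 'I_T.+1 * I) tau p)
   + (\sum_(p : 'I_T.+1 * I) tau p - \sum_(p : 'I_T.+1 * I) root_theta p * kap p).
  by rewrite sumk addrA subrK.
by apply: highD => //; rewrite -sumrB; apply: high_sum => p _; exact: Htau.
Qed.

(** The expansion splits into N0 times the defect of [casimir_mult_poly], multiples of the defects
    of [euler_quotient], and [f] times the Casimir of N0, all of them high. *)
Lemma casimir_product T (N0 : {mpoly F[n]}) :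
  high T.+1 (N0 * pattern_series T.+1 - fock_series T.+1) ->
  high T.+1 (casimir_op (fun=> 0%N) N0) -> high T.+1 (casimir_op lam (mult_poly T.+1 * N0)).
Proof.
set f := mult_poly T.+1 => HN HN0; rewrite casimir_opM.
have -> : \sum_j euler j N0 - quad_op N0 = casimir_op (fun=> 0%N) N0.
  by rewrite /casimir_op; congr (_ - _); apply: eq_bigr => j _; rewrite add0r mul1r.
have Hf := @casimir_mult_poly T; rewrite -/f in Hf.
set S := \sum_j _ in Hf.
have -> : \sum_j ((lam j)%:R * f - laplace j f) * euler j N0 =
   \sum_j ((lam j)%:R * f - laplace j f) * (euler j N0 + N0 * @root_psi T.+1 j) - S * N0.
  by rewrite /S mulr_suml -sumrB; apply: eq_bigr => j _; ring.
set S' := \sum_j _.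
have -> : casimir_op lam f * N0 + (S' - S * N0) + f * casimir_op (fun=> 0%N) N0 =
  N0 * (casimir_op lam f - S) + S' + f * casimir_op (fun=> 0%N) N0 by ring.
apply: highD; last exact: highM.
apply: highD; first exact: highM.
by apply: high_sum => j _; apply/highM/euler_quotient.
Qed.

(** * Comparison of patterns with multiplicities by lowest terms *)

Variables (P D : 'X_{1..n} -> nat) (phi : nat -> nat) (N N0 : 'X_{1..n} -> F).

Definition fock_mult (c : 'X_{1..n}) : nat := if [forall i, c i == c 0%R] then phi (c 0%R) else 0%N.

Hypothesis P0 : P 0%MM = 1%N.
Hypothesis phi0 : phi 0%N = 1%N.
Hypothesis P_reflect : forall i c c', (forall j, j != i -> c' j = c j) ->
  (c i + c' i = lam i + c (i + 1)%R + c (i - 1)%R)%N -> P c = P c'.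
Hypothesis P_out : forall i c, (lam i + c (i + 1)%R + c (i - 1)%R < c i)%N -> P c = 0%N.
Hypothesis D_series : forall T c, (mdeg c < T)%N -> (pattern_series T)@_c = (D c)%:R.
Hypothesis phi_series : forall T c, (mdeg c < T)%N -> (fock_series T)@_c = (fock_mult c)%:R.
Hypothesis P_conv : forall c, (P c)%:R =
  \sum_(a : 'X_{1..n < (mdeg c).+1} | (a <= c)%MM) N a * (D (c - a)%MM)%:R.
Hypothesis N_shell : forall a, N a != 0 -> casimir_val F lam a = 0.
Hypothesis fock_conv : forall c, (fock_mult c)%:R =
  \sum_(a : 'X_{1..n < (mdeg c).+1} | (a <= c)%MM) N0 a * (D (c - a)%MM)%:R.
Hypothesis N0_shell : forall a, N0 a != 0 -> casimir_val F (fun=> 0%N) a = 0.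

Definition mult_fock (c : 'X_{1..n}) : nat :=
  \sum_(q < (c 0%R).+1 | (delta_mnm *+ q <= c)%MM) m (c - delta_mnm *+ q)%MM * phi q.

Lemma delta_mnmE q i : (delta_mnm *+ q)%MM i = q.
Proof. by rewrite mulmnE mnmE mul1n. Qed.

Definition fock_poly T := \sum_(q < T) (phi q)%:R *: 'X_[delta_mnm *+ q] : {mpoly F[n]}.

Lemma delta_mnm_eq q c : ((delta_mnm *+ q)%MM == c) = [forall i, c i == c 0%R] && (q == c 0%R).
Proof.
apply/eqP/andP => [<-|[/forallP cc /eqP ->]].
  by split; [apply/forallP => i|]; rewrite !delta_mnmE.
by apply/mnmP => i; rewrite delta_mnmE (eqP (cc i)).
Qed.

Lemma mnm_le_mdeg c i : (c i <= mdeg c)%N.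
Proof. by rewrite mdegE (bigD1 i) //= leq_addr. Qed.

Lemma mcoeff_fock_poly T c : (mdeg c < T)%N -> (fock_poly T)@_c = (fock_mult c)%:R.
Proof.
move=> cT; rewrite /fock_poly linear_sum /fock_mult /=.
under eq_bigr => q _ do rewrite mcoeffZ mcoeffX delta_mnm_eq.
case: ifP => _; last by rewrite big1 // => q _; rewrite mulr0.
have c0T : (c 0%R < T)%N by apply: leq_ltn_trans cT; exact: mnm_le_mdeg.
rewrite (bigD1 (Ordinal c0T)) //= eqxx mulr1 big1 ?addr0 // => q qc.
by case: eqP => E; rewrite ?mulr0 //; case/eqP: qc; apply: val_inj.
Qed.

Lemma mcoeff_mult_fock T c : (mdeg c < T)%N ->
  (mult_poly T * fock_poly T)@_c = (mult_fock c)%:R.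
Proof.
move=> cT; rewrite /fock_poly mulr_sumr linear_sum /mult_fock natr_sum /=.
have c0T : (c 0%R < T)%N by apply: leq_ltn_trans cT; exact: mnm_le_mdeg.
rewrite [RHS](big_ord_widen_cond _ (fun q => delta_mnm *+ q <= c)%MM
  (fun q => (m (c - delta_mnm *+ q)%MM * phi q)%:R) c0T).
rewrite [RHS]big_mkcond; apply: eq_bigr => q _.
rewrite -scalerAr mcoeffZ mcoeffMX_le.
case: ifP => qc; last by rewrite mulr0.
have -> : (q < (c 0%R).+1)%N by rewrite ltnS -(delta_mnmE q (0 : I)); move/mnm_lepP: qc; apply.
by rewrite mcoeff_truncate ?natrM 1?mulrC // (leq_ltn_trans (mdeg_sub_le _ _)).
Qed.

(** Reflections fix delta, so the sums agree term by term; a term with q delta below [c'] but not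
    below [c] vanishes by [mult_out]. *)
Lemma mult_fock_reflect_le i c c' : (forall j, j != i -> c' j = c j) ->
  (c i + c' i = lam i + c (i + 1)%R + c (i - 1)%R)%N -> (c i <= c' i)%N ->
  mult_fock c = mult_fock c'.
Proof.
move=> cj sum le.
have i1 : i + 1 != i by rewrite -[X in _ == X]addr0 (inj_eq (addrI _)) oner_eq0.
have i2 : i - 1 != i by rewrite -[X in _ == X]addr0 (inj_eq (addrI _)) oppr_eq0 oner_eq0.
have fE (a : 'X_{1..n}) B : (a 0%R < B)%N -> mult_fock a =
    \sum_(q < B | (delta_mnm *+ q <= a)%MM) m (a - delta_mnm *+ q)%MM * phi q.
  move=> aB; rewrite /mult_fock (big_ord_widen_cond _ (fun q => delta_mnm *+ q <= a)%MM
    (fun q => m (a - delta_mnm *+ q)%MM * phi q)%N aB).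
  apply: eq_bigl => q; apply: andb_idr => /mnm_lepP /(_ 0); by rewrite delta_mnmE ltnS.
set B := (maxn (c 0%R) (c' 0%R)).+1.
rewrite (fE c B) ?(fE c' B) ?ltnS ?leq_maxl ?leq_maxr //.
rewrite big_mkcond [RHS]big_mkcond; apply: eq_bigr => q _.
case: ifP => qc.
  have qc' : (delta_mnm *+ q <= c')%MM.
    apply/mnm_lepP => j; rewrite delta_mnmE.
    have := mnm_lepP qc j; rewrite delta_mnmE; case: (eqVneq j i) => [->|ji]; last by rewrite cj.
    by move=> qi; exact: leq_trans qi le.
  rewrite qc'; congr (_ * _)%N; apply: (mult_reflect (i := i)) => [j ji|].
    by rewrite !mnmBE cj.
  rewrite !mnmBE !delta_mnmE; move: (mnm_lepP qc i) (mnm_lepP qc (i + 1)) (mnm_lepP qc (i - 1)).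
  by rewrite !delta_mnmE; move: sum le; lia.
case: ifP => // qc'; rewrite (mult_out (i := i)) //.
have ciq : (c i < q)%N.
  rewrite ltnNge; apply: contraFN qc => qi; apply/mnm_lepP => j; rewrite delta_mnmE.
  by case: (eqVneq j i) => [->//|ji]; rewrite -cj // -{1}(delta_mnmE q j); apply/mnm_lepP.
move: (mnm_lepP qc' i) (mnm_lepP qc' (i + 1)) (mnm_lepP qc' (i - 1)).
rewrite !mnmBE !delta_mnmE (cj _ i1) (cj _ i2); move: sum ciq; lia.
Qed.

Lemma mult_fock_reflect i c c' : (forall j, j != i -> c' j = c j) ->
  (c i + c' i = lam i + c (i + 1)%R + c (i - 1)%R)%N -> mult_fock c = mult_fock c'.
Proof.
move=> cj sum; case: (leqP (c i) (c' i)) => le; first exact: mult_fock_reflect_le sum le.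
have i1 : i + 1 != i by rewrite -[X in _ == X]addr0 (inj_eq (addrI _)) oner_eq0.
have i2 : i - 1 != i by rewrite -[X in _ == X]addr0 (inj_eq (addrI _)) oppr_eq0 oner_eq0.
symmetry; apply: (mult_fock_reflect_le (i := i)) => [j ji||]; first by rewrite cj.
  by rewrite (cj _ i1) (cj _ i2) addnC.
exact: ltnW.
Qed.

Lemma mult_fock_out i c : (lam i + c (i + 1)%R + c (i - 1)%R < c i)%N -> mult_fock c = 0%N.
Proof.
move=> out; rewrite /mult_fock big1 // => q qc; rewrite (mult_out (i := i)) //.
move: (mnm_lepP qc i) (mnm_lepP qc (i + 1)) (mnm_lepP qc (i - 1)).
by rewrite !mnmBE !delta_mnmE; move: out; lia.
Qed.

(** Twice the value is (2 (Lam + rho) - beta, beta). When Lam - beta is dominant, every c_j enters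
    with a factor at least 2, so only beta = 0 gives zero. *)
Lemma casimir_val_pos c : (forall i, ((c i).*2 <= lam i + c (i + 1)%R + c (i - 1)%R)%N) ->
  casimir_val F lam c = 0 -> c = 0%MM.
Proof.
move=> dom s0.
have s2 : casimir_val F lam c *+ 2 =
    \sum_j (((lam j).*2 + 2 + c (j + 1)%R + c (j - 1)%R - (c j).*2) * c j)%N%:R.
  have shE : \sum_j (c j)%:R * (c (j + 1))%:R = \sum_j (c j)%:R * (c (j - 1))%:R :> F.
    rewrite -[RHS](sum_shift _ 1); apply: eq_bigr => j _; by rewrite addrK mulrC.
  have -> : casimir_val F lam c *+ 2 = \sum_j ((lam j)%:R + 1) * (c j)%:R *+ 2
     - \sum_j (c j)%:R * (c j)%:R *+ 2 + \sum_j (c j)%:R * (c (j + 1))%:R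
     + \sum_j (c j)%:R * (c (j - 1))%:R.
    rewrite -shE /casimir_val /shell_quad sumrB !sumrMnl; ring.
  rewrite -sumrB -!big_split; apply: eq_bigr => j _ /=.
  rewrite natrM natrB; last by have := dom j; lia.
  by rewrite !natrD -!muln2 !natrM; ring.
apply/mnmP => j; rewrite mnm0E.
have : \sum_j (((lam j).*2 + 2 + c (j + 1)%R + c (j - 1)%R - (c j).*2) * c j)%N%:R = 0 :> F.
  by rewrite -s2 s0 mul0rn.
rewrite -natr_sum => /eqP; rewrite pnatr_eq0 sum_nat_eq0 => /forallP /(_ j) /=.
by have := dom j; rewrite muln_eq0 => d /orP[/eqP|/eqP] //; lia.
Qed.

Theorem multiplicities_agree c : P c = mult_fock c.
Proof.
move: {2}(mdeg c).+1 (ltnSn (mdeg c)) => T; elim: T c => // T IH c; rewrite ltnS leq_eqVlt.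
case/orP=> [/eqP cT|]; last exact: IH.
pose Nt := truncate T.+1 N; pose N0t := truncate T.+1 N0.
pose f := mult_poly T.+1; pose Pt := truncate T.+1 (fun a => (P a)%:R : F).
pose Ds := pattern_series T.+1; pose Ph := fock_series T.+1.
have conv (G : 'X_{1..n} -> F) a : (mdeg a < T.+1)%N -> (truncate T.+1 G * Ds)@_a =
    \sum_(b : 'X_{1..n < (mdeg a).+1} | (b <= a)%MM) G b * (D (a - b)%MM)%:R.
  move=> aT; rewrite mcoeffM_le; apply: eq_bigr => b ba; rewrite mcoeff_truncate.
    by rewrite D_series // (leq_ltn_trans (mdeg_sub_le _ _)).
  by apply: leq_ltn_trans aT; apply: lem_mdeg.
have H1 : high T.+1 (N0t * Ds - Ph).
  by move=> a aT; rewrite mcoeffB conv // -fock_conv phi_series // subrr.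
have H2 : high T.+1 (Nt * Ds - Pt).
  by move=> a aT; rewrite mcoeffB conv // -P_conv mcoeff_truncate // subrr.
have H3 : high T.+1 (Ph - fock_poly T.+1).
  by move=> a aT; rewrite mcoeffB mcoeff_fock_poly // phi_series // subrr.
have H4 : high T.+1 (casimir_op (fun=> 0%N) N0t).
  move=> a aT; rewrite mcoeff_casimir_op mcoeff_truncate //.
  by have [->|/N0_shell ->] := eqVneq (N0 a) 0; rewrite ?mulr0 ?mul0r.
have H5 := casimir_product H1 H4.
pose u := f * N0t - Nt.
have Hu a : (mdeg a < T.+1)%N -> casimir_val F lam a * u@_a = 0.
  move=> aT; rewrite /u mcoeffB mulrBr -mcoeff_casimir_op H5 // sub0r mcoeff_truncate //.
  by have [->|/N_shell ->] := eqVneq (N a) 0; rewrite ?mulr0 ?mul0r oppr0.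
have [E HE] := pattern_series_inv T.+1; rewrite -/Ds in HE.
pose h := f * fock_poly T.+1 - Pt.
have hE a : (mdeg a < T.+1)%N -> h@_a = (mult_fock a)%:R - (P a)%:R.
  by move=> aT; rewrite mcoeffB mcoeff_mult_fock // mcoeff_truncate.
have h0 a : (mdeg a < T)%N -> h@_a = 0 by move=> aT; rewrite hE ?(IH a) ?subrr // ltnW.
have Huh : high T.+1 (u * Ds - h).
  have -> : u * Ds - h = f * (N0t * Ds - Ph) + f * (Ph - fock_poly T.+1) - (Nt * Ds - Pt).
    by rewrite /u /h; ring.
  by apply: highB => //; apply: highD; apply: highM.
(* By induction [h] vanishes below degree T, and so does [u], which is [h] divided by the pattern
   series. *)
have u0 a : (mdeg a < T)%N -> u@_a = 0.
  move=> aT; have uE : high T.+1 (u - E * h).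
    have -> : u - E * h = E * (u * Ds - h) - u * (E * Ds - 1) by ring.
    by apply: highB; apply: highM.
  have /eqP := uE a (ltnW aT); rewrite mcoeffB subr_eq0 => /eqP ->.
  rewrite mcoeffM_le big1 // => b ba; rewrite h0 ?mulr0 //.
  exact: leq_ltn_trans (mdeg_sub_le _ _) aT.
have cT1 : (mdeg c < T.+1)%N by rewrite cT.
apply/eqP; rewrite -(eqr_nat F) eq_sym -subr_eq0 -hE //; apply/negPn/negP => hc.
have uc : u@_c != 0.
  apply: contra hc => /eqP uc; have /eqP := Huh c cT1.
  rewrite mcoeffB subr_eq0 => /eqP <-; rewrite mcoeffM_le big1 // => b'; move: (bmnm b') => b bc.
  have := lem_mdeg bc; rewrite cT leq_eqVlt => /orP[/eqP bT|bT]; last by rewrite u0 ?mul0r.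
  suff -> : b = c by rewrite uc mul0r.
  have := submK bc; move/(congr1 (@mdeg _)); rewrite mdegD bT cT -[X in _ = X]add0n => /addIn /eqP.
  by rewrite mdeg_eq0 => /eqP cb; rewrite -[RHS](submK bc) cb add0m.
have sc0 : casimir_val F lam c = 0.
  by have /eqP := Hu c cT1; rewrite mulf_eq0 (negPf uc) orbF => /eqP.
(* Where [c] is not dominant, a reflection lowers its degree, into the range where [h] is zero by
   induction. *)
have dom i : ((c i).*2 <= lam i + c (i + 1)%R + c (i - 1)%R)%N.
  rewrite leqNgt; apply/negP => lt.
  case: (ltnP (lam i + c (i + 1)%R + c (i - 1)%R) (c i)) => out.
    by move: hc; rewrite hE // (mult_fock_out out) (P_out out) subrr eqxx.
  pose c' : 'X_{1..n} := [multinom if j == i then (lam i + c (i + 1)%R + c (i - 1)%R - c i)%N else c j | j < n].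
  have c'j j : j != i -> c' j = c j by move=> /negPf ji; rewrite mnmE ji.
  have c'i : (c i + c' i = lam i + c (i + 1)%R + c (i - 1)%R)%N by rewrite mnmE eqxx subnKC.
  have c'T : (mdeg c' < T)%N.
    rewrite -cT !mdegE (bigD1 i) //= [X in (_ < X)%N](bigD1 i) //=.
    rewrite (eq_bigr (fun j => c j)) ?ltn_add2r => [|j /c'j //].
    by move: c'i lt; lia.
  move: hc; rewrite hE // (P_reflect c'j c'i) (mult_fock_reflect c'j c'i) -hE ?h0 ?eqxx //.
  exact: ltnW.
have c0 := casimir_val_pos dom sc0; move: hc; rewrite hE // c0 P0 /mult_fock mnm0E big_mkcond.
rewrite big_ord1 /= mulm0n subm0 mult0 phi0 lepm_refl subrr eqxx //.
Qed.
End Assembly.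

(** * Affine Gelfand-Tsetlin patterns *)

Section PatternCoding.
Variable n' : nat.
Local Notation n := n'.+3.
Local Notation I := 'I_n'.+3.
Implicit Types (d : pattern) (c : 'X_{1..n}).

(** The window may overshoot r on the right, since entries above the diagonal vanish. *)
Lemma row_sum_window d (r lo : int) (L : nat) : (forall j, j < lo -> d r j = 0%N) ->
  (forall j, r < j -> d r j = 0%N) -> r < lo + L%:Z ->
  row_sum d r = (\sum_(q < L) d r (lo + q%:Z)%R)%N.
Proof.
move=> dlo dhi rL.
have inj : injective (fun q : nat => lo + q%:Z) by move=> x y /addrI [].
rewrite /row_sum (@fsbigE _ _ _ _ _ [seq j <- [seq lo + q%:Z | q <- iota 0 L] | j <= r]).
- rewrite -big_filter -filter_predI big_filter big_map /= -{1}[L]subn0 -/(index_iota 0 L) big_mkord.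
  rewrite big_mkcond; apply: eq_bigr => q _; case: ifP => // /negbT.
  rewrite negb_and => /orP[|]; last by rewrite -ltNge => /dhi.
  by move/asboolPn => /negP; rewrite -ltNge => /dhi.
- by rewrite filter_uniq // map_inj_uniq // iota_uniq.
- by move=> j /=; rewrite mem_filter => /andP[].
- move=> j /= jr; rewrite mem_filter jr /= => jL; apply: dlo; rewrite ltNge.
  apply: contra jL => loj; apply/mapP; exists (absz (j - lo)).
    by rewrite mem_iota add0n; lia.
  by rewrite gez0_abs ?subr_ge0 // addrCA subrr addr0.
Qed.

Definition res (b : int) : I := b%:~R.

Lemma ord_nn : n%:R = 0 :> I.
Proof. by apply/eqP; rewrite ord_natr_eq0. Qed.

Lemma resD a b : res (a + b) = res a + res b.
Proof. exact: intrD. Qed.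
Lemma resB a b : res (a - b) = res a - res b.
Proof. exact: intrB. Qed.
Lemma res1 : res 1 = 1.
Proof. by []. Qed.
Lemma res_nat (k : nat) : res k%:Z = k%:R.
Proof. by []. Qed.
Lemma res_ord (i : I) : res i%:Z = i.
Proof. by rewrite res_nat natr_Zp. Qed.
Lemma resMn b : res (n%:Z * b) = 0.
Proof. by rewrite /res intrM -[n%:Z%:~R]/(n%:R) ord_nn mul0r. Qed.
Lemma resDn b : res (b + n%:Z) = res b.
Proof. by rewrite resD -[n%:Z]mulr1 resMn addr0. Qed.

Lemma res_val b : (res b)%:Z = (b %% n%:Z)%Z.
Proof.
rewrite {1}(divz_eq b n%:Z) resD mulrC resMn add0r.
have b0 : (0 <= b %% n%:Z)%Z by rewrite modz_ge0.
rewrite -{1}(gez0_abs b0) res_nat /= Zp_nat /= modn_small ?gez0_abs //.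
by rewrite -ltz_nat gez0_abs // ltz_pmod.
Qed.

Lemma res_eq a b : res a = res b -> exists m, a = b + n%:Z * m.
Proof.
move=> ab; exists ((a %/ n%:Z)%Z - (b %/ n%:Z)%Z).
have := res_val a; rewrite ab res_val => E.
rewrite {1}(divz_eq a n%:Z) {1}(divz_eq b n%:Z) E; ring.
Qed.

Definition periodic d := forall i j, d (i + n%:Z) (j + n%:Z) = d i j.

Lemma periodicM d m i j : periodic d -> d (i + n%:Z * m) (j + n%:Z * m) = d i j.
Proof.
move=> dp; have pos (k : nat) a b : d (a + n%:Z * k%:Z) (b + n%:Z * k%:Z) = d a b.
  elim: k a b => [|k IH] a b; first by rewrite mulr0 !addr0.
  by rewrite (intS k) mulrDr mulr1 !addrA IH dp.
case: m => k; first exact: pos.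
by rewrite NegzE mulrN -[LHS](pos k.+1) !subrK.
Qed.

Lemma periodic_res d a b a' b' : periodic d -> a - b = a' - b' -> res b = res b' ->
  d a b = d a' b'.
Proof.
move=> dp ab /res_eq [m bE]; rewrite bE -(periodicM m a' b' dp); congr d.
by move: ab; rewrite bE; lia.
Qed.

Lemma row_sum_periodic d r s : affGT n d -> res r = res s -> row_sum d r = row_sum d s.
Proof.
move=> [d0 _ dp [N dN]] rs.
have win x : row_sum d x = (\sum_(q < `|N|.+1) d x (x - `|N|%:Z + q%:Z)%R)%N.
  by apply: row_sum_window => [j jx|j xj|]; [apply: dN; lia|apply: d0|lia].
rewrite !win; apply: eq_bigr => q _; apply: periodic_res => //; first by ring.
by rewrite !resD rs.
Qed.

Lemma row_sum_rev d (r : int) T : (forall j, j <= r - T%:Z -> d r j = 0%N) ->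
  (forall j, r < j -> d r j = 0%N) -> row_sum d r = (\sum_(q < T) d r (r - q%:Z)%R)%N.
Proof.
move=> dlo dhi; rewrite (row_sum_window (lo := r - T%:Z + 1) (L := T)) //; last by lia.
  rewrite (reindex_inj rev_ord_inj) /=; apply: eq_bigr => q _; congr d.
  by have := ltn_ord q; lia.
by move=> j jr; apply: dlo; lia.
Qed.

(** By periodicity the n columns, read downwards from the diagonal, determine a pattern; each of
    them is nonincreasing. *)
Definition column d (k : nat) (i : I) : nat := d (i%:Z + k%:Z) i%:Z.

Lemma columnE d a b : periodic d -> b <= a -> d a b = column d `|a - b|%N (res b).
Proof.
move=> dp ba; apply: periodic_res => //; last by rewrite res_ord.
by rewrite addrAC subrr add0r gez0_abs ?subr_ge0.
Qed.

Lemma column_le d k l i : affGT n d -> (k <= l)%N -> (column d l i <= column d k i)%N.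
Proof. by move=> [_ dm _ _] kl; apply: dm; lia. Qed.

Lemma row_sum_columns d : affGT n d -> exists T0, forall T, (T0 <= T)%N -> forall r,
  row_sum d r = (\sum_(q < T) column d q (res r - q%:R)%R)%N.
Proof.
move=> [d0 _ dp [N dN]]; exists `|N|%N => T NT r.
rewrite (@row_sum_rev _ _ T) => [|j jr|j jr]; [|by apply: dN; lia|exact: d0].
apply: eq_bigr => q _; rewrite columnE //; last by lia.
by congr column; [lia|rewrite resB res_nat].
Qed.

Definition row_mnm d : 'X_{1..n} := [multinom row_sum d (nat_of_ord i)%:Z | i < n].

(** Each column entry lies in exactly one row modulo n, so the total over one period of rows bounds
    every column. *)
Lemma column_sum_le d i K : affGT n d -> (\sum_(q < K) column d q i <= mdeg (row_mnm d))%N.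
Proof.
move=> dA; have [T0 HT] := row_sum_columns dA; set T := maxn T0 K.
have KT : (K <= T)%N := leq_maxr _ _.
rewrite mdegE; under eq_bigr => r _ do rewrite mnmE (HT T (leq_maxl _ _)) res_ord.
rewrite exchange_big /= (big_ord_widen_cond _ predT (fun q => column d q i) KT) big_mkcond.
apply: leq_sum => q _; case: ifP => // _.
rewrite (sum_shift (fun r => column d q r) (- q%:R)) (bigD1 i) //= leq_addr //.
Qed.

Lemma column_eq0 d i k : affGT n d -> (mdeg (row_mnm d) <= k)%N -> column d k i = 0%N.
Proof.
move=> dA dk; apply/eqP; rewrite -leqn0 leqNgt; apply/negP => pos.
have := column_sum_le i k.+1 dA.
have : (\sum_(q < k.+1) 1 <= \sum_(q < k.+1) column d q i)%N.
  apply: leq_sum => q _; apply: leq_trans pos _; apply: column_le => //.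
  by rewrite -ltnS.
by rewrite sum1_card card_ord => /leq_trans /[apply]; rewrite ltnNge dk.
Qed.

Lemma column_leq d i k : affGT n d -> (column d k i <= mdeg (row_mnm d))%N.
Proof.
move=> dA; apply: leq_trans (column_sum_le i 1 dA).
by rewrite big_ord1; apply: column_le.
Qed.

Lemma telescope_nat (x : nat -> nat) k0 T : (forall k, x k.+1 <= x k)%N -> (k0 <= T)%N ->
  (\sum_(k < T | (k0 <= k)%N) (x k - x k.+1) = x k0 - x T)%N.
Proof.
move=> xd; elim: T => [|T IH]; first by rewrite leqn0 => /eqP ->; rewrite big_ord0 subnn.
rewrite leq_eqVlt => /orP[/eqP ->|k0T].
  by rewrite subnn big_pred0 // => k; rewrite leqNgt ltn_ord.
rewrite big_mkcond big_ord_recr -big_mkcond /= -ltnS k0T IH //.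
have mono : (x T <= x k0)%N.
  rewrite -(subnK (k0T : (k0 <= T)%N)); elim: (T - k0)%N => // p IHp.
  by rewrite addSn; apply: leq_trans (xd _) IHp.
by have := xd T; move: mono; lia.
Qed.

(** * Patterns as Kostant partitions *)

Definition decode (T : nat) (g : 'I_T * I -> nat) : pattern :=
  fun a b => if a < b then 0%N else (\sum_(k < T | (`|(a - b)%R| <= k)%N) g (k, res b))%N.

Lemma column_decode T (g : 'I_T * I -> nat) k i :
  column (decode g) k i = (\sum_(l < T | (k <= l)%N) g (l, i))%N.
Proof.
rewrite /column /decode ltNge lerDl /= addrAC subrr add0r res_ord.
by apply: eq_bigl.
Qed.

Lemma decode_affGT T (g : 'I_T * I -> nat) : affGT n (decode g).
Proof.
split=> [i j ij|i k j jk ki|i j|].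
- by rewrite /decode ij.
- rewrite /decode !ltNge jk (le_trans jk ki) /= [X in (_ <= X)%N](bigID (fun l : 'I_T => (`|(i - j)%R| <= l)%N)) /=.
  apply: leq_trans (leq_addr _ _); rewrite leq_eqVlt; apply/orP; left; apply/eqP.
  by apply: eq_bigl => l; lia.
- rewrite /decode ltrD2r resDn; congr (if _ then _ else _); apply: eq_bigl => l.
  by congr (_ <= _)%N; lia.
- exists T%:Z => i j ij; rewrite /decode; case: ifP => // _; apply: big_pred0 => l.
  by have := ltn_ord l; lia.
Qed.

Lemma row_sum_decode T (g : 'I_T * I -> nat) r :
  row_sum (decode g) r = (\sum_(p : 'I_T * I) arc p.1.+1 p.2 (res r) * g p)%N.
Proof.
have [T0 HT] := row_sum_columns (decode_affGT g).
set Q := maxn T0 T; rewrite (HT Q (leq_maxl _ _)).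
have TQ : (T <= Q)%N := leq_maxr _ _.
transitivity (\sum_(k < T) \sum_i arc k.+1 i (res r) * g (k, i))%N; last by rewrite pair_bigA; apply: eq_bigr => -[].
under eq_bigr => q _ do rewrite column_decode big_mkcond.
rewrite exchange_big; apply: eq_bigr => k _; rewrite -big_mkcond /=.
have kQ : (k.+1 <= Q)%N by apply: leq_trans TQ.
rewrite -(big_ord_widen Q (fun q => g (k, res r - q%:R)) kQ).
under [RHS]eq_bigr => i _ do rewrite /arc mnm_sumE big_distrl /=.
rewrite exchange_big; apply: eq_bigr => q _ /=.
rewrite (bigD1 (res r - q%:R)) //= mnm1E subrK eqxx mul1n big1 ?addn0 // => i ir.
by rewrite mnm1E -subr_eq0 -addrA -[q%:R - _]opprB subr_eq0 (negPf ir).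
Qed.

Lemma row_mnm_decode T (g : 'I_T * I -> nat) :
  row_mnm (decode g) = (\big[mnm_add/0%MM]_(p : 'I_T * I) (arc p.1.+1 p.2 *+ g p))%MM.
Proof.
apply/mnmP => i; rewrite mnmE row_sum_decode res_ord mnm_sumE.
by apply: eq_bigr => p _; rewrite mulmnE.
Qed.

Lemma decodeK T d : affGT n d -> (mdeg (row_mnm d) <= T)%N ->
  decode (fun p : 'I_T * I => column d p.1 p.2 - column d p.1.+1 p.2)%N = d.
Proof.
move=> dA dT; have [d0 _ dp _] := dA; apply/funext => a; apply/funext => b.
rewrite /decode; case: ltP => [/d0 -> //|ba]; rewrite (columnE dp ba).
have xT : column d T (res b) = 0%N by apply: column_eq0.
case: (leqP `|a - b|%N T) => ab.
  rewrite (telescope_nat (x := fun k => column d k (res b))) ?xT ?subn0 //.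
  by move=> k; apply: column_le.
rewrite big_pred0 => [|l]; first by rewrite column_eq0 // (leq_trans dT (ltnW ab)).
by have := ltn_ord l; lia.
Qed.

(** [g (k, i)] is the drop of column i between depths k and k + 1. One unit of it adds 1 to the rows
    i, ..., i + k, hence the root of an arc of length k + 1. *)
Lemma encodeK T (g : 'I_T * I -> nat) (p : 'I_T * I) :
  (column (decode g) p.1 p.2 - column (decode g) p.1.+1 p.2)%N = g p.
Proof.
case: p => k i; rewrite !column_decode /= (bigD1 k) //= [X in (_ + X - _)%N](eq_bigl (fun l : 'I_T => (k < l)%N)).
  by rewrite addnK.
by move=> l; rewrite [in RHS]ltn_neqAle -val_eqE /= eq_sym andbC.
Qed.

Definition code_mnm T (g : 'I_T * I -> nat) : 'X_{1..n} :=
  (\big[mnm_add/0%MM]_(p : 'I_T * I) (arc p.1.+1 p.2 *+ g p))%MM.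

Definition codes T c := [pred g : {ffun 'I_T * I -> 'I_T} | code_mnm (fun p => g p) == c].

(* The patterns with row sums c, listed without repetition when deg c < T. *)
Definition patterns T c : seq pattern :=
  [seq decode (fun p => val (g p)) | g : {ffun 'I_T * I -> 'I_T} <- enum (codes T c)].

Lemma patterns_uniq T c : uniq (patterns T c).
Proof.
rewrite map_inj_uniq ?enum_uniq // => g1 g2 E; apply/ffunP => p; apply: val_inj => /=.
by rewrite -(encodeK (fun p => val (g1 p))) E encodeK.
Qed.

Lemma mem_patterns T c d : (mdeg c < T)%N ->
  (d \in patterns T c) <-> affGT n d /\ row_mnm d = c.
Proof.
case: T => // T cT; split=> [/mapP[g]|[dA dc]].
  rewrite mem_enum inE => /eqP gc ->; split; first exact: decode_affGT.
  by rewrite row_mnm_decode -gc.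
have dT : (mdeg (row_mnm d) <= T.+1)%N by rewrite dc ltnW.
pose g : {ffun 'I_T.+1 * I -> 'I_T.+1} :=
  [ffun p : 'I_T.+1 * I => inord (column d p.1 p.2 - column d p.1.+1 p.2)].
have gE (p : 'I_T.+1 * I) : g p = (column d p.1 p.2 - column d p.1.+1 p.2)%N :> nat.
  rewrite ffunE inordK // ltnS; apply: leq_trans (leq_subr _ _) _.
  by apply: leq_trans (column_leq _ _ dA) _; rewrite dc.
have dg : decode (fun p => val (g p)) = d.
  by rewrite -[RHS](decodeK dA dT); congr decode; apply/funext => p; exact: gE.
apply/mapP; exists g => //; rewrite mem_enum inE /code_mnm.
by rewrite -row_mnm_decode dg dc.
Qed.

Definition pattern_count c : nat := size (patterns (mdeg c).+1 c).

Lemma size_patterns T c : (mdeg c < T)%N -> size (patterns T c) = pattern_count c.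
Proof.
move=> cT; apply: perm_size; apply: uniq_perm; rewrite ?patterns_uniq // => d.
by apply/idP/idP => /mem_patterns H; apply/mem_patterns => //; apply: H.
Qed.

Lemma mpolyX_big (F : numFieldType) (J : finType) (a : J -> 'X_{1..n}) :
  'X_[(\big[mnm_add/0%MM]_j a j)%MM] = \prod_j 'X_[a j] :> {mpoly F[n]}.
Proof. by apply: big_morph; [move=> ? ?; exact: mpolyXD|exact: mpolyX0]. Qed.

(** Expanding the product of geometric sums chooses an exponent for each arc, which is exactly a
    code. *)
Lemma mcoeff_pattern_series (F : numFieldType) T c : (mdeg c < T)%N ->
  (pattern_series n' F T)@_c = (pattern_count c)%:R.
Proof.
move=> cT; rewrite -(size_patterns cT) size_map -cardE /pattern_series /root_geom /geom.
rewrite bigA_distr_bigA /= linear_sum /= -sum1_card natr_sum [RHS]big_mkcond.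
apply: eq_bigr => g _; rewrite -mpolyX_big mcoeffX inE /code_mnm.
by case: eqP.
Qed.

Lemma affGT_local d : (forall i j : int, i < j -> d i j = 0%N) ->
  (forall i j : int, j <= i -> (d (i + 1)%R j <= d i j)%N) -> periodic d ->
  (exists N : int, forall i j : int, N <= i - j -> d i j = 0%N) -> affGT n d.
Proof.
move=> d0 dm dp dN; split=> // i k j jk ki.
have [q ->] : exists q : nat, i = k + q%:Z by exists (absz (i - k)); lia.
elim: q {ki} => [|q IH]; first by rewrite addr0.
apply: leq_trans IH; rewrite -addn1 PoszD addrA; apply: dm; lia.
Qed.

Lemma res_succ r : res (r + 1) = res r + 1.
Proof. exact: resD. Qed.
Lemma res_pred r : res (r - 1) = res r - 1.
Proof. exact: resB. Qed.

Lemma succ_neq (i : I) : (i + 1 == i) = false.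
Proof. by rewrite -[X in _ == X]addr0 (inj_eq (addrI _)) oner_eq0. Qed.
Lemma pred_neq (i : I) : (i - 1 == i) = false.
Proof. by rewrite -[X in _ == X]addr0 (inj_eq (addrI _)) oppr_eq0 oner_eq0. Qed.

Lemma row_mnmE d r : affGT n d -> row_mnm d (res r) = row_sum d r.
Proof. by move=> dA; rewrite mnmE; apply: row_sum_periodic => //; rewrite res_ord. Qed.

(** * Bender-Knuth involutions *)

Section BenderKnuth.
Variable dl : int -> nat.
Hypothesis dlp : forall j, dl (j + n%:Z) = dl j.

Definition interlacing d := forall i j : int, j <= i -> (d i j <= d (i + 1)%R (j + 1)%R + dl j)%N.

(** The bounds imposed on entry (r, j) by rows r - 1 and r + 1. At j = r the entry above is zero
    only by convention and is no bound, hence the case distinction in [bk_high]. *)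
Definition bk_low d (r j : int) : nat := maxn (d (r + 1) j) (d (r - 1)%R (j - 1)%R - dl (j - 1)%R)%N.
Definition bk_high d (r j : int) : nat :=
  let b := (d (r + 1)%R (j + 1)%R + dl j)%N in if j < r then minn (d (r - 1) j) b else b.
(** Reflects every entry in its interval of allowed values. All rows congruent to i change together;
    their neighbours are not congruent to i, so the intervals stay fixed. *)
Definition bender_knuth (i : I) d : pattern := fun r j =>
  if (res r == i) && (j <= r) then (bk_low d r j + bk_high d r j - d r j)%N else d r j.

Lemma bk_bounds d r j : affGT n d -> interlacing d -> j <= r ->
  (bk_low d r j <= d r j <= bk_high d r j)%N.
Proof.
move=> [d0 dm dp _] dI jr; rewrite /bk_low /bk_high geq_max; apply/andP; split.
  apply/andP; split; first by apply: dm => //; lia.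
  have := dI (r - 1) (j - 1); rewrite !subrK leq_subLR addnC; apply; lia.
case: ltP => jr'; last exact: dI.
by rewrite leq_min (dI _ _ jr) andbT; apply: dm; lia.
Qed.

Lemma bender_knuth_affGT i d : affGT n d -> interlacing d ->
  affGT n (bender_knuth i d) /\ interlacing (bender_knuth i d).
Proof.
move=> dA dI; have [d0 dm dp [N dN]] := dA; split; last first.
  move=> r j jr; rewrite /bender_knuth jr res_succ lerD2r jr !andbT.
  case: (eqVneq (res r) i) => [->|ri].
    rewrite succ_neq; have /andP[] := bk_bounds dA dI jr.
    have : (bk_high d r j <= d (r + 1)%R (j + 1)%R + dl j)%N.
      by rewrite /bk_high; case: ifP => // _; apply: geq_minr.
    lia.
  case: eqP => _; last exact: dI.
  have jr1 : j + 1 <= r + 1 by rewrite lerD2r.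
  have /andP[] := bk_bounds dA dI jr1.
  have : (d r j - dl j <= bk_low d (r + 1)%R (j + 1)%R)%N by rewrite /bk_low !addrK; apply: leq_maxr.
  lia.
apply: affGT_local.
- by move=> r j rj; rewrite /bender_knuth [j <= r]leNgt rj andbF d0.
- move=> r j jr; rewrite /bender_knuth jr res_succ andbT.
  have jr1 : j <= r + 1 by lia.
  rewrite jr1 andbT; case: (eqVneq (res r) i) => [->|ri].
    rewrite succ_neq; have /andP[] := bk_bounds dA dI jr.
    have : (d (r + 1)%R j <= bk_low d r j)%N by apply: leq_maxl.
    lia.
  case: eqP => _; last by apply: dm; lia.
  have /andP[] := bk_bounds dA dI jr1.
  have : (bk_high d (r + 1)%R j <= d r j)%N.
    have jr2 : j < r + 1 by lia.
    by rewrite /bk_high jr2 addrK; apply: geq_minl.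
  lia.
- move=> r j; rewrite /bender_knuth resDn lerD2r; case: ifP => // _.
  rewrite /bk_low /bk_high ltrD2r ![_ + n%:Z + 1]addrAC ![_ + n%:Z - 1]addrAC !dp !dlp //.
- exists (`|N|%N%:Z + 2) => r j Nrj; rewrite /bender_knuth.
  case: ifP => _; last by apply: dN; lia.
  have e1 : d (r + 1) j = 0%N by apply: dN; lia.
  have e2 : d (r - 1) (j - 1) = 0%N by apply: dN; lia.
  have e3 : d (r - 1) j = 0%N by apply: dN; lia.
  have jr : j < r by lia.
  by rewrite /bk_low /bk_high jr e1 e2 e3 max0n sub0n min0n.
Qed.

Lemma bender_knuthK i d : affGT n d -> interlacing d -> bender_knuth i (bender_knuth i d) = d.
Proof.
move=> dA dI; apply/funext => r; apply/funext => j.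
rewrite {1}/bender_knuth; case: ifP => [/andP[/eqP ri jr]|ri]; last by rewrite /bender_knuth ri.
have up x : bender_knuth i d (r + 1) x = d (r + 1) x.
  by rewrite /bender_knuth res_succ ri succ_neq.
have dn x : bender_knuth i d (r - 1) x = d (r - 1) x.
  by rewrite /bender_knuth res_pred ri pred_neq.
rewrite /bk_low /bk_high !up !dn -/(bk_low d r j) -/(bk_high d r j).
rewrite /bender_knuth ri eqxx jr /=.
by have /andP[] := bk_bounds dA dI jr; lia.
Qed.

Lemma bender_knuth_row_neq i d r : res r != i -> row_sum (bender_knuth i d) r = row_sum d r.
Proof. by move=> /negPf ri; apply: eq_fsbigr => j _; rewrite /bender_knuth ri. Qed.

(** Old plus new entry is [bk_low] plus [bk_high]. Pairing the lower bound at j + 1 with the upper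
    bound at j gives max(a, b - s) + min(b, a + s) = a + b with s = [dl j]; the unpaired upper bound
    at j = r contributes [dl r]. *)
Lemma bender_knuth_row_eq i d r : affGT n d -> interlacing d -> res r = i ->
  (row_sum (bender_knuth i d) r + row_sum d r =
   dl r + row_sum d (r + 1)%R + row_sum d (r - 1)%R)%N.
Proof.
move=> dA dI ri; have [d0 dm dp [N dN]] := dA.
have [[b0 _ _ [N' bN]] bI] := bender_knuth_affGT i dA dI.
pose T := (`|N| + `|N'| + 3)%N.
have win x k : (T <= k)%N -> row_sum d x = (\sum_(q < k) d x (x - q%:Z)%R)%N.
  by move=> Tk; apply: row_sum_rev => j jx; [apply: dN; rewrite /T in Tk; lia|exact: d0].
have winb : row_sum (bender_knuth i d) r =
    (\sum_(q < T.+1) bender_knuth i d r (r - q%:Z)%R)%N.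
  by apply: row_sum_rev => j jx; [apply: bN; rewrite /T in jx; lia|exact: b0].
rewrite winb (win r T.+1) // (win (r + 1) T.+1) // (win (r - 1) T) // -big_split /=.
transitivity (\sum_(q < T.+1) (bk_low d r (r - q%:Z)%R + bk_high d r (r - q%:Z)%R))%N.
  apply: eq_bigr => q _; have qr : r - q%:Z <= r by lia.
  rewrite /bender_knuth ri eqxx qr andTb; have /andP[] := bk_bounds dA dI qr.
  by move: (bk_low _ _ _) (bk_high _ _ _) (d _ _) => x y z; lia.
rewrite big_split /= big_ord_recr /= [X in (_ + X)%N = _]big_ord_recl /=.
rewrite [X in _ = (_ + X + _)%N]big_ord_recl /=.
have -> : bk_low d r (r - T%:Z) = 0%N.
  have e1 : d (r + 1) (r - T%:Z) = 0%N by apply: dN; rewrite /T; lia.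
  have e2 : d (r - 1) (r - T%:Z - 1) = 0%N by apply: dN; rewrite /T; lia.
  by rewrite /bk_low e1 e2.
have S : (\sum_(q < T) bk_low d r (r - q%:Z)%R
    + \sum_(q < T) bk_high d r (r - (bump 0 q)%:Z)%R =
    \sum_(q < T) d (r + 1)%R (r + 1 - (bump 0 q)%:Z)%R
    + \sum_(q < T) d (r - 1)%R (r - 1 - q%:Z)%R)%N.
  rewrite -!big_split; apply: eq_bigr => q _; rewrite /bump leq0n add1n /=.
  rewrite /bk_low /bk_high; have -> : r - q.+1%:Z < r by lia.
  have -> : r - q.+1%:Z = r - q%:Z - 1 by lia.
  have -> : r - q%:Z - 1 + 1 = r - q%:Z by lia.
  have -> : r + 1 - q.+1%:Z = r - q%:Z by lia.
  have -> : r - 1 - q%:Z = r - q%:Z - 1 by lia.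
  lia.
have -> : bk_high d r (r - 0%N%:Z) = (d (r + 1)%R (r + 1 - 0%N%:Z)%R + dl r)%N.
  by rewrite /bk_high !subr0 ltxx.
by rewrite addn0 addnCA S [(_ + dl r)%N]addnC !addnA.
Qed.

Definition interlacing_patterns c : seq pattern :=
  [seq d <- patterns (mdeg c).+1 c | `[< interlacing d >]].

Lemma mem_interlacing_patterns c d : (d \in interlacing_patterns c) <->
  [/\ affGT n d, interlacing d & row_mnm d = c].
Proof.
rewrite mem_filter; split=> [/andP[/asboolP dI /mem_patterns []] //|[dA dI dc]].
by apply/andP; split; [apply/asboolP|apply/mem_patterns].
Qed.

Lemma interlacing_patterns_uniq c : uniq (interlacing_patterns c).
Proof. exact/filter_uniq/patterns_uniq. Qed.

Definition interlacing_count c : nat := size (interlacing_patterns c).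

Lemma bender_knuth_mnm i d : affGT n d -> interlacing d ->
  let c := row_mnm d in let c' := row_mnm (bender_knuth i d) in
  (forall j, j != i -> c' j = c j) /\
  (c i + c' i = dl i%:Z + c (i + 1)%R + c (i - 1)%R)%N.
Proof.
move=> dA dI c c'; split=> [j ji|].
  by rewrite !mnmE bender_knuth_row_neq // res_ord.
have := bender_knuth_row_eq dA dI (res_ord i).
rewrite -!(row_mnmE _ dA) res_succ res_pred res_ord -/c addnC => <-.
by rewrite /c' /c !mnmE.
Qed.

Lemma interlacing_reflect (i : I) c c' : (forall j, j != i -> c' j = c j) ->
  (c i + c' i = dl i%:Z + c (i + 1)%R + c (i - 1)%R)%N ->
  interlacing_count c = interlacing_count c'.
Proof.
move=> cj ci.
have bk (a a' : 'X_{1..n}) : (forall j, j != i -> a' j = a j) ->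
    (a i + a' i = dl i%:Z + a (i + 1)%R + a (i - 1)%R)%N ->
    forall d, d \in interlacing_patterns a -> bender_knuth i d \in interlacing_patterns a'.
  move=> aj ai d /mem_interlacing_patterns [dA dI da].
  have [bA bI] := bender_knuth_affGT i dA dI; have [bj bi] := bender_knuth_mnm i dA dI.
  apply/mem_interlacing_patterns; split=> //; apply/mnmP => j.
  have [->|ji] := eqVneq j i; last by rewrite bj // da aj.
  by move: bi; rewrite da -ai => /addnI.
rewrite /interlacing_count -(size_map (bender_knuth i)); apply: perm_size.
have inv a d : d \in interlacing_patterns a -> bender_knuth i (bender_knuth i d) = d.
  by move=> /mem_interlacing_patterns [dA dI _]; apply: bender_knuthK.
apply: uniq_perm; last 1 first.
- move=> d; apply/mapP/idP => [[d' d'c ->]|dc']; first exact: bk d'c.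
  exists (bender_knuth i d); last by rewrite (inv c').
  apply: (bk c') dc' => [j ji|]; first by rewrite cj.
  by rewrite (cj (i + 1)) ?succ_neq // (cj (i - 1)) ?pred_neq // addnC.
- rewrite map_inj_in_uniq ?interlacing_patterns_uniq // => d1 d2 d1c d2c E.
  by rewrite -(inv c d1 d1c) E (inv c).
- exact: interlacing_patterns_uniq.
Qed.

(** The toggled pattern would need a negative row sum. *)
Lemma interlacing_out (i : I) c : (dl i%:Z + c (i + 1)%R + c (i - 1)%R < c i)%N ->
  interlacing_count c = 0%N.
Proof.
move=> lt; rewrite /interlacing_count; case E : interlacing_patterns => [|d s] //.
have : d \in interlacing_patterns c by rewrite E inE eqxx.
move=> /mem_interlacing_patterns [dA dI dc]; have [_] := bender_knuth_mnm i dA dI.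
by rewrite dc => bi; move: lt; rewrite -bi; lia.
Qed.

Lemma interlacing_count0 : interlacing_count 0%MM = 1%N.
Proof.
have z : (fun _ _ => 0%N) \in interlacing_patterns 0%MM.
  apply/mem_interlacing_patterns; split => //.
    by split=> //; exists 0.
  by apply/mnmP => i; rewrite mnmE mnm0E /row_sum fsbig1.
rewrite /interlacing_count.
have : interlacing_patterns 0%MM =i [:: (fun _ _ => 0%N)].
  move=> d; rewrite inE; apply/idP/eqP => [|-> //].
  move=> /mem_interlacing_patterns [dA _ d0]; have [z0 _ dp _] := dA.
  apply/funext => a; apply/funext => b; have [|ba] := ltP a b; first exact: z0.
  by rewrite columnE // column_eq0 // d0 mdeg0.
have u1 : uniq [:: (fun _ _ => 0%N) : pattern] by [].
by move=> /(uniq_perm (interlacing_patterns_uniq 0%MM) u1) /perm_size.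
Qed.
End BenderKnuth.

(** * Lattice paths and affine permutations *)

Section LatticePaths.
Variables (eo : int -> int) (M : int).
Hypothesis eo_lt : forall j, eo j < eo (j + 1).
Hypothesis eo_per : forall j, eo (j + n%:Z) = eo j + M.

Lemma eo_perM m j : eo (j + n%:Z * m) = eo j + M * m.
Proof.
have pos (k : nat) x : eo (x + n%:Z * k%:Z) = eo x + M * k%:Z.
  elim: k x => [|k IH] x; first by rewrite !mulr0 !addr0.
  by rewrite (intS k) !mulrDr !mulr1 !addrA IH eo_per.
case: m => k; first exact: pos.
have := pos k.+1 (j + n%:Z * Negz k); rewrite NegzE !mulrN !subrK => ->.
by rewrite addrK.
Qed.

Lemma eo_mono a b : a <= b -> eo a <= eo b.
Proof.
move=> ab; have [q ->] : exists q : nat, b = a + q%:Z by exists (absz (b - a)); lia.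
elim: q {ab b} => [|q IH]; first by rewrite addr0.
have -> : a + q.+1%:Z = a + q%:Z + 1 by lia.
by apply: le_trans IH _; apply: ltW.
Qed.

Lemma period_gt0 : 0 < M.
Proof.
have := eo_per 0; rewrite add0r => E; rewrite -(ltrD2l (eo 0)) -E addr0.
by apply: lt_le_trans (eo_lt 0) _; apply: eo_mono; rewrite add0r.
Qed.

(** Path j starts at time i = j and, since [d] vanishes far from the diagonal, ends at height
    [eo (w j)]: [w] permutes the endpoints. *)
Definition height (w : int -> int) d i j : int := (d i j)%:Z + eo (w j).
Definition viol w d (i j : int) := j <= i /\ height w d (i + 1) (j + 1) <= height w d i j.
(* Invariant under the period (n, M), and increasing along every path. *)
Definition key w d (i j : int) : int := M * i - n%:Z * height w d i j.
Definition min_viol w d i j :=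
  viol w d i j /\ forall i' j', viol w d i' j' -> key w d i j <= key w d i' j'.
(** Minimal violations form periodic families, possibly in several residues; the least column in one
    period singles one out. *)
Definition sel_viol w d i j :=
  [/\ min_viol w d i j, 0 <= j < n%:Z & forall i' j', min_viol w d i' j' -> 0 <= j' -> j <= j'].

Section OneState.
Variables (w : int -> int) (d : pattern).
Hypothesis w_per : forall j, w (j + n%:Z) = w j + n%:Z.
Hypothesis dA : affGT n d.

Lemma w_perM m j : w (j + n%:Z * m) = w j + n%:Z * m.
Proof.
have pos (k : nat) x : w (x + n%:Z * k%:Z) = w x + n%:Z * k%:Z.
  elim: k x => [|k IH] x; first by rewrite !mulr0 !addr0.
  by rewrite (intS k) !mulrDr !mulr1 !addrA IH w_per.
case: m => k; first exact: pos.
have := pos k.+1 (j + n%:Z * Negz k); rewrite NegzE !mulrN !subrK => ->.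
by rewrite addrK.
Qed.

Lemma height_perM m i j : height w d (i + n%:Z * m) (j + n%:Z * m) = height w d i j + M * m.
Proof.
have [_ _ dp _] := dA.
by rewrite /height (periodicM _ _ _ dp) w_perM eo_perM addrA.
Qed.

Lemma viol_perM m i j : viol w d (i + n%:Z * m) (j + n%:Z * m) <-> viol w d i j.
Proof.
by rewrite /viol lerD2r ![_ + n%:Z * m + 1]addrAC !height_perM lerD2r.
Qed.

Lemma key_perM m i j : key w d (i + n%:Z * m) (j + n%:Z * m) = key w d i j.
Proof. by rewrite /key height_perM; ring. Qed.

Lemma min_viol_perM m i j : min_viol w d (i + n%:Z * m) (j + n%:Z * m) <-> min_viol w d i j.
Proof. by rewrite /min_viol viol_perM key_perM. Qed.

Lemma height_anti i k j : j <= k -> k <= i -> height w d i j <= height w d k j.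
Proof. by move=> jk ki; have [_ dm _ _] := dA; rewrite /height lerD2r lez_nat; apply: dm. Qed.

Lemma key_lt i k j : j <= k -> k < i -> key w d k j < key w d i j.
Proof.
move=> jk ki; have H := height_anti jk (ltW ki); rewrite /key.
have M0 := period_gt0; have : M * k < M * i by rewrite ltr_pM2l.
have : n%:Z * height w d i j <= n%:Z * height w d k j by rewrite ler_pM2l.
lia.
Qed.

(** Modulo the period only n paths matter, and on each the key is least at its start, so the keys
    are bounded below. *)
Lemma sel_viol_exists i0 j0 : viol w d i0 j0 -> exists i j, sel_viol w d i j.
Proof.
move=> V0.
have norm (j : int) : exists m, 0 <= j + n%:Z * m < n%:Z.
  exists (- (j %/ n%:Z)%Z); rewrite mulrN mulrC {1 3}(divz_eq j n%:Z) addrC addKr.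
  by rewrite modz_ge0 // ltz_pmod.
have [lb Hlb] : exists lb : int, forall i j, viol w d i j -> lb <= key w d i j.
  exists (- \sum_(q < n) `|key w d q%:Z q%:Z|) => i j V.
  have [m /andP[j0' jn]] := norm j; rewrite -(key_perM m) .
  have [ji _] := proj2 (viol_perM m i j) V.
  set i1 := i + _ in ji *; set j1 := j + _ in ji j0' jn *.
  have : key w d j1 j1 <= key w d i1 j1.
    by move: ji; rewrite le_eqVlt => /orP[/eqP <- //|jlt]; rewrite ltW // key_lt.
  apply: le_trans; rewrite lerNl.
  have j1n : (`|j1| < n)%N by lia.
  have -> : j1 = (Ordinal j1n : nat)%:Z by rewrite /= gez0_abs.
  apply: (le_trans (ler_norm _)); rewrite normrN (bigD1 (Ordinal j1n)) //= lerDl.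
  by apply: sumr_ge0.
have exn : exists k : nat, `[< exists i j, viol w d i j /\ key w d i j = lb + k%:Z >].
  exists (absz (key w d i0 j0 - lb)); apply/asboolP; exists i0, j0; split=> //.
  by rewrite gez0_abs ?subr_ge0 ?Hlb // addrCA subrr addr0.
case: (ex_minnP exn) => k /asboolP [i1 [j1 [V1 k1]]] kmin.
have min1 : min_viol w d i1 j1.
  split=> // i j V; rewrite k1; have lbV := Hlb _ _ V.
  have := kmin (absz (key w d i j - lb)).
  have -> : `[< exists i' j', viol w d i' j' /\ key w d i' j' = lb + (absz (key w d i j - lb))%:Z >].
    by apply/asboolP; exists i, j; split=> //; lia.
  by move=> /(_ isT); lia.
have exj : exists q : nat, `[< exists i, min_viol w d i q%:Z >].
  have [m /andP[j0' jn]] := norm j1; exists (absz (j1 + n%:Z * m)); apply/asboolP.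
  by exists (i1 + n%:Z * m); rewrite gez0_abs // min_viol_perM.
case: (ex_minnP exj) => q /asboolP [i Hi] qmin; exists i, q%:Z; split=> //; last first.
  move=> i' j' Hm j0'; have : (q <= absz j')%N.
    by apply: qmin; apply/asboolP; exists i'; rewrite gez0_abs.
  by lia.
have [m /andP[j0' jn]] := norm q%:Z; rewrite lez_nat leq0n /=.
apply: le_lt_trans jn; have : (q <= absz (q%:Z + n%:Z * m)%R)%N.
  apply: qmin; apply/asboolP.
  by exists (i + n%:Z * m); rewrite gez0_abs // min_viol_perM.
by move: j0'; lia.
Qed.

Lemma sel_viol_uniq i j i' j' : sel_viol w d i j -> sel_viol w d i' j' -> i = i' /\ j = j'.
Proof.
move=> [m1 /andP[j0 _] h1] [m2 /andP[j0' _] h2].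
have jj : j = j' by apply/eqP; rewrite eq_le (h1 _ _ m2) ?(h2 _ _ m1).
split=> //; subst j'; have [[ji _] k1] := m1; have [[ji' _] k2] := m2.
have [lt|lt|//] := ltgtP i i'.
  by have := k2 _ _ m1.1; rewrite leNgt key_lt.
by have := k1 _ _ m2.1; rewrite leNgt key_lt.
Qed.
End OneState.

(** * Swapping tails at a minimal violation *)

Definition adj_swap (j p : int) : int :=
  if res p == res j then p + 1 else if res p == res j + 1 then p - 1 else p.
(** The translate of time i belonging to the pair that contains p; the floor gives both members of a
    pair the same time. *)
Definition crossing (i j p : int) : int := i + n%:Z * ((p - j) %/ n%:Z)%Z.

Lemma adj_swap0 j m : adj_swap j (j + n%:Z * m) = j + n%:Z * m + 1.
Proof. by rewrite /adj_swap resD resMn addr0 eqxx. Qed.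

Lemma adj_swap1 j m : adj_swap j (j + n%:Z * m + 1) = j + n%:Z * m.
Proof. by rewrite /adj_swap resD res1 resD resMn addr0 succ_neq eqxx addrK. Qed.

Lemma crossing0 i j m : crossing i j (j + n%:Z * m) = i + n%:Z * m.
Proof. by rewrite /crossing (_ : j + _ - j = n%:Z * m) ?mulKz //; ring. Qed.

Lemma crossing1 i j m : crossing i j (j + n%:Z * m + 1) = i + n%:Z * m.
Proof.
rewrite /crossing (_ : j + n%:Z * m + 1 - j = m * n%:Z + 1); last by ring.
by rewrite divzMDl // (@divz_small 1) // addr0.
Qed.

Variant adj_spec (j p : int) : Prop :=
| AdjLow m of p = j + n%:Z * m
| AdjHigh m of p = j + n%:Z * m + 1
| AdjFixed of res p != res j & res p != res j + 1 & adj_swap j p = p.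

Lemma adjP j p : adj_spec j p.
Proof.
have [/res_eq [m ->]|pj] := eqVneq (res p) (res j); first exact: (AdjLow (m := m)).
have [E|pj1] := eqVneq (res p) (res j + 1); last first.
  by apply: AdjFixed => //; rewrite /adj_swap (negPf pj) (negPf pj1).
have [m pE] : exists m, p = j + 1 + n%:Z * m by apply: res_eq; rewrite res_succ.
by apply: (AdjHigh (m := m)); rewrite pE addrAC.
Qed.

Lemma adj_swapK j : involutive (adj_swap j).
Proof.
move=> p; case: (adjP j p) => [m ->|m ->|_ _ E]; by rewrite ?adj_swap0 ?adj_swap1 ?adj_swap0 ?E.
Qed.

Lemma adj_swap_per j p : adj_swap j (p + n%:Z) = adj_swap j p + n%:Z.
Proof. by rewrite /adj_swap resDn; do 2?[case: ifP => _]; rewrite // addrAC. Qed.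

Lemma crossing_per i j p : crossing i j (p + n%:Z) = crossing i j p + n%:Z.
Proof.
rewrite /crossing (_ : p + n%:Z - j = 1 * n%:Z + (p - j)); last by ring.
by rewrite divzMDl //; ring.
Qed.

Lemma crossing_swap i j p : crossing i j (adj_swap j p) = crossing i j p.
Proof.
case: (adjP j p) => [m ->|m ->|_ _ -> //].
  by rewrite adj_swap0 crossing0 crossing1.
by rewrite adj_swap1 crossing0 crossing1.
Qed.

Section Swap.
Variables (w : int -> int) (d : pattern) (i j : int).
Hypothesis w_per : forall j, w (j + n%:Z) = w j + n%:Z.
Hypothesis dA : affGT n d.
Hypothesis ij_min : min_viol w d i j.

Local Notation sg := (adj_swap j).
Local Notation cr := (crossing i j).
Local Notation H := (height w d).

(* For every J congruent to j, the paths J and J + 1 exchange their tails after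
   the time [cr J] of their crossing. *)
Definition swap_height (i' p : int) : int := if i' <= cr p then H i' p else H i' (sg p).
Definition swap_perm : int -> int := fun p => w (sg p).
(** The absolute value only converts to [nat]; the difference is nonnegative by [swap_height_ge]. *)
Definition swap_pattern : pattern := fun i' p =>
  if i' < p then 0%N else `|(swap_height i' p - eo (w (sg p)))%R|%N.

Let ij : j <= i. Proof. by case: ij_min => -[]. Qed.

Lemma crossing_viol m : H (i + n%:Z * m + 1) (j + n%:Z * m + 1) <= H (i + n%:Z * m) (j + n%:Z * m).
Proof. by have [V _] := ij_min; have [] := proj2 (viol_perM w_per dA m i j) V. Qed.

Lemma no_viol_before m i' : j + n%:Z * m <= i' -> i' < i + n%:Z * m ->
  H i' (j + n%:Z * m) < H (i' + 1) (j + n%:Z * m + 1).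
Proof.
move=> ji' ii'; rewrite ltNge; apply/negP => V.
have := proj2 ij_min i' (j + n%:Z * m) (conj ji' V).
by rewrite leNgt -(key_perM w_per dA m i j) (key_lt w dA).
Qed.

Lemma swap_le p i' : p <= i' -> cr p < i' -> sg p <= i'.
Proof.
case: (adjP j p) => [m ->|m ->|_ _ ->] //.
  by rewrite adj_swap0 crossing0; move: ij; lia.
by rewrite adj_swap1; lia.
Qed.

(** Only the crossing time I is at stake. Path J continues at H (I+1) (J+1), at most H I J by the
    violation; path J + 1 continues at H (I+1) J, at most H (I-1) J, which is below H I (J+1)
    because there is no earlier violation. *)
Lemma swap_height_anti i' p : p <= i' -> swap_height (i' + 1) p <= swap_height i' p.
Proof.
move=> pi'; rewrite /swap_height; have [le1|gt1] := leP (i' + 1) (cr p).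
  have -> : i' <= cr p by lia.
  by apply: height_anti => //; lia.
have [le2|gt2] := leP i' (cr p); last first.
  by apply: height_anti => //; [exact: swap_le|lia].
have {le2 gt1} i'E : i' = cr p by lia.
rewrite i'E; rewrite i'E in pi'; case: (adjP j p) pi' => [m ->|m ->|_ _ ->] pi'.
- rewrite adj_swap0 crossing0; exact: crossing_viol.
- rewrite adj_swap1 crossing1; rewrite crossing1 in pi'.
  have ji : j + n%:Z * m <= i + n%:Z * m - 1 by lia.
  have := no_viol_before ji; rewrite subrK => lt.
  by apply: le_trans (height_anti w dA ji _) (ltW (lt _)); lia.
- by apply: height_anti => //; lia.
Qed.

Lemma swap_height_per i' p : swap_height (i' + n%:Z) (p + n%:Z) = swap_height i' p + M.
Proof.
have HP a b : H (a + n%:Z) (b + n%:Z) = H a b + M.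
  by have := height_perM w_per dA 1 a b; rewrite !mulr1.
by rewrite /swap_height crossing_per lerD2r adj_swap_per !HP; case: ifP.
Qed.

Lemma swap_height_limit : exists N : int, forall i' p, N <= i' - p -> swap_height i' p = eo (w (sg p)).
Proof.
have [_ _ _ [N dN]] := dA; exists (`|N|%N%:Z + (i - j) + 2) => i' p Ni.
have crp : cr p < i'.
  rewrite /crossing; have := lez_floor (p - j) (isT : n%:Z != 0); move: ij Ni; lia.
rewrite /swap_height leNgt crp /= /height dN ?add0r //.
have : sg p <= p + 1 by rewrite /adj_swap; do 2?[case: ifP => _]; lia.
move: ij Ni; lia.
Qed.

Lemma swap_height_ge i' p : p <= i' -> eo (w (sg p)) <= swap_height i' p.
Proof.
move=> pi'; have [N HN] := swap_height_limit.
have anti (q : nat) : swap_height (i' + q%:Z) p <= swap_height i' p.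
  elim: q => [|q IH]; first by rewrite addr0.
  have -> : i' + q.+1%:Z = i' + q%:Z + 1 by lia.
  by apply: le_trans (swap_height_anti _) IH; lia.
by apply: le_trans (anti (absz N)); rewrite HN //; lia.
Qed.

Lemma swap_heightE i' p : p <= i' -> height swap_perm swap_pattern i' p = swap_height i' p.
Proof.
move=> pi'; rewrite /height /swap_pattern /swap_perm ltNge pi' /=.
by rewrite gez0_abs ?subrK // subr_ge0 swap_height_ge.
Qed.

Lemma swap_pattern_affGT : affGT n swap_pattern.
Proof.
apply: affGT_local.
- by move=> a b ab; rewrite /swap_pattern ab.
- move=> a b ba; rewrite -lez_nat -(lerD2r (eo (w (sg b)))).
  have := swap_heightE ba; rewrite /height /swap_perm => ->.
  have ba1 : b <= a + 1 by lia.
  have := swap_heightE ba1; rewrite /height /swap_perm => ->.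
  exact: swap_height_anti.
- move=> a b; rewrite /swap_pattern ltrD2r; case: ifP => // _.
  rewrite swap_height_per adj_swap_per w_per eo_per; congr absz; ring.
- have [N HN] := swap_height_limit; exists N => a b Nab.
  by rewrite /swap_pattern; case: ifP => // _; rewrite HN // subrr.
Qed.

Lemma swap_height_le i' p : i' <= cr p -> swap_height i' p = H i' p.
Proof. by rewrite /swap_height => ->. Qed.

Lemma swap_height_gt i' p : cr p < i' -> swap_height i' p = H i' (sg p).
Proof. by rewrite /swap_height leNgt => ->. Qed.

Lemma swap_height_fixed i' p : sg p = p -> swap_height i' p = H i' p.
Proof. by rewrite /swap_height => ->; case: ifP. Qed.

Let I0 m := i + n%:Z * m.
Let J0 m := j + n%:Z * m.

Let key0 m : key w d (I0 m) (J0 m) = key w d i j.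
Proof. exact: key_perM. Qed.

Let key'E i' p : p <= i' -> key swap_perm swap_pattern i' p = M * i' - n%:Z * swap_height i' p.
Proof. by move=> pi'; rewrite /key swap_heightE. Qed.

(* Below the key of the selected violation, the swap changes nothing. *)
Lemma swap_early i' p : p <= i' ->
  (key w d i' p <= key w d i j) || (key swap_perm swap_pattern i' p <= key w d i j) ->
  swap_height i' p = H i' p /\ (sg p != p -> i' <= cr p).
Proof.
move=> pi' early.
have late (x : int) m : I0 m < i' -> x <= H (I0 m) (J0 m) ->
    key w d i j < M * i' - n%:Z * x.
  move=> Ii' xH; rewrite -(key0 m) /key.
  have : M * I0 m < M * i' by rewrite ltr_pM2l // period_gt0.
  have : n%:Z * x <= n%:Z * H (I0 m) (J0 m) by rewrite ler_pM2l.
  lia.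
case: (adjP j p) early pi' => [m ->|m ->|_ _ E] early pi'; last first.
  by rewrite E eqxx; split=> //; apply: swap_height_fixed.
- have [le|gt] := leP i' (cr (j + n%:Z * m + 1)); first by split=> //; apply: swap_height_le.
  exfalso; move: early; rewrite key'E // swap_height_gt // adj_swap1.
  rewrite crossing1 in gt.
  have h1 : H i' (j + n%:Z * m + 1) <= H (I0 m) (J0 m).
    by apply: le_trans (height_anti w dA _ _) (crossing_viol m); move: ij; lia.
  have h2 : H i' (j + n%:Z * m) <= H (I0 m) (J0 m).
    by apply: height_anti => //; rewrite /I0 /J0; move: ij; lia.
  by move: (late _ m gt h1) (late _ m gt h2); rewrite /key !ltNge => /negPf -> /negPf ->.
- have [le|gt] := leP i' (cr (j + n%:Z * m)); first by split=> //; apply: swap_height_le.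
  exfalso; move: early; rewrite key'E // swap_height_gt // adj_swap0.
  rewrite crossing0 in gt.
  have h1 : H i' (j + n%:Z * m + 1) <= H (I0 m) (J0 m).
    by apply: le_trans (height_anti w dA _ _) (crossing_viol m); move: ij; lia.
  have h2 : H i' (j + n%:Z * m) <= H (I0 m) (J0 m).
    by apply: height_anti => //; rewrite /I0 /J0; move: ij; lia.
  by move: (late _ m gt h1) (late _ m gt h2); rewrite /key !ltNge => /negPf -> /negPf ->.
Qed.

(** Only the height of path p + 1 can have changed. For p = J - 1 a change would require a violation
    of smaller key; for p = J it occurs at the crossing itself, which is a violation both before and
    after the swap. *)
Lemma swap_viol i' p : p <= i' -> key w d i' p <= key w d i j ->
  swap_height i' p = H i' p ->
  (viol swap_perm swap_pattern i' p <-> viol w d i' p).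
Proof.
move=> pi' early sE; have pi1 : p + 1 <= i' + 1 by rewrite lerD2r.
rewrite /viol !swap_heightE // sE.
have [_ back] := swap_early pi' (introT orP (or_introl early)).
have same : swap_height (i' + 1) (p + 1) = H (i' + 1) (p + 1) ->
    p <= i' /\ swap_height (i' + 1) (p + 1) <= H i' p <->
    p <= i' /\ H (i' + 1) (p + 1) <= H i' p by move=> ->.
case: (adjP j (p + 1)) => [m pE|m pE|_ _ E]; last by apply: same; apply: swap_height_fixed.
- have pJ : p = J0 m - 1 by rewrite /J0 -pE addrK.
  have [le|gt] := leP (i' + 1) (cr (p + 1)); first by apply: same; apply: swap_height_le.
  exfalso; rewrite pE crossing0 -/(I0 m) in gt.
  have JI : J0 m <= I0 m by rewrite /I0 /J0; move: ij; lia.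
  have lt : H (I0 m) (J0 m - 1) < H (I0 m) (J0 m).
    rewrite ltNge; apply/negP => ge.
    have V : viol w d (I0 m - 1) (J0 m - 1).
      split; first by lia.
      by rewrite !subrK; apply: le_trans ge _; apply: height_anti => //; lia.
    have := proj2 ij_min _ _ V; rewrite -(key0 m) leNgt => /negP; apply.
    apply: lt_le_trans (_ : key w d (I0 m) (J0 m - 1) <= _); first by apply: key_lt => //; lia.
    by rewrite /key; have : n%:Z * H (I0 m) (J0 m) <= n%:Z * H (I0 m) (J0 m - 1);
      [rewrite ler_pM2l|lia].
  have : key w d (I0 m) (J0 m) < key w d (I0 m) (J0 m - 1).
    by rewrite /key; have : n%:Z * H (I0 m) (J0 m - 1) < n%:Z * H (I0 m) (J0 m);
      [rewrite ltr_pM2l|lia].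
  rewrite key0 => /lt_le_trans lt2; move: early; rewrite pJ leNgt => /negP; apply; apply: lt2.
  have [<-|ne] := eqVneq (I0 m) i'; first exact: lexx.
  by apply/ltW/(key_lt w dA); move: gt ne; lia.
- have pJ : p = J0 m by apply: (addIr 1); rewrite pE.
  have le : i' <= cr (p + 1).
    by have := back; rewrite pJ adj_swap0 crossing0 => b; rewrite -pJ pE crossing1; apply: b; lia.
  have [le1|gt1] := leP (i' + 1) (cr (p + 1)); first by apply: same; apply: swap_height_le.
  have i'E : i' = I0 m by move: le gt1; rewrite pE crossing1 /I0; lia.
  rewrite swap_height_gt // pE adj_swap1 i'E pJ -/(J0 m); split=> -[JI _]; split=> //.
    exact: crossing_viol.
  by apply: height_anti => //; lia.
Qed.

(** This makes the swap an involution: the same violation is selected before and after. *)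
Lemma swap_min_viol i' p : min_viol swap_perm swap_pattern i' p <-> min_viol w d i' p.
Proof.
have base : viol swap_perm swap_pattern i j /\ key swap_perm swap_pattern i j = key w d i j.
  have [sE _] := swap_early ij (introT orP (or_introl (lexx _))).
  split; last by rewrite key'E // sE.
  by apply/swap_viol => //; case: ij_min.
have keyE a b : b <= a -> swap_height a b = H a b -> key swap_perm swap_pattern a b = key w d a b.
  by move=> ba E; rewrite key'E // E.
have lower a b : viol swap_perm swap_pattern a b ->
    key w d i j <= key swap_perm swap_pattern a b.
  move=> V; have [ba _] := V; rewrite leNgt; apply/negP => lt.
  have [sE _] := swap_early ba (introT orP (or_intror (ltW lt))).
  have early : key w d a b <= key w d i j by rewrite -(keyE _ _ ba sE) ltW.
  have := proj2 ij_min _ _ (proj1 (swap_viol ba early sE) V).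
  by rewrite -(keyE _ _ ba sE) leNgt lt.
split=> -[V mn].
- have [pi' _] := V.
  have le : key swap_perm swap_pattern i' p <= key w d i j.
    by rewrite -base.2; apply: mn; case: base.
  have [sE _] := swap_early pi' (introT orP (or_intror le)).
  have kE := keyE _ _ pi' sE.
  split; first by apply/swap_viol => //; rewrite -kE.
  by move=> a b Vab; rewrite -kE; apply: le_trans le _; case: ij_min => _; apply.
- have [pi' _] := V.
  have le : key w d i' p <= key w d i j by apply: mn; case: ij_min.
  have [sE _] := swap_early pi' (introT orP (or_introl le)).
  split; first by apply/swap_viol.
  by move=> a b Vab; rewrite (keyE _ _ pi' sE); apply: le_trans le _; apply: lower.
Qed.

Lemma swap_sel_viol i' p : sel_viol swap_perm swap_pattern i' p <-> sel_viol w d i' p.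
Proof.
rewrite /sel_viol; split=> -[h1 h2 h3]; split=> //; try exact/swap_min_viol.
  by move=> a b /swap_min_viol; apply: h3.
by move=> a b /swap_min_viol; apply: h3.
Qed.
End Swap.

Lemma swap_permK w j : swap_perm (swap_perm w j) j = w.
Proof. by apply/funext => p; rewrite /swap_perm adj_swapK. Qed.

(** The two terms of a pair cancel, so only pairs cut by an end of the window survive; [G p]
    accounts for a cut between p - 1 and p. *)
Lemma adj_telescope j (f : int -> int) lo L :
  (forall p, adj_swap j p = p -> f p = 0) ->
  (forall m, f (j + n%:Z * m) + f (j + n%:Z * m + 1) = 0) ->
  let G p := if res p == res j + 1 then f (p - 1) else 0 in
  \sum_(q < L) f (lo + (q : nat)%:Z) = G (lo + L%:Z) - G lo.
Proof.
move=> f0 f2 G; elim: L => [|L IH]; first by rewrite big_ord0 addr0 subrr.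
rewrite big_ord_recr /= IH; set p := lo + L%:Z.
have -> : lo + L.+1%:Z = p + 1 by rewrite /p; lia.
suff -> : f p = G (p + 1) - G p by ring.
rewrite /G res_succ (inj_eq (addIr 1)) addrK; case: (adjP j p) => [m ->|m ->|pj pj1 E].
- by rewrite resD resMn addr0 eqxx eq_sym succ_neq subr0.
- rewrite resD res1 resD resMn addr0 succ_neq eqxx addrK.
  by have := f2 m; lia.
- by rewrite (negPf pj) (negPf pj1) f0 // subrr.
Qed.

Section SwapTwice.
Variables (w : int -> int) (d : pattern) (i j : int).
Hypothesis w_per : forall j, w (j + n%:Z) = w j + n%:Z.
Hypothesis dA : affGT n d.
Hypothesis ij_min : min_viol w d i j.

Local Notation sg := (adj_swap j).
Local Notation cr := (crossing i j).
Local Notation w' := (swap_perm w j).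
Local Notation d' := (swap_pattern w d i j).

Lemma swap_patternK : swap_pattern w' d' i j = d.
Proof.
have [d0 _ _ _] := dA.
apply/funext => a; apply/funext => b; rewrite {1}/swap_pattern; case: ltP => [/d0 -> //|ba].
suff -> : swap_height w' d' i j a b = height w d a b.
  by rewrite {1}/swap_perm adj_swapK /height addrK.
rewrite {1}/swap_height; case: leP => [le|gt].
  by rewrite (swap_heightE w_per dA ij_min ba) swap_height_le.
rewrite (swap_heightE w_per dA ij_min (swap_le ij_min ba gt)).
by rewrite swap_height_gt ?crossing_swap // adj_swapK.
Qed.

(** Row r meets only the paths p with p <= r, so its sum changes exactly when it separates r from
    its partner r + 1. *)
Lemma swap_row_sum r : (row_sum d' r)%:Z = (row_sum d r)%:Z +
  (if res r == res j then eo (w r) - eo (w (r + 1)) else 0).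
Proof.
have [d0 _ _ [N dN]] := dA; have [d0' _ _ [N' dN']] := swap_pattern_affGT w_per dA ij_min.
pose L := (`|N| + `|N'| + 1)%N; pose lo := r - L%:Z + 1.
have win e Q : (forall i j : int, i < j -> e i j = 0%N) -> (forall i j, Q <= i - j -> e i j = 0%N) ->
    (`|Q| < L)%N -> (row_sum e r)%:Z = \sum_(q < L) (e r (lo + (q : nat)%:Z))%:Z.
  move=> e0 eQ QL; rewrite (row_sum_window (lo := lo) (L := L)).
  - by rewrite -natz natr_sum; apply: eq_bigr => q _; rewrite natz.
  - by move=> b blo; apply: eQ; rewrite /lo in blo; lia.
  - exact: e0.
  - by rewrite /lo; lia.
pose f p := swap_height w d i j r p - eo (w (sg p)) - (d r p)%:Z.
have fE p : p <= r -> f p = (d' r p)%:Z - (d r p)%:Z.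
  by move=> pr; rewrite /f -(swap_heightE w_per dA ij_min pr) /height addrK.
apply/eqP; rewrite -subr_eq0 opprD addrA; apply/eqP.
rewrite (win _ _ d0' dN') ?(win _ _ d0 dN) /L; try lia.
rewrite -/L -sumrB (eq_bigr (fun q : 'I_L => f (lo + (q : nat)%:Z))); last first.
  by move=> q _; rewrite fE // /lo; have := ltn_ord q; lia.
rewrite (@adj_telescope j) => [|p E|m].
- have -> : lo + L%:Z = r + 1 by rewrite /lo; ring.
  rewrite res_succ (inj_eq (addIr 1)) addrK.
  have -> : f (lo - 1) = 0.
    by rewrite fE ?(dN' r) ?(dN r) ?subrr // /lo /L; lia.
  rewrite if_same subr0; case: eqP => [/res_eq [m rE]|_]; last by rewrite subr0.
  rewrite /f rE adj_swap0 swap_height_le; first by rewrite /height; ring.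
  by rewrite crossing0; case: ij_min => -[]; lia.
- by rewrite /f E swap_height_fixed // /height; ring.
- rewrite /f adj_swap0 adj_swap1 /swap_height crossing0 crossing1 adj_swap0 adj_swap1.
  by rewrite /height; case: ifP => _; ring.
Qed.
End SwapTwice.

(* [2 M] times the r-th coordinate of the translation of weights attached to w;
   left undivided, so that divisibility never has to be proved. *)
Definition energy (w : int -> int) (r : int) : int :=
  \sum_(q < n) (eo (w (r + 1 + (q : nat)%:Z)) ^+ 2 - eo (r + 1 + (q : nat)%:Z) ^+ 2).

(** * Affine permutations of bounded energy *)

Definition affperm (w : int -> int) : Prop :=
  [/\ forall j, w (j + n%:Z) = w j + n%:Z, injective w
    & forall r, \sum_(q < n) (w (r + (q : nat)%:Z) - (r + (q : nat)%:Z)) = 0].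

Section Affperm.
Variable w : int -> int.
Hypothesis wA : affperm w.

Lemma swap_affperm j : affperm (swap_perm w j).
Proof.
have [w_per w_inj w_sum] := wA; split=> [p|p q /w_inj|r].
- by rewrite /swap_perm adj_swap_per w_per.
- exact: (can_inj (adj_swapK j)).
- rewrite -[RHS](w_sum r); apply/eqP; rewrite -subr_eq0 -sumrB; apply/eqP.
  rewrite (eq_bigr (fun q : 'I_n => w (adj_swap j (r + (q : nat)%:Z)) - w (r + (q : nat)%:Z))).
    rewrite (@adj_telescope j (fun p => w (adj_swap j p) - w p)) => [|p ->|m].
    + by rewrite resDn addrAC adj_swap_per !w_per; case: ifP => _; ring.
    + by rewrite subrr.
    + by rewrite adj_swap0 adj_swap1; ring.
  by move=> q _; rewrite /swap_perm; ring.
Qed.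

(** The change offsets that of [swap_row_sum]: energy plus 2 M times the row sum is preserved. *)
Lemma swap_energy j r : energy (swap_perm w j) r = energy w r +
  (if res r == res j then M * 2 * (eo (w (r + 1)) - eo (w r)) else 0).
Proof.
have [w_per _ _] := wA.
apply/eqP; rewrite addrC -subr_eq -sumrB; apply/eqP.
rewrite (eq_bigr (fun q : 'I_n => eo (w (adj_swap j (r + 1 + (q : nat)%:Z))) ^+ 2
                                - eo (w (r + 1 + (q : nat)%:Z)) ^+ 2)); last first.
  by move=> q _; rewrite /swap_perm; ring.
rewrite (@adj_telescope j (fun p => eo (w (adj_swap j p)) ^+ 2 - eo (w p) ^+ 2)) => [|p ->|m].
- rewrite resDn res_succ (inj_eq (addIr 1)) [r + 1 + _ - 1]addrAC adj_swap_per !w_per addrK.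
  case: eqP => [/res_eq [m rE]|_]; last by rewrite subrr.
  by rewrite rE adj_swap0 !eo_per; ring.
- by rewrite subrr.
- by rewrite adj_swap0 adj_swap1; ring.
Qed.

Definition sgn_mx (w : int -> int) : 'M[int]_n := \matrix_(r, c) (res (w (r : nat)%:Z) == c)%:R.
End Affperm.

(* The sign of the permutation of residues modulo n induced by w. *)
Definition affsgn (w : int -> int) : int := \det (sgn_mx w).

Lemma affsgn_id : affsgn id = 1.
Proof.
rewrite /affsgn (_ : sgn_mx _ = 1%:M) ?det1 //; apply/matrixP => r c.
by rewrite !mxE res_ord.
Qed.

Lemma swap_sgn w j : (forall j, w (j + n%:Z) = w j + n%:Z) ->
  affsgn (swap_perm w j) = - affsgn w.
Proof.
move=> w_per; rewrite /affsgn.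
suff -> : sgn_mx (swap_perm w j) = row_perm (tperm (res j) (res j + 1)) (sgn_mx w).
  by rewrite row_permE det_mulmx det_perm odd_tperm eq_sym succ_neq expr1 mulN1r.
have res_w p q : res p = res q -> res (w p) = res (w q).
  by move=> /res_eq [m ->]; rewrite w_perM // resD resMn addr0.
apply/matrixP => r c; rewrite !mxE /swap_perm; congr ((_ == c)%:R); apply: res_w.
rewrite res_ord /adj_swap res_ord.
case: tpermP => [->|->|/eqP/negPf -> /eqP/negPf ->]; rewrite ?eqxx ?succ_neq ?res_ord //.
- by rewrite res_succ res_ord.
- by rewrite res_pred res_ord addrK.
Qed.

(** Write w (b + q) = b + rho q + n tau q with [rho] a permutation. As [tau] sums to zero, linear
    terms in it can be adjusted freely, leaving M times the sum of M tau (tau - 1) + 2 g tau with 0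
    <= g < M; each term is nonnegative and controls |tau|. *)
Lemma affperm_energy w r : affperm w -> exists T : I -> int,
  [/\ forall q, 0 <= T q, energy w r = M * \sum_q T q
    & forall q : I, `|w (r + 1 + (q : nat)%:Z) - (r + 1 + (q : nat)%:Z)| <= n%:Z * (T q + 2)].
Proof.
move=> [w_per w_inj w_sum]; set b := r + 1.
pose x (q : I) := w (b + (q : nat)%:Z) - b; pose rho q := res (x q); pose tau q := (x q %/ n%:Z)%Z.
have xE (q : I) : w (b + (q : nat)%:Z) = b + (rho q : nat)%:Z + n%:Z * tau q.
  have := divz_eq (x q) n%:Z; rewrite -res_val -/(rho q) -/(tau q) /x; lia.
have rho_inj : injective rho.
  move=> q1 q2 /res_eq [m E]; have {}E : w (b + (q1 : nat)%:Z) = w (b + (q2 : nat)%:Z + n%:Z * m).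
    by rewrite w_perM //; move: E; rewrite /x; lia.
  have := congr1 res (w_inj _ _ E); rewrite !resD resMn addr0 => /addrI.
  by rewrite !res_ord.
have re (phi : I -> int) : \sum_q phi (rho q) = \sum_q phi q by rewrite [RHS](reindex_inj rho_inj).
have tau0 : \sum_q tau q = 0.
  have := w_sum b; rewrite (eq_bigr (fun q : I => ((rho q : nat)%:Z - (q : nat)%:Z) + n%:Z * tau q)).
    rewrite big_split sumrB /= (re (fun q => (q : nat)%:Z)) subrr add0r -mulr_sumr => /eqP.
    by rewrite mulf_eq0 => /orP[//|/eqP].
  by move=> q _; rewrite xE; ring.
pose g (q : I) := eo (b + (q : nat)%:Z) - eo b.
have g_ge (q : I) : 0 <= g q by rewrite subr_ge0 eo_mono // lerDl.
have g_lt (q : I) : g q + 1 <= M.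
  have h1 : eo (b + (q : nat)%:Z) < eo (b + (q : nat)%:Z + 1) := eo_lt _.
  have h2 : eo (b + (q : nat)%:Z + 1) <= eo (b + n%:Z) by apply: eo_mono; have := ltn_ord q; lia.
  by move: h1 h2; rewrite eo_per /g; lia.
pose T q := M * (tau q * (tau q - 1)) + 2 * g (rho q) * tau q.
have M0 := period_gt0.
have bound (q : I) : 0 <= T q /\ `|tau q| <= T q + 1.
  have := g_ge (rho q); have := g_lt (rho q); rewrite /T; move: (g _) (tau q) => a t aM a0.
  have [t0|t0] := leP 1 t.
    have h1 : 0 <= a * t by rewrite mulr_ge0 //; lia.
    have h2 : 0 <= (M - 1) * (t * (t - 1)) by rewrite !mulr_ge0 //; lia.
    have h3 : 0 <= (t - 1) * (t - 1) by rewrite -expr2 sqr_ge0.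
    by split; lia.
  have h1 : 0 <= (M - 1 - a) * (- t) by rewrite mulr_ge0 //; lia.
  have [->|t1] := eqVneq t 0; first by rewrite mul0r !mulr0 add0r.
  have h2 : 0 <= M * ((- t) * (- t - 1)) by rewrite !mulr_ge0 //; lia.
  by split; lia.
exists T; split=> [q||q]; first by case: (bound q).
- have -> : energy w r = \sum_q (2 * (M * eo b) * tau q + M * T q + M * M * tau q
      + ((eo (b + (rho q : nat)%:Z) ^+ 2) - eo (b + (q : nat)%:Z) ^+ 2)).
    by apply: eq_bigr => q _; rewrite -/b xE eo_perM /T /g; ring.
  rewrite !big_split sumrN /= (re (fun q => eo (b + (q : nat)%:Z) ^+ 2)) subrr addr0.
  by rewrite -!mulr_sumr tau0 !mulr0 add0r addr0 [X in _ = _ * (X + _)]mulr_sumr -big_split.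
- have [T0 tT] := bound q; rewrite xE.
  have h : `|n%:Z * tau q| <= n%:Z * (T q + 1) by rewrite normrM ger0_norm // ler_pM2l.
  by have := ltn_ord (rho q); have := ltn_ord q; move: h; lia.
Qed.

Lemma energy_ge0 w r : affperm w -> 0 <= energy w r.
Proof.
move=> /(@affperm_energy w r) [T [T0 -> _]].
by rewrite mulr_ge0 ?sumr_ge0 // ltW // period_gt0.
Qed.

Lemma affperm_bound w r (a : nat) p : affperm w -> energy w r = M * 2 * a%:Z ->
  `|w p - p| <= n%:Z * (2 * a%:Z + 2).
Proof.
move=> wA E; have [T [T0 ET HT]] := affperm_energy r wA; have [w_per _ _] := wA.
have Ta (q : I) : T q <= 2 * a%:Z.
  have -> : 2 * a%:Z = \sum_q T q.
    by apply: (mulfI (lt0r_neq0 period_gt0)); rewrite -ET E mulrA.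
  by rewrite (bigD1 q) //= lerDl sumr_ge0.
pose q : I := res (p - r - 1).
have [m pE] : exists m, p = r + 1 + (q : nat)%:Z + n%:Z * m.
  by apply: res_eq; rewrite resD res_ord /q !resB resD !res1; ring.
rewrite pE w_perM // (_ : _ - _ = w (r + 1 + (q : nat)%:Z) - (r + 1 + (q : nat)%:Z)); last by ring.
apply: le_trans (HT q) _; rewrite ler_pM2l // lerD2r; exact: Ta.
Qed.

(** By [shifts_eo], the values of eo after w are the coordinates of Lam + rho minus the sum of a_i
    alpha_i. *)
Definition shifts (w : int -> int) (a : 'X_{1..n}) : Prop :=
  affperm w /\ forall r, energy w r = M * 2 * (a (res r))%:Z.

(* A map commuting with translation by n is determined by its displacements on
   residues; subtracting [B %/ 2] allows negative displacements. *)
Definition displaced B (v : {ffun I -> 'I_B}) (p : int) : int :=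
  p + ((v (res p) : nat)%:Z - (B %/ 2)%N%:Z).

(** Displacements are at most n (2 a_0 + 2) by [affperm_bound]; half of the range n (8 a_0 + 8)
    leaves room on both sides. *)
Definition shift_perms (a : 'X_{1..n}) : seq (int -> int) :=
  [seq w <- [seq displaced v | v : {ffun I -> 'I_(n * (8 * a 0%R + 8))}] | `[< shifts w a >]].

Lemma shift_perms_uniq a : uniq (shift_perms a).
Proof.
rewrite filter_uniq // map_inj_uniq ?enum_uniq // => v1 v2 E; apply/ffunP => i.
have := congr1 (fun w => w (i : nat)%:Z) E; rewrite /displaced res_ord => /addrI /(addIr _).
by case=> /val_inj.
Qed.

Lemma mem_shift_perms w a : (w \in shift_perms a) <-> shifts w a.
Proof.
rewrite mem_filter; split=> [/andP[/asboolP //]|wS]; apply/andP; split; first exact/asboolP.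
have [wA wE] := wS; have [w_per _ _] := wA.
have B0 : (0 < n * (8 * a 0%R + 8))%N by rewrite muln_gt0 /= addn_gt0 orbT.
set B := (n * _)%N in B0 *; pose C := (B %/ 2)%N.
have CE : C%:Z = n%:Z * (4 * (a 0%R)%:Z + 4) /\ B%:Z = 2 * C%:Z.
  have BE : B = (n * (4 * a 0%R + 4) * 2)%N by rewrite /B; ring.
  by rewrite /C BE mulnK //; split; rewrite ?PoszM ?PoszD; ring.
have bd p : `|w p - p| <= n%:Z * (2 * (a 0%R)%:Z + 2).
  by apply: (@affperm_bound _ 0) => //; rewrite wE -[X in res X]/(0%:Z) res_nat.
apply/mapP; exists [ffun i : I => insubd (Ordinal B0) (absz (w (i : nat)%:Z - (i : nat)%:Z + C%:Z))].
  by rewrite mem_enum.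
apply/funext => p; rewrite /displaced ffunE val_insubd.
have [m pE] : exists m, p = (res p : nat)%:Z + n%:Z * m by apply: res_eq; rewrite res_ord.
have -> : w (res p : nat)%:Z - (res p : nat)%:Z = w p - p by rewrite {3 4}pE w_perM //; ring.
have bdp := bd p; have n0 : (0 : int) < n%:Z by [].
have h : n%:Z * (2 * (a 0%R)%:Z + 2) * 2 = C%:Z by rewrite CE.1; ring.
have h' : 0 < C%:Z by rewrite CE.1 mulr_gt0 //; lia.
rewrite ifT -/C; first by rewrite gez0_abs; lia.
by rewrite -ltz_nat -/B; have := CE.2; lia.
Qed.

Lemma sum_involution (X : eqType) (s : seq X) (f : X -> int) (phi : X -> X) : uniq s ->
  {in s, forall x, [/\ phi x \in s, phi (phi x) = x & f (phi x) = - f x]} ->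
  \sum_(x <- s) f x = 0.
Proof.
move=> us H; have sp : perm_eq s (map phi s).
  apply: uniq_perm => // [|x].
    by rewrite map_inj_in_uniq // => x y /H [_ Ex _] /H [_ Ey _] E; rewrite -Ex E Ey.
  apply/idP/mapP => [xs|[y ys ->]]; last by case: (H y ys).
  by exists (phi x); case: (H x xs).
have : \sum_(x <- s) f x = - \sum_(x <- s) f x.
  rewrite {1}(perm_big _ sp) big_map -sumrN; apply: eq_big_seq => x xs.
  by case: (H x xs).
lia.
Qed.

(** The coroot values of Lam; the subtracted 1 removes the contribution of rho that makes [eo]
    strict. *)
Definition gap (j : int) : nat := `|(eo (j + 1) - eo j - 1)%R|%N.

Lemma gapE j : (gap j)%:Z = eo (j + 1) - eo j - 1.
Proof. by rewrite gez0_abs //; have := eo_lt j; lia. Qed.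

Lemma gap_per j : gap (j + n%:Z) = gap j.
Proof. by rewrite /gap [j + n%:Z + 1]addrAC !eo_per; congr absz; ring. Qed.

Lemma shifts_eo w a r : shifts w a ->
  eo (w r) = eo r + (a (res r))%:Z - (a (res (r - 1)))%:Z.
Proof.
move=> [[w_per _ _] wE]; pose h p := eo (w p) ^+ 2 - eo p ^+ 2.
have : energy w r - energy w (r - 1) = h (r + n%:Z) - h r.
  rewrite /energy subrK -sumrB.
  transitivity (\sum_(0 <= q < n) (h (r + q.+1%:Z) - h (r + q%:Z))).
    rewrite big_mkord; apply: eq_bigr => q _; rewrite /h.
    by rewrite (_ : r + (q : nat).+1%:Z = r + 1 + (q : nat)%:Z) //; lia.
  by rewrite (telescope_sumr (fun q : nat => h (r + q%:Z))) // addr0.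
rewrite !wE /h w_per !eo_per => E; have M0 := period_gt0.
have M2 : M * 2 != 0 by rewrite mulf_neq0 // lt0r_neq0.
apply: (mulfI M2); move: E; rewrite !(mulrDr, mulrN); lia.
Qed.

(** Affine permutations preserve the norm of Lam + rho. Concretely, substituting [shifts_eo] into
    the energy at 0 leaves a telescoping sum of [Z]. *)
Lemma shifts_casimir (F : numFieldType) w a : shifts w a ->
  casimir_val F (fun i : I => gap (i : nat)%:Z) a = 0.
Proof.
move=> wS; have [_ wE] := wS.
pose A (p : int) := (a (res p))%:Z; pose Z p := 2 * eo p * A p + A p ^+ 2.
pose cas (q : int) := (eo (q + 1) - eo q) * A q - (A q * A q - A q * A (q + 1)).
have cas0 : \sum_(q < n) cas (q : nat)%:Z = 0.
  have : 2 * \sum_(q < n) cas (q : nat)%:Z + energy w 0 = Z n%:Z - Z 0.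
    rewrite -(telescope_sumr (fun q : nat => Z q%:Z)) // big_mkord mulr_sumr -big_split.
    apply: eq_bigr => q _ /=; rewrite (shifts_eo _ wS) add0r.
    have -> : (q : nat).+1%:Z = (q : nat)%:Z + 1 by lia.
    rewrite [1 + _]addrC addrK /cas /Z -!/(A _); ring.
  have := eo_per 0; rewrite add0r /Z wE /A => ->.
  rewrite -[n%:Z]mulr1 resMn (_ : res _ = 0); last exact: (res_nat 0).
  move: (\sum_(q < n) _) (a 0)%:Z (eo 0) => S x e E.
  have : 2 * S = 0 by apply: (addIr (M * 2 * x)); rewrite E; ring.
  lia.
have <- : (\sum_(q < n) cas (q : nat)%:Z)%:~R = 0 :> F by rewrite cas0.
rewrite (rmorph_sum (intmul (1 : F))) /casimir_val /shell_quad -sumrB /=.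
apply: eq_bigr => q _; rewrite /cas /A res_succ res_ord.
have -> : eo ((q : nat)%:Z + 1) - eo (q : nat)%:Z = (gap (q : nat)%:Z)%:Z + 1.
  by rewrite gapE subrK.
by rewrite !(rmorphB, rmorphD, rmorphM) /= ?expr2 -?pmulrn.
Qed.

(** * The sign-reversing involution on pairs of an affine permutation and a pattern *)

Definition state c w d := [/\ affperm w, affGT n d
  & forall r, energy w r + M * 2 * (row_sum d r)%:Z = M * 2 * (c (res r))%:Z].

Definition states c : seq ((int -> int) * pattern) :=
  [seq x | a : 'X_{1..n < (mdeg c).+1} <- enum [pred a : 'X_{1..n < (mdeg c).+1} | (a <= c)%MM],
           x : (int -> int) * pattern <- [seq (w, d) | w <- shift_perms a, d <- patterns (mdeg c).+1 (c - a)%MM]].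

Lemma mem_states c x : (x \in states c) <-> state c x.1 x.2.
Proof.
have Mnz : M * 2 != 0 by rewrite mulf_neq0 // lt0r_neq0 // period_gt0.
have sub_lt a : (mdeg (c - a)%MM < (mdeg c).+1)%N.
  by rewrite ltnS lem_mdeg // lem_subr.
split.
  move=> /allpairsPdep [a [y [ain /allpairsP [[w d] [/= win din ->]] ->]]] /=.
  have /mem_shift_perms [wA wE] := win; have [dA dc] := proj1 (mem_patterns _ (sub_lt a)) din.
  rewrite mem_enum inE in ain; split=> // r; rewrite wE -row_mnmE // dc mnmBE -mulrDr.
  by rewrite -PoszD subnKC //; move/mnm_lepP: ain.
case: x => w d /= [wA dA E].
have le i : (row_mnm d i <= c i)%N.
  have := E (i : nat)%:Z; rewrite -row_mnmE // res_ord; have := energy_ge0 (i : nat)%:Z wA => e0 Ei.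
  by rewrite -lez_nat -(ler_pM2l (_ : 0 < M * 2)) -?Ei ?lerDr // mulr_gt0 // period_gt0.
have dle : (row_mnm d <= c)%MM by apply/mnm_lepP.
have aP := sub_lt (row_mnm d).
apply/allpairsPdep; exists (BMultinom aP), (w, d); split=> //.
  by rewrite mem_enum inE /= lem_subr.
apply/allpairsP; exists (w, d); split=> //=.
  apply/mem_shift_perms; split=> // r; have := E r; rewrite -row_mnmE // => Er.
  by rewrite mnmBE -subzn // mulrBr -Er addrK.
apply/mem_patterns; first exact: sub_lt.
by split=> //; apply/mnmP => i; rewrite !mnmBE subKn.
Qed.

Lemma states_uniq c : uniq (states c).
Proof.
apply: allpairs_uniq_dep => [|a _|].
- exact: enum_uniq.
- apply: allpairs_uniq; [exact: shift_perms_uniq|exact: patterns_uniq|].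
  by move=> [? ?] [? ?] _ _ /= [-> ->].
- move=> p q /allpairsPdep [a [x [_ xin ->]]] /allpairsPdep [b [y [_ yin ->]]] /= xy.
  rewrite -{y}xy in yin *; suff -> : a = b by [].
  have [[w d] [/= /mem_shift_perms [_ wa] _ xE]] := allpairsP xin.
  have [[w' d'] [/= /mem_shift_perms [_ wb] _ xE']] := allpairsP yin.
  have [ww _] : (w, d) = (w', d') by rewrite -xE.
  apply: val_inj; apply/mnmP => i; have := wa (i : nat)%:Z; rewrite ww wb res_ord => E.
  have Mnz : M * 2 != 0 by rewrite mulf_neq0 // lt0r_neq0 // period_gt0.
  by have [] := mulfI Mnz E.
Qed.

Definition shift_sum (a : 'X_{1..n}) : int := \sum_(w <- shift_perms a) affsgn w.

Lemma sum_states c : \sum_(x <- states c) affsgn x.1 =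
  \sum_(a : 'X_{1..n < (mdeg c).+1} | (a <= c)%MM) shift_sum a * (pattern_count (c - a)%MM)%:Z.
Proof.
rewrite /states big_allpairs_dep big_enum /=; apply: eq_bigr => a ac.
rewrite big_allpairs_dep /shift_sum mulr_suml; apply: eq_bigr => w _ /=.
have lt : (mdeg (c - a)%MM < (mdeg c).+1)%N by rewrite ltnS; apply: lem_mdeg; apply: lem_subr.
by rewrite big_const_seq count_predT iter_addr addr0 (size_patterns lt) -[LHS]mulr_natr natz.
Qed.

Definition bad (x : (int -> int) * pattern) : Prop := exists i j, viol x.1 x.2 i j.

Definition selected (x : (int -> int) * pattern) : int * int :=
  xget (0, 0) [set ij | sel_viol x.1 x.2 ij.1 ij.2].

Definition swap_state (x : (int -> int) * pattern) : (int -> int) * pattern :=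
  (swap_perm x.1 (selected x).2, swap_pattern x.1 x.2 (selected x).1 (selected x).2).

Lemma selectedP c x : state c x.1 x.2 -> bad x ->
  sel_viol x.1 x.2 (selected x).1 (selected x).2.
Proof.
move=> [[w_per _ _] dA _] [i0 [j0 V]].
have [i [j S]] := sel_viol_exists w_per dA V.
by apply: (xgetPex (0, 0) (P := [set ij | sel_viol x.1 x.2 ij.1 ij.2])); exists (i, j).
Qed.

Lemma swap_stateP c x : state c x.1 x.2 -> bad x ->
  [/\ state c (swap_state x).1 (swap_state x).2, bad (swap_state x), swap_state (swap_state x) = x
    & affsgn (swap_state x).1 = - affsgn x.1].
Proof.
move=> xS xB; have S := selectedP xS xB; have [wA dA E] := xS; have [w_per _ _] := wA.
move: S; case Es : (selected x) => [i j] /= S; have [mn _ _] := S.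
have S' : sel_viol (swap_state x).1 (swap_state x).2 i j.
  by rewrite /swap_state Es; apply/swap_sel_viol.
have st' : state c (swap_state x).1 (swap_state x).2.
  rewrite /swap_state Es /=; split; [exact: swap_affperm|exact: swap_pattern_affGT|move=> r].
  rewrite swap_energy // (swap_row_sum w_per dA mn) -E; case: ifP => _; ring.
have B' : bad (swap_state x) by exists i, j; case: S' => -[].
have Es' : selected (swap_state x) = (i, j).
  have [wA' dA' _] := st'; have [w_per' _ _] := wA'.
  have := selectedP st' B'; case: (selected _) => a b /= Sab.
  by have [-> ->] := sel_viol_uniq dA' Sab S'.
split=> //; last by rewrite /swap_state Es /= swap_sgn.
rewrite {1}/swap_state Es' /swap_state Es /= swap_permK swap_patternK //.
by case: (x).
Qed.

(** Far from the diagonal the heights are [eo (w p)], so without violations [w] is strictly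
    increasing; periodicity forces steps of exactly one, and the zero displacement sum leaves the
    identity. *)
Lemma not_bad_id w d : affperm w -> affGT n d -> ~ bad (w, d) -> w = id.
Proof.
move=> [w_per w_inj w_sum] [_ _ _ [N dN]] good.
have step p : w p + 1 <= w (p + 1).
  have d0 i : p + N <= i -> d i p = 0%N /\ d (i + 1) (p + 1) = 0%N.
    by move=> Ni; split; apply: dN; lia.
  have lt : height w d (Num.max (p + N) p) p < height w d (Num.max (p + N) p + 1) (p + 1).
    rewrite ltNge; apply/negP => ge; apply: good; exists (Num.max (p + N) p), p.
    by split=> //=; rewrite le_max lexx orbT.
  move: lt; rewrite /height; have [|-> ->] := d0 (Num.max (p + N) p).
    by rewrite le_max lexx.
  rewrite !add0r => lt; rewrite leNgt; apply/negP => gt.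
  have : eo (w (p + 1)) <= eo (w p) by apply: eo_mono; lia.
  by rewrite leNgt lt.
have steps p (q : nat) : w p + q%:Z <= w (p + q%:Z).
  elim: q => [|q IH]; first by rewrite !addr0.
  have := step (p + q%:Z); rewrite (_ : p + q.+1%:Z = p + q%:Z + 1); last by lia.
  by move: IH; lia.
have tight p (q : nat) : (q <= n)%N -> w (p + q%:Z) = w p + q%:Z.
  move=> qn; have := steps p q; have := steps (p + q%:Z) (n - q)%N.
  by rewrite (_ : p + q%:Z + (n - q)%N%:Z = p + n%:Z) ?w_per; lia.
have := w_sum 0; rewrite (eq_bigr (fun=> w 0)); last first.
  by move=> q _; rewrite tight ?addrK // ltnW.
rewrite sumr_const card_ord => /eqP; rewrite mulrn_eq0 /= => /eqP w0.
apply/funext => p; have [m ->] : exists m, p = (res p : nat)%:Z + n%:Z * m.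
  by apply: res_eq; rewrite res_ord.
rewrite w_perM //; congr (_ + _); have := tight 0 (res p); rewrite w0 !add0r; apply.
exact: ltnW.
Qed.

Lemma not_bad_interlacing d : ~ bad (id, d) <-> interlacing gap d.
Proof.
have E (i j : int) : (height id d (i + 1) (j + 1) <= height id d i j) =
    ~~ (d i j <= d (i + 1)%R (j + 1)%R + gap j)%N.
  by rewrite /height /= -ltnNge -ltz_nat PoszD gapE; apply/idP/idP; lia.
split=> [good i j ji|dI [i [j [ji]]]].
  by apply: contrapT => /negP; rewrite -E => le; apply: good; exists i, j.
by rewrite E dI.
Qed.

Theorem interlacing_count_conv c : (interlacing_count gap c)%:Z =
  \sum_(a : 'X_{1..n < (mdeg c).+1} | (a <= c)%MM) shift_sum a * (pattern_count (c - a)%MM)%:Z.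
Proof.
rewrite -sum_states (bigID (fun x => `[< bad x >])) /= -[X in _ = X + _]big_filter.
rewrite (@sum_involution _ _ _ swap_state) ?filter_uniq ?states_uniq // => [|x]; last first.
  rewrite !mem_filter => /andP[/asboolP xB /mem_states xS].
  have [xS' xB' xK xs] := swap_stateP xS xB; split=> //.
  by apply/andP; split; [apply/asboolP|apply/mem_states].
rewrite add0r -big_filter.
rewrite (perm_big [seq (id : int -> int, d) | d <- interlacing_patterns gap c]) /=.
  rewrite big_map /= big_const_seq count_predT iter_addr addr0 affsgn_id.
  by rewrite /interlacing_count natz.
apply: uniq_perm; first by rewrite filter_uniq // states_uniq.
  by rewrite map_inj_uniq ?interlacing_patterns_uniq // => d1 d2 [].
have e0 r : energy id r = 0 by rewrite /energy big1 // => q _; rewrite subrr.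
have Mnz : M * 2 != 0 by rewrite mulf_neq0 // lt0r_neq0 // period_gt0.
have idA : affperm id by split=> // r; rewrite big1 // => q _; rewrite subrr.
move=> [w d]; apply/idP/mapP => [|[d0 /mem_interlacing_patterns [dA dI dc] [-> ->]]].
  rewrite mem_filter => /andP[/asboolPn good /mem_states [/= wA dA E]].
  have wE := not_bad_id wA dA good; subst w; exists d => //.
  apply/mem_interlacing_patterns; split=> //; first exact/not_bad_interlacing.
  apply/mnmP => i; have := E (i : nat)%:Z; rewrite e0 add0r res_ord -row_mnmE // res_ord.
  by move/(mulfI Mnz) => [].
rewrite mem_filter; apply/andP; split; first by apply/asboolPn/not_bad_interlacing.
by apply/mem_states; split=> //= r; rewrite e0 add0r -row_mnmE // dc.
Qed.

End LatticePaths.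

(** * Patterns with mu = 0 *)

Section ConstantRows.
Variable T : nat.

(** Partitions of N written by multiplicities: [f k] parts of size k + 1. *)
Definition part_codes B N :=
  [pred f : {ffun 'I_T -> 'I_B} | (\sum_(k < T) k.+1 * f k)%N == N].

Lemma sum_arc k (j : I) : (\sum_(i : I) arc k i j)%N = k.
Proof.
rewrite (eq_bigr (fun i : I => \sum_(l < k) ((i + l%:R)%R == j))%N); last first.
  by move=> i _; rewrite /arc mnm_sumE; apply: eq_bigr => l _; rewrite mnm1E.
rewrite exchange_big /= (eq_bigr (fun=> 1%N)) ?sum_nat_const ?card_ord ?muln1 // => l _.
rewrite (bigD1 (j - l%:R)) //= subrK eqxx big1 ?addn0 // => i /negPf.
by move=> E; rewrite [i + _ == _]eq_sym -subr_eq eq_sym E.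
Qed.

Definition decode1 (f : 'I_T -> nat) : pattern := decode (fun p : 'I_T * I => f p.1).

Lemma row_mnm_decode1 f : row_mnm (decode1 f) = (delta_mnm n' *+ (\sum_(k < T) k.+1 * f k))%MM.
Proof.
apply/mnmP => j; rewrite delta_mnmE mnmE row_sum_decode.
rewrite -(pair_bigA _ (fun (k : 'I_T) (i : I) => arc k.+1 i (res j%:Z) * f k)%N) /=.
by apply: eq_bigr => k _; rewrite -big_distrl /= sum_arc.
Qed.

Lemma decode1_interlacing f : interlacing (fun=> 0%N) (decode1 f).
Proof.
move=> i j ji; rewrite addn0 /decode1 /decode ltrD2r ltNge ji /=.
by rewrite (_ : i + 1 - (j + 1) = i - j) //; ring.
Qed.
End ConstantRows.

(** Along a diagonal the entries weakly increase by interlacing and return after n steps by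
    periodicity, so they are constant. *)
Lemma interlacing0_column d k i : affGT n d -> interlacing (fun=> 0%N) d ->
  column d k i = column d k 0.
Proof.
move=> [_ _ dp _] dI.
have up (q : nat) (a b : int) : b <= a -> (d a b <= d (a + q%:Z)%R (b + q%:Z)%R)%N.
  move=> ba; elim: q => [|q IH]; first by rewrite !addr0.
  apply: leq_trans IH _; have := dI (a + q%:Z) (b + q%:Z); rewrite addn0 lerD2r => /(_ ba).
  by rewrite -!addrA (_ : q%:Z + 1 = q.+1%:Z) //; lia.
have stepE (a b : int) : b <= a -> d (a + 1) (b + 1) = d a b.
  move=> ba; apply/eqP; rewrite eqn_leq; apply/andP; split; last exact: (up 1%N).
  have := up n'.+2 (a + 1) (b + 1); rewrite lerD2r => /(_ ba).
  by rewrite -!addrA (_ : 1 + n'.+2%:Z = n%:Z) ?dp //; lia.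
have shiftE (q : nat) (a b : int) : b <= a -> d (a + q%:Z) (b + q%:Z) = d a b.
  move=> ba; elim: q => [|q IH]; first by rewrite !addr0.
  rewrite -[RHS]IH -[RHS]stepE ?lerD2r // -!addrA (_ : q%:Z + 1 = q.+1%:Z) //; lia.
rewrite /column; have := shiftE (nat_of_ord i) k%:Z 0; rewrite add0r addrC add0r; apply.
by rewrite lez_nat.
Qed.

Lemma interlacing0_count c : interlacing_count (fun=> 0%N) c =
  if [forall i, c i == c 0] then #|part_codes (mdeg c).+1 (mdeg c).+1 (c 0)| else 0%N.
Proof.
set T := (mdeg c).+1.
have codeE d : affGT n d -> interlacing (fun=> 0%N) d -> row_mnm d = c ->
    d = decode1 (fun k : 'I_T => column d k 0%R - column d k.+1 0%R)%N.
  move=> dA dI dc; rewrite -[LHS](decodeK (T := T) dA) ?dc //; congr decode.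
  by apply/funext => p; rewrite !(interlacing0_column _ p.2 dA dI).
have [cc|ncc] := ifPn; last first.
  rewrite /interlacing_count; case E : interlacing_patterns => [|d s] //.
  have /mem_interlacing_patterns [dA dI dc] : d \in interlacing_patterns (fun=> 0%N) c.
    by rewrite E inE eqxx.
  move: ncc; rewrite -dc (codeE d dA dI dc) row_mnm_decode1 => /negP []; apply/forallP => i.
  by rewrite !delta_mnmE.
rewrite cardE -(size_map (fun f : {ffun 'I_T -> 'I_T} => decode1 (fun k => val (f k)))).
apply: perm_size; apply: uniq_perm; first exact: interlacing_patterns_uniq.
  rewrite map_inj_uniq ?enum_uniq // => f1 f2 E; apply/ffunP => k; apply: val_inj => /=.
  have := encodeK (fun p : 'I_T * I => val (f1 p.1)) (k, 0) => /= <-.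
  by rewrite -/(decode1 (fun k => val (f1 k))) E /decode1 (encodeK _ (k, 0)).
move=> d; apply/idP/mapP => [/mem_interlacing_patterns [dA dI dc]|[f]].
  have fT (k : 'I_T) : (column d k 0%R - column d k.+1 0%R < T)%N.
    by rewrite ltnS (leq_trans (leq_subr _ _)) // -dc column_leq.
  exists [ffun k => Ordinal (fT k)]; last first.
    by rewrite {1}(codeE d dA dI dc); congr decode1; apply/funext => k; rewrite ffunE.
  rewrite mem_enum inE; apply/eqP; rewrite -dc {3}(codeE d dA dI dc) row_mnm_decode1 delta_mnmE.
  by apply: eq_bigr => k _; rewrite ffunE.
rewrite mem_enum inE => fN ->; apply/mem_interlacing_patterns.
split; [exact: decode_affGT|exact: decode1_interlacing|].
by apply/eqP; rewrite row_mnm_decode1 delta_mnm_eq cc.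
Qed.

Lemma coef_congrM (p q p' q' : {poly nat}) N :
  (forall i, (i <= N)%N -> p`_i = p'`_i) -> (forall i, (i <= N)%N -> q`_i = q'`_i) ->
  forall i, (i <= N)%N -> (p * q)`_i = (p' * q')`_i.
Proof.
move=> pp qq i iN; rewrite !coefM; apply: eq_bigr => j _.
by rewrite pp ?qq // (leq_trans _ iN) // ?leq_subr // -ltnS.
Qed.

(** More factors or longer geometric sums do not affect the coefficient of degree N, so the
    truncation in [fock_coef] can be exchanged for any sufficient one. *)
Lemma fock_coefE T B N : (N <= T)%N -> (N < B)%N -> fock_coef N = #|part_codes T B N|.
Proof.
pose F B k : {poly nat} := \sum_(j < B) 'X^(k.+1 * j).
have cardE' : #|part_codes T B N| = (\prod_(k < T) F B k)`_N.
  rewrite /F bigA_distr_bigA /= coef_sum -sum1_card big_mkcond /=; apply: eq_bigr => f _.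
  by rewrite -expr_sum coefXn inE eq_sym; case: eqP.
have trunc B1 B2 k i : (i < B1)%N -> (i < B2)%N -> (F B1 k)`_i = (F B2 k)`_i.
  suff half A C : (i < A)%N -> (A <= C)%N -> (F A k)`_i = (F C k)`_i.
    by move=> i1 i2; case: (leqP B1 B2) => [|/ltnW] le; [|symmetry]; apply: half.
  move=> iA leAC; rewrite /F (big_ord_widen C (fun j => 'X^(k.+1 * j)) leAC) !coef_sum big_mkcond /=.
  apply: eq_bigr => j _; case: ltnP => // Aj; rewrite coefXn.
  by case: eqP => // ij; move: (leq_trans iA Aj); rewrite ij mulSn ltnNge leq_addr.
have one k i : (i < k.+1)%N -> (F N.+1 k)`_i = (1 : {poly nat})`_i.
  move=> ik; rewrite /F big_ord_recl muln0 expr0 coefD coef_sum big1 ?addr0 // => j _.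
  rewrite coefXn; case: eqP => // ij; move: ik.
  by rewrite ij /bump /= mulnC -ltn_divRL // divnn /= ltnS.
move=> NT NB; rewrite cardE' /fock_coef big_add1 /= big_mkord.
have bigF (G : nat -> {poly nat}) t : (t <= T)%N ->
    (forall k i, (i <= N)%N -> (G k)`_i = (F N.+1 k)`_i) ->
    forall i, (i <= N)%N -> (\prod_(k < t) G k)`_i = (\prod_(k < t) F N.+1 k)`_i.
  move=> _ HG; elim: t => [|t IH] i iN; first by rewrite !big_ord0.
  by rewrite !big_ord_recr /=; apply: (coef_congrM (N := N)) => //; apply: HG.
rewrite (bigF (F B) T) // => [|k i iN]; last by apply: trunc => //; apply: leq_ltn_trans NB.
have -> : (\prod_(m < N) \sum_(0 <= j < N.+1) 'X^(m.+1 * j) : {poly nat}) = \prod_(k < N) F N.+1 k.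
  by apply: eq_bigr => k _; rewrite big_mkord.
suff H t i : (i <= N)%N -> (\prod_(k < N) F N.+1 k)`_i = (\prod_(k < N + t) F N.+1 k)`_i.
  by rewrite -(subnKC NT); apply: H.
move=> iN; elim: t => [|t IH]; first by rewrite addn0.
rewrite addnS big_ord_recr /= IH.
transitivity ((\prod_(k < N + t) F N.+1 k) * 1)`_i; first by rewrite mulr1.
symmetry; apply: (coef_congrM (N := N)) => // l lN; apply: one.
by rewrite ltnS (leq_trans lN) ?leq_addr.
Qed.

Lemma mcoeff_fock_series (F : numFieldType) T c : (mdeg c < T)%N ->
  (fock_series n' F T)@_c = (fock_mult fock_coef c)%:R.
Proof.
move=> cT; have -> : fock_mult fock_coef c =
    if [forall i, c i == c 0] then #|part_codes T T (c 0)| else 0%N.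
  rewrite /fock_mult; case: ifP => // _; have c0T := leq_ltn_trans (mnm_le_mdeg c 0) cT.
  by apply: fock_coefE => //; apply: ltnW.
rewrite /fock_series /geom bigA_distr_bigA /= linear_sum /=.
rewrite (eq_bigr (fun f : {ffun 'I_T -> 'I_T} =>
    ([forall i, c i == c 0] && (f \in part_codes T T (c 0)))%:R)).
  case: ifP => cc; last by rewrite big1.
  by rewrite -sum1_card natr_sum [RHS]big_mkcond; apply: eq_bigr => f _; case: (f \in _).
move=> f _; rewrite -mpolyX_big mcoeffX -[in RHS]topredE /= -delta_mnm_eq.
congr ((_ == c)%:R); apply/mnmP => i; rewrite mnm_sumE delta_mnmE.
by apply: eq_bigr => k _; rewrite !mulmnE mnmE mul1n.
Qed.

End PatternCoding.

Lemma card_uniq_seq (T : eqType) (s : seq T) : uniq s -> ([set` s] #= `I_(size s))%card.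
Proof.
elim: s => [_|x s IH /= /andP[xs us]].
  by rewrite (_ : [set` [::]] = set0) ?II0 ?card_eqxx //; apply/seteqP; split.
apply/eq_cardSP; exists x; first by rewrite /= inE eqxx.
rewrite (_ : _ `\ x = [set` s]) ?IH //; apply/seteqP; split=> y /=; rewrite inE.
  by move=> [/orP[/eqP ->|//]]; case.
by move=> ys; split; [rewrite ys orbT|move=> yx; rewrite -yx ys in xs].
Qed.

(** * Equality of pattern counts and multiplicities *)

Section CountingIdentity.
Variables (n' : nat) (F : numFieldType).
Local Notation n := n'.+3.
Local Notation I := 'I_n'.+3.
Variables (eo : int -> int) (M : int).
Hypothesis eo_lt : forall j, eo j < eo (j + 1).
Hypothesis eo_per : forall j, eo (j + n%:Z) = eo j + M.
Local Notation lam := (fun i : I => gap eo (i : nat)%:Z).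
Variables (m : 'X_{1..n} -> nat) (t : nat -> I -> 'X_{1..n} -> F).
Hypothesis mult0 : m 0%MM = 1%N.
Hypothesis mult_reflect : forall i (c c' : 'X_{1..n}), (forall j, j != i -> c' j = c j) ->
  (c i + c' i = lam i + c (i + 1)%R + c (i - 1)%R)%N -> m c = m c'.
Hypothesis mult_out : forall i (c : 'X_{1..n}), (lam i + c (i + 1)%R + c (i - 1)%R < c i)%N -> m c = 0%N.
Hypothesis trace_rec : forall k i c, t k i c = if (arc k.+1 i <= c)%MM then
    t k i (c - arc k.+1 i)%MM
    + kappa F lam k.+1 i (c - arc k.+1 i)%MM * (m (c - arc k.+1 i)%MM)%:R
  else 0.
Hypothesis trace_sum : forall (c : 'X_{1..n}) T, (mdeg c <= T.+1)%N ->
  \sum_(k < T.+1) \sum_i t k i c = casimir_val F lam c * (m c)%:R.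

Lemma interlacing_count_conv_field (e : int -> int) (Q : int) (c : 'X_{1..n}) :
  (forall j, e j < e (j + 1)) -> (forall j, e (j + n%:Z) = e j + Q) ->
  (interlacing_count (gap e) c)%:R =
  \sum_(a : 'X_{1..n < (mdeg c).+1} | (a <= c)%MM)
    (shift_sum e Q a)%:~R * (pattern_count (c - a)%MM)%:R :> F.
Proof.
move=> e_lt e_per; have := interlacing_count_conv e_lt e_per c.
move=> /(congr1 (fun x : int => x%:~R : F)); rewrite -pmulrn => ->.
rewrite (rmorph_sum (intmul (1 : F))) /=; apply: eq_bigr => a _.
by rewrite intrM.
Qed.

Lemma shift_sum_casimir (e : int -> int) (Q : int) (a : 'X_{1..n}) :
  (forall j, e j < e (j + 1)) -> (forall j, e (j + n%:Z) = e j + Q) ->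
  (shift_sum e Q a)%:~R != 0 :> F ->
  casimir_val F (fun i : I => gap e (i : nat)%:Z) a = 0.
Proof.
move=> e_lt e_per; rewrite intr_eq0 /shift_sum; case E : shift_perms => [|w s].
  by rewrite big_nil eqxx.
have wa : w \in shift_perms e Q a by rewrite E inE eqxx.
by move=> _; apply: shifts_casimir (proj1 (mem_shift_perms e_lt e_per w a) wa).
Qed.

Lemma gap_id : gap id = fun=> 0%N.
Proof. by apply/funext => j; rewrite /gap (_ : id (j + 1) - id j - 1 = 0) //=; ring. Qed.

Theorem interlacing_count_eq c : interlacing_count (gap eo) c = mult_fock m fock_coef c.
Proof.
(* The Fock side is the instance [eo = id] with period n, that is, mu = 0 and K = 0. *)
have id_lt (j : int) : id j < id (j + 1) by rewrite ltrDl.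
have id_per (j : int) : id (j + n%:Z) = id j + n%:Z by [].
have fockE a : fock_mult fock_coef a = interlacing_count (gap id) (a : 'X_{1..n}).
  rewrite gap_id interlacing0_count /fock_mult; case: ifP => // _.
  by apply: fock_coefE; rewrite ?ltnS ?(leqW (mnm_le_mdeg _ _)) ?mnm_le_mdeg.
apply: (multiplicities_agree mult0 mult_reflect mult_out trace_rec trace_sum
  (D := @pattern_count n') (N := fun a => (shift_sum eo M a)%:~R)
  (N0 := fun a => (shift_sum id n%:Z a)%:~R)).
- exact: interlacing_count0.
- by have := fockE 0%MM; rewrite interlacing_count0 /fock_mult mnm0E; case: ifP.
- by move=> i a a'; apply: interlacing_reflect; apply: gap_per.
- by move=> i a; apply: interlacing_out; apply: gap_per.
- exact: mcoeff_pattern_series.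
- exact: mcoeff_fock_series.
- by move=> a; apply: interlacing_count_conv_field.
- by move=> a; apply: shift_sum_casimir.
- by move=> a; rewrite fockE; apply: interlacing_count_conv_field.
- move=> a /(shift_sum_casimir id_lt id_per) <-; by rewrite gap_id.
Qed.
End CountingIdentity.

(** * The strictly increasing sequence attached to mu *)

Section Shifted.
Variables (n' K : nat) (mu : n'.+3.-tuple int).
Local Notation n := n'.+3.
Hypothesis mu_adm : mu_admissible K mu.

Definition strict_mu (j : int) : int := j - mu_tilde K mu j.

Lemma mu_tilde_per (j : int) : mu_tilde K mu (j + n%:Z) = mu_tilde K mu j - K%:Z.
Proof.
rewrite /mu_tilde (_ : - (j + n%:Z) = (-1) * n%:Z + (- j)); last by ring.
by rewrite modzMDl divzMDl // ; ring.
Qed.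

(** A step inside a period uses the inequalities within mu; the step out of residue 0 uses the
    wrap-around inequality with K. *)
Lemma mu_tilde_le (j : int) : mu_tilde K mu (j + 1) <= mu_tilde K mu j.
Proof.
have [mu_dec mu_wrap] := mu_adm.
pose q := ((- j) %/ n%:Z)%Z; pose r := ((- j) %% n%:Z)%Z.
have jE : - j = q * n%:Z + r := divz_eq _ _.
have r0 : 0 <= r by rewrite modz_ge0.
have rn : r < n%:Z by rewrite ltz_pmod.
rewrite /mu_tilde -/q -/r; have [r1|r1] := leP 1 r.
  have -> : - (j + 1) = q * n%:Z + (r - 1) by rewrite opprD jE; ring.
  have rb : 0 <= r - 1 < n%:Z by lia.
  rewrite modzMDl divzMDl // (@divz_small _ n%:Z rb) (modz_small rb).
  rewrite addr0 lerD2r opprB addrC; apply: mu_dec; lia.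
have rE : r = 0 by lia.
have -> : - (j + 1) = (q - 1) * n%:Z + (n%:Z - 1) by rewrite opprD jE rE; ring.
have n1 : 0 <= n%:Z - 1 < n%:Z by lia.
rewrite modzMDl divzMDl // (@divz_small _ n%:Z n1) (modz_small n1).
rewrite rE oppr0 opprB addr0 mulrBl mul1r; by rewrite addrCA [leRHS]addrC lerD2l lerBlDr.
Qed.

Lemma strict_mu_lt (j : int) : strict_mu j < strict_mu (j + 1).
Proof. by rewrite /strict_mu; have := mu_tilde_le j; lia. Qed.

Lemma strict_mu_per (j : int) : strict_mu (j + n%:Z) = strict_mu j + (K%:Z + n%:Z).
Proof. by rewrite /strict_mu mu_tilde_per; ring. Qed.

Lemma gap_strict_mu (j : int) : (gap strict_mu j)%:Z = mu_tilde K mu j - mu_tilde K mu (j + 1).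
Proof. by rewrite (gapE strict_mu_lt) /strict_mu; ring. Qed.

(** The inequality for a shift by l is the l-fold iterate of the one for l = 1. *)
Lemma affGTmuE d : affGTmu K mu d <-> affGT n d /\ interlacing (gap strict_mu) d.
Proof.
split=> [[dA dI]|[dA dI]].
  split=> // i j ji; have := dI i j 1 ji isT; have := gap_strict_mu j; lia.
split=> // i j l ji l0; rewrite -[l](gez0_abs l0).
elim: (absz l) => [|q IH]; first by rewrite !addr0.
apply: le_trans IH _; have := dI (i + q%:Z) (j + q%:Z); rewrite lerD2r => /(_ ji).
have := gap_strict_mu (j + q%:Z).
have qE x : x + q%:Z + 1 = x + q.+1%:Z by rewrite -addrA; congr (_ + _); lia.
rewrite !qE; move: (d _ _) (d _ _) (mu_tilde _ _ _) (mu_tilde _ _ _) (gap _ _) => a b x y z.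
lia.
Qed.
End Shifted.

(** * Formal characters *)

Section Characters.
Variables (n' : nat) (F : numFieldType) (Lam : weight F n'.+3).
Local Notation n := n'.+3.
Local Notation I := 'I_n'.+3.
Implicit Types c : 'X_{1..n}.

(** Extends a function of root coefficients by zero to all weights; injectivity of [lower_wt] makes
    the chosen coefficients unique. *)
Definition lower_char (f : 'X_{1..n} -> nat) : fchar F n := fun l =>
  if pselect (exists c, lower_wt Lam c = l) is left e then f (projT1 (cid e)) else 0%N.

Hypothesis inj : injective (lower_wt Lam).

Lemma lower_charE f c : lower_char f (lower_wt Lam c) = f c.
Proof.
rewrite /lower_char; case: pselect => [e|[]]; last by exists c.
by congr f; apply: inj; exact: projT2 (cid e).
Qed.

Lemma lower_char0 f l : (forall c, lower_wt Lam c <> l) -> lower_char f l = 0%N.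
Proof. by move=> H; rewrite /lower_char; case: pselect => // e; case: (H _ (projT2 (cid e))). Qed.

Lemma lower_wt_dec l : (exists c, l = lower_wt Lam c) \/ (forall c, lower_wt Lam c <> l).
Proof.
have [[c <-]|H] := pselect (exists c, lower_wt Lam c = l); first by left; exists c.
by right=> c E; apply: H; exists c.
Qed.

Lemma delta_mul_inj : injective (fun N => delta F n *+ N).
Proof.
have d2 N : (delta F n *+ N).2 = N%:R.
  have -> : (delta F n *+ N).2 = (delta F n).2 *+ N by exact: (raddfMn (@snd _ F)).
  rewrite /delta weight2_sum (bigD1 (0 : I)) //= big1 ?addr0 // => i i0.
  by case: eqP => // E; case/eqP: i0; apply: val_inj.
move=> N N' /(congr1 snd); rewrite !d2 => /eqP; by rewrite eqr_nat => /eqP.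
Qed.

Lemma fock_charE N : fock_char F n (- (delta F n *+ N)) = fock_coef N.
Proof.
rewrite /fock_char (_ : [set N' | _] = [set N]) ?fsbig_set1 //.
by apply/seteqP; split=> N' /=; [move/oppr_inj/delta_mul_inj|move->].
Qed.

Lemma fock_char_neq0 l : fock_char F n l != 0%N -> exists N, l = - (delta F n *+ N).
Proof.
move=> nz; apply: contrapT => H; case/eqP: nz; rewrite /fock_char fsbig1 // => N /= E.
by case: H; exists N.
Qed.

Lemma lower_wt_delta c N :
  lower_wt Lam (c + delta_mnm n' *+ N)%MM = lower_wt Lam c - delta F n *+ N.
Proof.
rewrite /lower_wt -addrA -opprD; congr (_ - _).
rewrite /delta -sumrMnl -big_split; apply: eq_bigr => i _ /=.
by rewrite mnmDE delta_mnmE mulrnDr.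
Qed.

(** A nonzero term has second factor - q delta and is determined by q; [s] lists the pairs with q
    delta below [c]. *)
Lemma fock_product (m : 'X_{1..n} -> nat) :
  is_fprod (lower_char m) (fock_char F n) (lower_char (mult_fock m fock_coef)).
Proof.
have supp l p : p.1 + p.2 = l -> (lower_char m p.1 * fock_char F n p.2 != 0)%N ->
    exists c N, [/\ l = lower_wt Lam (c + delta_mnm n' *+ N)%MM, p.1 = lower_wt Lam c
      & p.2 = - (delta F n *+ N)].
  move=> <-; rewrite muln_eq0 negb_or => /andP[m0 /fock_char_neq0 [N ->]].
  have [[c ->]|H] := lower_wt_dec p.1; last by rewrite lower_char0 in m0.
  by exists c, N; rewrite lower_wt_delta.
move=> l; have [[c ->]|out] := lower_wt_dec l; last first.
  have none p : p.1 + p.2 = l -> (lower_char m p.1 * fock_char F n p.2)%N = 0%N.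
    move=> E; apply/eqP; apply: contrapT => /negP /(supp _ _ E) [c [N [lE _ _]]].
    exact: (out _ (esym lE)).
  split; last by rewrite lower_char0 // fsbig1.
  rewrite (_ : [set p | _] = set0) //; apply/seteqP; split=> // p [/none E].
  by rewrite E.
pose s := [seq (lower_wt Lam (c - delta_mnm n' *+ q)%MM, - (delta F n *+ q))
          | q <- [seq q <- iota 0 (c 0).+1 | (delta_mnm n' *+ q <= c)%MM]].
have ssum q : (delta_mnm n' *+ q <= c)%MM ->
    lower_wt Lam (c - delta_mnm n' *+ q)%MM - delta F n *+ q = lower_wt Lam c.
  by move=> qc; rewrite -lower_wt_delta submK.
have suppc p : p.1 + p.2 = lower_wt Lam c ->
    (lower_char m p.1 * fock_char F n p.2 != 0)%N -> p \in s.
  move=> E /(supp _ _ E) [a [N [/inj cE p1 p2]]]; apply/mapP; exists N; last first.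
    by rewrite cE addmK -p1 -p2; case: (p).
  by rewrite cE mem_filter lem_addl mem_iota /= add0n ltnS mnmDE delta_mnmE leq_addl.
have us : uniq s.
  rewrite map_inj_uniq ?filter_uniq ?iota_uniq // => q q' /(congr1 snd) /= /oppr_inj.
  exact: delta_mul_inj.
split.
  apply: (sub_finite_set (B := [set` s])); last exact: finite_seq.
  by move=> p [/suppc H /H].
rewrite lower_charE (fsbigE s) //.
- rewrite big_map big_filter_cond -[iota _ _]/(index_iota 0 (c 0).+1) big_mkord /mult_fock.
  apply: eq_big => [q|q qc]; last by rewrite /= lower_charE fock_charE.
  by rewrite andb_idr // => qc; rewrite inE /=; apply: ssum.
- by move=> p /= /mapP [q]; rewrite mem_filter => /andP[qc _] -> /=; apply: ssum.
- move=> p /= E ps; apply/eqP; apply: contraNT ps; exact: suppc.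
Qed.
End Characters.

Section AffineCharacter.
Variables (n' K : nat) (F : numFieldType) (mu : n'.+3.-tuple int).
Local Notation n := n'.+3.
Local Notation I := 'I_n'.+3.
Hypothesis mu_adm : mu_admissible K mu.
Local Notation Lam := (Lambda_mu F K mu).
Local Notation eo := (strict_mu K mu).

Lemma Lambda_mu1 (i : I) : Lam.1 0 i = (gap eo (i : nat)%:Z)%:R.
Proof.
have coord (j : I) z : (fund_weight F j *~ z).1 0 i = (i == j)%:R * z%:~R.
  have -> : (fund_weight F j *~ z).1 = (fund_weight F j).1 *~ z by exact: (raddfMz (@fst _ F)).
  by rewrite -scaler_int !mxE eqxx mulrC.
rewrite /Lambda_mu weight1_sum (bigD1 i) //= big1 => [|j ji].
  by rewrite coord eqxx mul1r addr0 -gap_strict_mu // -pmulrn.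
by rewrite coord eq_sym (negPf ji) mul0r.
Qed.

Lemma Lambda_mu2 : Lam.2 = 0.
Proof.
rewrite /Lambda_mu weight2_sum big1 // => j _.
have -> (z : int) : (fund_weight F j *~ z).2 = (fund_weight F j).2 *~ z.
  exact: (raddfMz (@snd _ F)).
by rewrite mul0rz.
Qed.

Lemma pattern_weightE d : pattern_weight F K mu d = lower_wt Lam (row_mnm n' d).
Proof. by rewrite /pattern_weight /lower_wt; congr (_ - _); apply: eq_bigr => i _; rewrite mnmE. Qed.
Lemma pattern_fsum :
  is_fsum (affGTmu K mu) (pattern_weight F K mu) (lower_char Lam (@interlacing_count n' (gap eo))).
Proof.
have inj := lower_wt_inj Lambda_mu1 Lambda_mu2.
move=> l; have [[c ->]|out] := lower_wt_dec Lam l.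
  rewrite lower_charE // (_ : [set d | _] = [set` interlacing_patterns (gap eo) c]).
    exact/card_uniq_seq/interlacing_patterns_uniq.
  apply/seteqP; split=> d /=.
    move=> [/(affGTmuE mu_adm) [dA dI]]; rewrite pattern_weightE => /inj dc.
    exact/mem_interlacing_patterns.
  move=> /mem_interlacing_patterns [dA dI dc]; split; first exact/(affGTmuE mu_adm).
  by rewrite pattern_weightE dc.
rewrite lower_char0 // (_ : [set d | _] = set0) ?II0 ?card_eqxx //.
apply/seteqP; split=> // d /= [_]; rewrite pattern_weightE; exact: out.
Qed.

Theorem affine_character (L : lmodType F) (rho : aff_rep n L) :
  irr_integrable_hw rho Lam ->
  exists chV chL : fchar F n,
    [/\ is_fsum (affGTmu K mu) (pattern_weight F K mu) chV, is_character rho chL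
      & is_fprod chL (fock_char F n) chV].
Proof.
move=> [irr intg [v0 [v0_neq0 v0_wt v0_hi]]].
have inj := lower_wt_inj Lambda_mu1 Lambda_mu2.
have [m [t [[mdim m0] refl out trec tsum]]] :=
  lower_multiplicities Lambda_mu1 Lambda_mu2 irr v0_neq0 v0_wt v0_hi intg.
have countE : @interlacing_count n' (gap eo) = mult_fock m fock_coef.
  apply/funext => c.
  exact: (interlacing_count_eq (strict_mu_lt mu_adm) (strict_mu_per K mu) m0 refl out trec tsum).
exists (lower_char Lam (mult_fock m fock_coef)), (lower_char Lam m); split.
- by rewrite -countE; apply: pattern_fsum.
- move=> l; have [[c ->]|lout] := lower_wt_dec Lam l; first by rewrite lower_charE.
  rewrite lower_char0 //; exists (fun=> 0); split=> [[]//|v vl].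
  have -> : v = 0.
    apply: (weight_space_out irr v0_neq0 v0_wt v0_hi _ vl) => c.
    by apply/eqP => E; apply: (lout c).
  exists 0; split=> [|x _]; first by rewrite big_ord0.
  by rewrite [x]thinmx0.
- exact: fock_product.
Qed.
End AffineCharacter.

Theorem theorem3p26 (R : realType) (n K : nat) (mu : n.-tuple int)
    (hn : (2 < n)%N) (hK : (0 < K)%N) (hmu : mu_admissible K mu)
    (L : lmodType R[i]) (rho : aff_rep n L)
    (hL : irr_integrable_hw rho (Lambda_mu R[i] K mu)) :
  exists chV chL : fchar R[i] n,
    [/\ is_fsum (affGTmu K mu) (pattern_weight R[i] K mu) chV,
        is_character rho chL
      & is_fprod chL (fock_char R[i] n) chV].
Proof.
(* Writing n as n' + 3 gives the residues 'I_n their ring structure, on which all cyclic indexing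
   relies. *)
case: n hn mu hmu rho hL => [|[|[|n']]] // _ mu hmu rho hL.
exact: (affine_character hmu hL).
Qed.
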